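(* For each Platonic solid $\{p,q\}$, with $\omega_n:=1+2\cos\frac{2\pi}{n}$, the full symmetry group $\Gamma_{\{p,q\}}$ admits a linear representation as a discrete orthogonal subgroup $\langle\mathbf R_1,\mathbf R_2,\mathbf R_3,\mathbf S_f\rangle<\mathrm{SL}_4(\mathbb Z[\omega_p,\omega_q])$ with respect to $\mathbf Q_{\{p,q\}}$, where $$\mathbf R_1=\begin{pmatrix}0&1&0&0\\1&0&0&0\\ \omega_p&-\omega_p&1&0\\ \omega_p(\omega_p+\omega_q)+\omega_q&-\omega_p(\omega_p+\omega_q)-\omega_q&0&1\end{pmatrix},$$ $$\mathbf R_2=\begin{pmatrix}1&0&0&0\\ \omega_p&-\omega_p&1&0\\ \omega_p(-1+\omega_p)&1-\omega_p^2&\omega_p&0\\ \omega_p^2(-1+\omega_p+\omega_q)&-\omega_p(1+\omega_p)(-1+\omega_p+\omega_q)&\omega_p(-1+\omega_p+\omega_q)&1\end{pmatrix},$$ $$\mathbf R_3=\begin{pmatrix}1&0&0&0\\0&1&0&0\\ \omega_q&\omega_p&-(\omega_p+\omega_q)&1\\ \omega_q(-1+\omega_p+\omega_q)&\omega_p(-1+\omega_p+\omega_q)&1-(\omega_p+\omega_q)^2&\omega_p+\omega_q\end{pmatrix},$$ $$\mathbf S_f=\begin{pmatrix}1&0&0&0\\0&1&0&0\\0&0&1&0\\2&2(1-\omega_p+\omega_q)&2(1+\omega_p+\omega_q)&-1\end{pmatrix}.$$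
   Context: The matrix $\mathbf Q_{\{p,q\}}$ is $$\mathbf Q_{\{p,q\}}=\begin{pmatrix}1&a&b&-1\\ a&d&c&b\\ b&c&d&a\\ -1&b&a&1\end{pmatrix},\quad a=-1-\omega_p-\omega_q,\ b=-1+\omega_p-\omega_q,\ c=-1-\omega_p^2+\omega_q^2,\ d=(1+\omega_p+\omega_q)^2 .$$ ''Orthogonal with respect to $\mathbf Q_{\{p,q\}}$'' means $\mathbf M^\top\mathbf Q_{\{p,q\}}\mathbf M=\mathbf Q_{\{p,q\}}$ for every element $\mathbf M$ of the group. The Platonic solid $\mathcal P=\{p,q\}$ (Schläfli symbol) has $p$-gonal faces, $q$ of which meet at each vertex; $\{p,q\}\in\{\{3,3\},\{3,4\},\{4,3\},\{3,5\},\{5,3\}\}$. For $v\in\mathbb R^3$ with $\|v\|>1$, the stereographic circle of $v$ is the image under stereographic projection (from the North Pole) of the cap $\{u\in\mathbb S^2:u\cdot v\ge1\}$; it is an oriented circle (disk, exterior of a disk, or half-plane) of $\widehat{\mathbb R^2}=\mathbb R^2\cup\{\infty\}$. Let $\mathcal P_0$ be the canonical realisation of $\mathcal P$, i.e. the regular polyhedron centred at the origin with all edges tangent to $\mathbb S^2$, and let $\mathcal P_0^*=\{u: u\cdot v\le1\ \forall v\in\mathcal P_0\}$ be its polar. A polytopal circle packing induced by $\mathcal P$ is $\mathcal S_{\mathcal P}=\mu\cdot\mathcal A_{\mathcal P_0}$ and its dual arrangement is $\mathcal S_{\mathcal P}^*=\mu\cdot\mathcal A_{\mathcal P_0^*}$,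 where $\mu$ is a Möbius transformation and $\mathcal A_{\mathcal P_0}$, $\mathcal A_{\mathcal P_0^*}$ are the collections of stereographic circles of the vertices of $\mathcal P_0$ and $\mathcal P_0^*$. Let $\langle\mathcal S_{\mathcal P}^*\rangle$ be the group generated by the inversions through the circles of $\mathcal S_{\mathcal P}^*$ and let $\mathfrak S(\mathcal S_{\mathcal P})$ be the group of Möbius transformations (including orientation-reversing ones) preserving $\mathcal S_{\mathcal P}$. The full symmetry group is $\Gamma(\mathcal S_{\mathcal P}):=\langle\mathcal S_{\mathcal P}^*\rangle\rtimes\mathfrak S(\mathcal S_{\mathcal P})$; up to conjugation by Möbius transformations it depends only on $\{p,q\}$ and is denoted $\Gamma_{\{p,q\}}$.
   Formalization: Containment in SL_4(Z[ω_p,ω_q]) is false as stated, since R_1 (and the other generators, which are reflections) has determinant −1; the formal statement instead asserts entries in Z[ω_p,ω_q] and determinant 1 or −1. *)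

(* Defs.v *)
From HB Require Import structures.
From mathcomp Require Import all_boot all_order all_algebra.
From mathcomp Require Import all_classical all_reals all_analysis.

Set Implicit Arguments.
Unset Strict Implicit.
Unset Printing Implicit Defensive.

Import Order.TTheory GRing.Theory Num.Theory.
Import numFieldNormedType.Exports.

Local Open Scope classical_set_scope.
Local Open Scope ring_scope.

(* When the elements of S are invertible, this is the subgroup they generate:
   [generated_inv] adds two-sided inverses only. *)
Inductive generated (T : Type) (mul : T -> T -> T) (one : T) (S : set T)
    : set T :=
| generated_one : generated mul one S one
| generated_base x : S x -> generated mul one S x
| generated_mul x y : generated mul one S x -> generated mul one S y ->
    generated mul one S (mul x y)
| generated_inv x y : generated mul one S x ->
    mul x y = one -> mul y x = one -> generated mul one S y.

Definition dot (R : realType) (n : nat) (u v : 'rV[R]_n) : R :=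
  (u *m v^T) 0 0.

Section Polyhedra.
Variable R : realType.
Implicit Types (P E F : set 'rV[R]_3) (v : 'rV[R]_3).

Definition conv_hull (s : seq 'rV[R]_3) : set 'rV[R]_3 :=
  [set x | exists a : 'I_(size s) -> R,
     [/\ forall i, 0 <= a i, \sum_i a i = 1 & x = \sum_i a i *: s`_i]].

(* Affine dimension: the least row space containing all differences of points
   of F has rank d. *)
Definition has_dim F (d : nat) : Prop :=
  F !=set0 /\
  exists U : 'M[R]_3,
    [/\ \rank U = d,
        forall x y, F x -> F y -> (x - y <= U)%MS &
        forall W : 'M[R]_3,
          (forall x y, F x -> F y -> (x - y <= W)%MS) -> (U <= W)%MS].

Definition is_polyhedron P : Prop :=
  (exists s, P = conv_hull s) /\ has_dim P 3.

Definition is_face P (d : nat) F : Prop :=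
  has_dim F d /\
  exists c : 'rV[R]_3,
    F = [set x | P x /\ forall y, P y -> dot c y <= dot c x].

Definition vertices P : set 'rV[R]_3 := [set v | is_face P 0 [set v]].

Definition is_flag P v E F : Prop :=
  [/\ vertices P v, is_face P 1 E, is_face P 2 F, E v & E `<=` F].

Definition is_symmetry P (O : 'M[R]_3) : Prop :=
  O *m O^T = 1%:M /\ [set x *m O | x in P] = P.

(* Flag-transitivity under linear isometries: the symmetries of a polyhedron
   centred at the origin fix the origin. *)
Definition is_regular P : Prop :=
  is_polyhedron P /\
  forall v E F v' E' F', is_flag P v E F -> is_flag P v' E' F' ->
    exists O, [/\ is_symmetry P O, v *m O = v',
      [set x *m O | x in E] = E' & [set x *m O | x in F] = F'].

Definition has_schlafli_symbol (p q : nat) P : Prop :=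
  (forall F, is_face P 2 F -> (vertices P `&` F #= `I_p)%card) /\
  (forall v, vertices P v -> ([set F | is_face P 2 F /\ F v] #= `I_q)%card).

(* An edge is tangent to the unit sphere at x when it contains x and lies in
   the tangent plane {y | x . y = 1} of the sphere at x. *)
Definition edge_tangent P : Prop :=
  forall E, is_face P 1 E ->
    exists x, [/\ E x, dot x x = 1 & forall y, E y -> dot x y = 1].

Definition canonical_realisation (p q : nat) P : Prop :=
  [/\ is_regular P, has_schlafli_symbol p q P & edge_tangent P].

Definition polar P : set 'rV[R]_3 :=
  [set u | forall v, P v -> dot u v <= 1].

End Polyhedra.

Section Moebius.
Variable R : realType.

(* None is the point at infinity. *)
Definition extended_plane : Type := option 'rV[R]_2.

Definition stereo (u : 'rV[R]_3) : extended_plane :=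
  if u 0 ord_max == 1 then None
  else Some (\row_(j < 2) (u 0 (widen_ord (leqnSn 2) j) / (1 - u 0 ord_max))).

Definition stereo_circle (v : 'rV[R]_3) : set extended_plane :=
  stereo @` [set u | dot u u = 1 /\ 1 <= dot u v].

Definition circle_inversion (c : 'rV[R]_2) (r : R) (z : extended_plane)
    : extended_plane :=
  match z with
  | None => Some c
  | Some x => if x == c then None
              else Some (c + (r ^+ 2 / dot (x - c) (x - c)) *: (x - c))
  end.

Definition line_reflection (n : 'rV[R]_2) (k : R) (z : extended_plane)
    : extended_plane :=
  match z with
  | None => None
  | Some x => Some (x - (2 * (dot n x - k) / dot n n) *: n)
  end.

Definition moebius : set (extended_plane -> extended_plane) :=
  generated (fun f g : extended_plane -> extended_plane => f \o g) id
    ([set f | exists c r, 0 < r /\ f = circle_inversion c r] `|`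
     [set f | exists n k, n != 0 /\ f = line_reflection n k]).

Definition disk (c : 'rV[R]_2) (r : R) : set extended_plane :=
  [set z | if z is Some x then dot (x - c) (x - c) <= r ^+ 2 else False].

Definition disk_exterior (c : 'rV[R]_2) (r : R) : set extended_plane :=
  [set z | if z is Some x then r ^+ 2 <= dot (x - c) (x - c) else True].

Definition half_plane (n : 'rV[R]_2) (k : R) : set extended_plane :=
  [set z | if z is Some x then k <= dot n x else True].

(* f is the inversion through the boundary of the oriented circle D. *)
Definition is_inversion_through (D : set extended_plane)
    (f : extended_plane -> extended_plane) : Prop :=
  (exists c r, [/\ 0 < r, D = disk c r \/ D = disk_exterior c r &
                   f = circle_inversion c r]) \/
  (exists n k, [/\ n != 0, D = half_plane n k & f = line_reflection n k]).

(* mu . A_P; with polar P in place of P this is the dual arrangement. *)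
Definition arrangement (mu : extended_plane -> extended_plane)
    (P : set 'rV[R]_3) : set (set extended_plane) :=
  [set mu @` stereo_circle v | v in vertices P].

Definition inversion_group (A : set (set extended_plane))
    : set (extended_plane -> extended_plane) :=
  generated (fun f g : extended_plane -> extended_plane => f \o g) id
    [set f | exists2 D, A D & is_inversion_through D f].

Definition symmetry_group (A : set (set extended_plane))
    : set (extended_plane -> extended_plane) :=
  [set f | moebius f /\ [set f @` D | D in A] = A].

(* N and H are subgroups of the Moebius group; N is normalised by H and meets
   it trivially. *)
Definition semidirect (N H : set (extended_plane -> extended_plane)) : Prop :=
  (forall g h, N g -> H h -> exists2 g', N g' & h \o g = g' \o h) /\
  N `&` H = [set id].

(* The internal semidirect product, as a set of Moebius transformations. *)
Definition full_symmetry_group (mu : extended_plane -> extended_plane)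
    (P : set 'rV[R]_3) : set (extended_plane -> extended_plane) :=
  [set g \o h | g in inversion_group (arrangement mu (polar P))
              & h in symmetry_group (arrangement mu P)].

End Moebius.

Section Matrices.
Variable R : realType.

Definition omega (n : nat) : R := 1 + 2 * cos (2 * pi / n%:R).

(* The subring Z[x, y] of R. *)
Definition Zadjoin (x y : R) : set R :=
  [set z | forall A : {pred R}, subring_closed A ->
     x \in A -> y \in A -> z \in A].

Definition mx4 (s : seq (seq R)) : 'M[R]_4 :=
  \matrix_(i < 4, j < 4) (nth [::] s i)`_j.

Variables p q : nat.
Local Notation wp := (omega p).
Local Notation wq := (omega q).

Definition Qmx : 'M[R]_4 :=
  let a := - 1 - wp - wq in
  let b := - 1 + wp - wq in
  let c := - 1 - wp ^+ 2 + wq ^+ 2 in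
  let d := (1 + wp + wq) ^+ 2 in
  mx4 [:: [:: 1; a; b; - 1];
          [:: a; d; c; b];
          [:: b; c; d; a];
          [:: - 1; b; a; 1]].

Definition R1mx : 'M[R]_4 :=
  mx4 [:: [:: 0; 1; 0; 0];
          [:: 1; 0; 0; 0];
          [:: wp; - wp; 1; 0];
          [:: wp * (wp + wq) + wq; - wp * (wp + wq) - wq; 0; 1]].

Definition R2mx : 'M[R]_4 :=
  mx4 [:: [:: 1; 0; 0; 0];
          [:: wp; - wp; 1; 0];
          [:: wp * (- 1 + wp); 1 - wp ^+ 2; wp; 0];
          [:: wp ^+ 2 * (- 1 + wp + wq);
              - wp * (1 + wp) * (- 1 + wp + wq);
              wp * (- 1 + wp + wq); 1]].

Definition R3mx : 'M[R]_4 :=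
  mx4 [:: [:: 1; 0; 0; 0];
          [:: 0; 1; 0; 0];
          [:: wq; wp; - (wp + wq); 1];
          [:: wq * (- 1 + wp + wq); wp * (- 1 + wp + wq);
              1 - (wp + wq) ^+ 2; wp + wq]].

Definition Sfmx : 'M[R]_4 :=
  mx4 [:: [:: 1; 0; 0; 0];
          [:: 0; 1; 0; 0];
          [:: 0; 0; 1; 0];
          [:: 2; 2 * (1 - wp + wq); 2 * (1 + wp + wq); - 1]].

Definition matrix_group : set 'M[R]_4 :=
  generated mulmx 1%:M [set R1mx; R2mx; R3mx; Sfmx].

End Matrices.
Arguments omega : clear implicits.
Arguments Qmx : clear implicits.
Arguments R1mx : clear implicits.
Arguments R2mx : clear implicits.
Arguments R3mx : clear implicits.
Arguments Sfmx : clear implicits.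
Arguments matrix_group : clear implicits.

(* Main.v *)
From mathcomp Require Import all_fingroup.
Require Import Defs.
From HB Require Import structures.
From mathcomp Require Import all_boot all_order all_algebra.
From mathcomp Require Import all_classical all_reals all_analysis.
From mathcomp Require Import ring lra.

Set Implicit Arguments.
Unset Strict Implicit.
Unset Printing Implicit Defensive.

Import Order.TTheory GRing.Theory Num.Theory.
Import numFieldNormedType.Exports.

Local Open Scope classical_set_scope.
Local Open Scope ring_scope.

(** Let [e] be the midpoint of an edge of the polyhedron, [v = e + k] one of its
    ends and [n = e + m] the vertex of the polar given by one of the two faces
    at the edge. Then [e] is the point of tangency with the sphere, [e], [k], [m]
    are orthogonal ([regular_frame]), and flag transitivity provides three
    symmetries which move just one element of the flag each. They are the
    reflections [r1] in the plane orthogonal to [k], [r2] in the plane of [v] and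
    [n], and [r3] in the plane orthogonal to [m]. Since [r1 r2] rotates the [p]
    vertices of a face and [r3 r2] the [q] faces at a vertex, freely because a
    rotation with a fixed point off its axis is trivial, their orders divide [p]
    and [q]; convexity excludes star polygons, and thus the Schlaefli symbol
    determines the frame up to isometry ([cosp_value]).

    The chamber of [r1], [r2], [r3] is the cone over [v], [e], [n]. Reflecting a
    point in a wall that separates it from the chamber increases its product with
    an interior point of the chamber ([climb_ind]). This shows that the three
    reflections generate the symmetry group ([mirror_group_full]), and that the
    dual circles are disjoint or tangent ([polar_dot_le]).

    Points of the extended plane are identified with the rays of the light cone
    of R^(3,1), oriented circles with rays of spacelike vectors ([cap_inj]),
    inversions with Lorentz reflections ([inversion_throughP]) and Moebius
    transformations with Lorentz matrices ([rep_fun], [rep_mx]). The vertices [v]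
    of the polyhedron and of its polar become the vectors [lor v 1]. A Moebius
    transformation preserving the packing permutes the vectors of the vertices,
    hence fixes their sum, which lies on the time axis, and is an isometry of the
    polyhedron ([sym_grP]). The inversions through the dual circles play
    ping-pong ([pingpong]): a nonempty reduced word takes the centre
    [o = lor 0 1] far away, beyond one of the mirrors. So the two groups meet
    trivially, and an element close to the identity has trivial dual factor and is
    an isometry taking a point of the chamber to itself; this gives discreteness
    ([full_group_discrete]).

    The full group is therefore generated by the four Lorentz reflections in
    [lor k 0], in the normal of the second mirror, in [lor m 0] and in [lor n 1],
    which form a Coxeter diagram with labels p, q, infinity. The four integral
    matrices are reflections with the same Cartan matrix, so that an explicit
    basis conjugates the transposes of the ones into the others ([basis_gens]).
    The remaining claims are polynomial identities for the four generators. *)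

(** * Dot products *)

Section Dot.
Variables (R : realType) (n : nat).
Implicit Types (u v w : 'rV[R]_n) (a : R) (O : 'M[R]_n).

Lemma dotE u v : dot u v = \sum_i u 0 i * v 0 i.
Proof. by rewrite /dot mxE; apply: eq_bigr => i _; rewrite mxE. Qed.

Lemma dotC u v : dot u v = dot v u.
Proof. by rewrite !dotE; apply: eq_bigr => i _; rewrite mulrC. Qed.

Lemma dotDl u v w : dot (u + v) w = dot u w + dot v w.
Proof. by rewrite /dot mulmxDl mxE. Qed.

Lemma dotZl a u v : dot (a *: u) v = a * dot u v.
Proof. by rewrite /dot -scalemxAl mxE. Qed.

Lemma dotNl u v : dot (- u) v = - dot u v.
Proof. by rewrite /dot mulNmx mxE. Qed.

Lemma dot0l v : dot 0 v = 0.
Proof. by rewrite /dot mul0mx mxE. Qed.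

Lemma dotDr u v w : dot u (v + w) = dot u v + dot u w.
Proof. by rewrite dotC dotDl !(dotC u). Qed.

Lemma dotZr a u v : dot u (a *: v) = a * dot u v.
Proof. by rewrite dotC dotZl dotC. Qed.

Lemma dotNr u v : dot u (- v) = - dot u v.
Proof. by rewrite dotC dotNl dotC. Qed.

Lemma dot0r v : dot v 0 = 0.
Proof. by rewrite dotC dot0l. Qed.

Lemma dotBl u v w : dot (u - v) w = dot u w - dot v w.
Proof. by rewrite dotDl dotNl. Qed.

Lemma dotBr u v w : dot w (u - v) = dot w u - dot w v.
Proof. by rewrite dotDr dotNr. Qed.

Lemma dot_suml (I : Type) (r : seq I) (P : pred I) (F : I -> 'rV[R]_n) v :
  dot (\sum_(i <- r | P i) F i) v = \sum_(i <- r | P i) dot (F i) v.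
Proof. by rewrite /dot mulmx_suml summxE. Qed.

Lemma dot_sumr (I : Type) (r : seq I) (P : pred I) (F : I -> 'rV[R]_n) v :
  dot v (\sum_(i <- r | P i) F i) = \sum_(i <- r | P i) dot v (F i).
Proof. by rewrite dotC dot_suml; apply: eq_bigr => i _; rewrite dotC. Qed.

Lemma dot_ge0 u : 0 <= dot u u.
Proof. by rewrite dotE sumr_ge0 // => i _; rewrite -expr2 sqr_ge0. Qed.

Lemma dot_eq0 u : (dot u u == 0) = (u == 0).
Proof.
apply/eqP/eqP => [|->]; last exact: dot0l.
rewrite dotE => /eqP; rewrite psumr_eq0 => [/allP h|i _]; last first.
  by rewrite -expr2 sqr_ge0.
apply/rowP => i; rewrite mxE.
by have := h i (mem_index_enum _); rewrite -expr2 sqrf_eq0 => /eqP.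
Qed.

Lemma dot_gt0 u : (0 < dot u u) = (u != 0).
Proof. by rewrite lt_neqAle dot_ge0 andbT eq_sym dot_eq0. Qed.

Lemma dot_inj u v : (forall w, dot u w = dot v w) -> u = v.
Proof.
move=> h; apply/eqP; rewrite -subr_eq0 -dot_eq0; apply/eqP.
by rewrite dotBl h subrr.
Qed.

Lemma dot_mulmx O u v : dot (u *m O) v = dot u (v *m O^T).
Proof. by rewrite /dot trmx_mul trmxK mulmxA. Qed.

Lemma dot_orth O u v : O *m O^T = 1%:M -> dot (u *m O) (v *m O) = dot u v.
Proof. by move=> h; rewrite dot_mulmx -mulmxA h mulmx1. Qed.

Lemma orth_mulmxV O u : O *m O^T = 1%:M -> u *m O *m O^T = u.
Proof. by move=> h; rewrite -mulmxA h mulmx1. Qed.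

Lemma orth_mulmxVr O u : O *m O^T = 1%:M -> u *m O^T *m O = u.
Proof. by move=> h; rewrite -mulmxA (mulmx1C h) mulmx1. Qed.

Lemma orth_inj O : O *m O^T = 1%:M -> injective (fun u : 'rV_n => u *m O).
Proof. by move=> h u v /(congr1 (mulmx^~ O^T)); rewrite !orth_mulmxV. Qed.

Lemma dot_mxP u v : dot u v = 0 <-> u *m v^T = 0.
Proof.
split=> [h|h]; last by rewrite /dot h mxE.
by rewrite [u *m _]mx11_scalar [X in X%:M]h raddf0.
Qed.

End Dot.

Definition dotx := (dotDl, dotDr, dotBl, dotBr, dotZl, dotZr, dotNl, dotNr,
  dot0l, dot0r).

(** * Linear algebra in three dimensions *)

Section Space.
Variable R : realType.
Implicit Types (c d u v w x y z : 'rV[R]_3).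

(** Two planes through the origin are never orthogonal complements of each
    other, since the two dimensions add up to at most three. *)
Lemma annihilator_pairs c d y z : c != 0 -> z != 0 ->
  dot c y = 0 -> dot d y = 0 -> dot c z = 0 -> dot d z = 0 ->
  (exists a, d = a *: c) \/ (exists a, y = a *: z).
Proof.
move=> c0 z0 cy dy cz dz.
pose A := col_mx c d; pose B := col_mx z y.
have AB0 : A *m B^T = 0.
  rewrite tr_col_mx mul_col_row.
  by move/dot_mxP: cy => ->; move/dot_mxP: dy => ->; move/dot_mxP: cz => ->;
     move/dot_mxP: dz => ->; rewrite block_mx0.
have := mulmx0_rank_max AB0; rewrite mxrank_tr => rk.
have one_row (a b : 'rV[R]_3) : a != 0 -> (\rank (col_mx a b) <= 1)%N ->
    exists k, b = k *: a.
  move=> a0 r1; apply/sub_rVP.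
  have aS : (a <= col_mx a b)%MS.
    by rewrite -(addsmxE a b); exact: addsmxSl.
  have bS : (b <= col_mx a b)%MS.
    by rewrite -(addsmxE a b); exact: addsmxSr.
  apply: submx_trans bS _.
  rewrite -(geq_leqif (mxrank_leqif_sup aS)) (leq_trans r1) //.
  by rewrite rank_rV a0.
case: (leqP (\rank A) 1) => rA; first by left; apply: one_row c0 rA.
right; apply: (one_row _ _ z0).
by rewrite -(leq_add2l 2) (leq_trans _ rk) // leq_add2r.
Qed.

Lemma ex_orth2 (n : nat) (c d : 'rV[R]_n.+3) :
  exists2 t, t != 0 & dot t c = 0 /\ dot t d = 0.
Proof.
pose A := row_mx c^T d^T.
have kA : kermx A != 0.
  rewrite -mxrank_eq0 mxrank_ker subn_eq0 -ltnNge.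
  by rewrite (leq_ltn_trans (rank_leq_col A)).
exists (nz_row (kermx A)); first by rewrite nz_row_eq0.
have /sub_kermxP := nz_row_sub (kermx A).
rewrite [in X in X -> _]/A mul_mx_row -[0]row_mx0 => /eq_row_mx[h1 h2].
by split; apply/dot_mxP.
Qed.

Lemma span3 x y z :
  (forall u, dot u x = 0 -> dot u y = 0 -> dot u z = 0 -> u = 0) ->
  forall w, exists a b c : R, w = a *: x + b *: y + c *: z.
Proof.
move=> h w; pose A := col_mx x (col_mx y z).
have uA : A \in unitmx.
  rewrite -unitmx_tr -row_free_unit -kermx_eq0.
  apply/eqP/row_matrixP => i; rewrite row0.
  move: (row i _) (row_sub i (kermx A^T)) => r /sub_kermxP.
  rewrite !tr_col_mx !mul_mx_row -[in RHS]row_mx0 => /eq_row_mx[h1].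
  rewrite -[in RHS]row_mx0 => /eq_row_mx[h2 h3].
  by apply: h; apply/dot_mxP.
have : w = w *m invmx A *m A by rewrite mulmxKV.
move: (w *m invmx A) => t; rewrite -[t]hsubmxK -[rsubmx t]hsubmxK.
move: (lsubmx t) (lsubmx (rsubmx t)) (rsubmx (rsubmx t)) => a b c.
rewrite /A mul_row_col [row_mx b c *m _]mul_row_col => ->.
exists (a 0 0), (b 0 0), (c 0 0).
by rewrite -!mul_scalar_mx -!mx11_scalar addrA.
Qed.

End Space.

(** * Exposed faces of a polytope *)

Section SmallSeq.
Variable R : realType.

Lemma seq_max (T : eqType) (f : T -> R) (s : seq T) x0 : x0 \in s ->
  exists2 w, w \in s & forall y, y \in s -> f y <= f w.
Proof.
elim: s x0 => [//|x s IH] x0 _; case: s IH => [_|z s IH].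
  by exists x; rewrite ?mem_head // => y; rewrite inE => /eqP ->.
have [w ws hw] := IH z (mem_head _ _); have [le_wx|lt_xw] := leP (f w) (f x).
  exists x; rewrite ?mem_head // => y; rewrite inE => /orP[/eqP -> //|/hw].
  by move=> h; exact: le_trans le_wx.
exists w; first by rewrite inE ws orbT.
by move=> y; rewrite inE => /orP[/eqP ->|/hw //]; exact: ltW.
Qed.

(** For perturbing a functional without reversing any of the finitely many
    strict inequalities that it satisfies. *)
Lemma small_eps (l : seq (R * R)) : (forall ab, ab \in l -> 0 < ab.1) ->
  exists2 e, 0 < e & forall ab, ab \in l -> e * ab.2 < ab.1.
Proof.
elim: l => [_|[a b] l IH h]; first by exists 1.
have [e e0 he] := IH (fun ab abl => h ab (mem_behead (s := (a, b) :: l) abl)).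
have a0 : 0 < a := h _ (mem_head _ _).
have b1 : 0 < `|b| + 1 by rewrite ltr_wpDl.
pose e' := Num.min e (a / (`|b| + 1)).
have e'0 : 0 < e' by rewrite lt_min e0 divr_gt0.
exists e' => // -[a' b']; rewrite inE => /orP[/eqP[-> ->]/=|h'].
  have : e' <= a / (`|b| + 1) by rewrite ge_min lexx orbT.
  rewrite ler_pdivlMr // => h'; apply: lt_le_trans h'.
  by rewrite ltr_pM2l // (le_lt_trans (ler_norm b)) // ltrDl.
have /= := he _ h'; have /= a'0 := h _ (mem_behead (s := (a, b) :: l) h').
have [b'0|b'0] := leP b' 0; last first.
  by apply: le_lt_trans; rewrite ler_pM2r // ge_min lexx.
by move=> _; rewrite (le_lt_trans _ a'0) // mulr_ge0_le0 // ltW.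
Qed.

End SmallSeq.

Section Hull.
Variables (R : realType) (s : seq 'rV[R]_3).
Implicit Types (c d u v w x y : 'rV[R]_3).
Local Notation P := (conv_hull s).

Definition face (Q : set 'rV[R]_3) c : set 'rV[R]_3 :=
  [set x | Q x /\ forall y, Q y -> dot c y <= dot c x].

Lemma face_eq Q c x y : face Q c x -> face Q c y -> dot c x = dot c y.
Proof. by move=> [Qx hx] [Qy hy]; apply/eqP; rewrite eq_le hx // hy. Qed.

Lemma face_trans Q c x y : face Q c x -> Q y -> dot c y = dot c x -> face Q c y.
Proof. by move=> [Qx hx] Qy e; split=> // z; rewrite e; apply: hx. Qed.

Lemma mem_conv w : w \in s -> P w.
Proof.
move=> ws; have lt_w : (index w s < size s)%N by rewrite index_mem.
exists (fun i => (i == Ordinal lt_w)%:R); split => [i||].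
- by rewrite ler0n.
- by rewrite (bigD1 (Ordinal lt_w)) //= eqxx big1 ?addr0 // => i /negPf ->.
- rewrite (bigD1 (Ordinal lt_w)) //= eqxx big1 ?addr0 => [|i /negPf ->].
    by rewrite scale1r nth_index.
  by rewrite scale0r.
Qed.

Lemma conv_face_le c d (k l : R) x :
  (forall w, w \in s -> dot c w <= k) ->
  (forall w, w \in s -> dot c w = k -> dot d w <= l) ->
  P x -> dot c x = k -> dot d x <= l.
Proof.
move=> ck dl [a [a0 a1 ->]].
have cE z : dot z (\sum_i a i *: s`_i) = \sum_i a i * dot z s`_i.
  by rewrite dot_sumr; apply: eq_bigr => i _; rewrite dotZr.
have sE z : z = \sum_i a i * z by rewrite -mulr_suml a1 mul1r.
rewrite !cE => ek.
have a_k i : a i * (k - dot c s`_i) = 0.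
  suff /psumr_eq0P h : \sum_i a i * (k - dot c s`_i) = 0.
    by apply: h => // j _; rewrite mulr_ge0 // subr_ge0 ck // mem_nth.
  under eq_bigr do rewrite mulrBr.
  by rewrite sumrB -sE ek subrr.
rewrite [l]sE; apply: ler_sum => i _.
have /eqP := a_k i; rewrite mulf_eq0 subr_eq0 => /orP[/eqP ->|/eqP ck'].
  by rewrite !mul0r.
by apply: ler_wpM2l => //; apply: dl => //; rewrite mem_nth.
Qed.

Lemma conv_le c (k : R) x :
  (forall w, w \in s -> dot c w <= k) -> P x -> dot c x <= k.
Proof.
move=> h Px; apply: (@conv_face_le 0 c 0 k) => // [w _|w ws _|].
- by rewrite dot0l.
- exact: h.
- by rewrite dot0l.
Qed.

Lemma faceP c x :
  face P c x <-> P x /\ forall w, w \in s -> dot c w <= dot c x.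
Proof.
split=> [[Px h]|[Px h]]; split=> //; first by move=> w ws; exact/h/mem_conv.
by move=> y; apply: conv_le.
Qed.

Lemma conv_neq0 x : P x -> exists w, w \in s.
Proof.
move=> [a [_ a1 _]]; case: (s) a a1 => [|w t] a; last first.
  by exists w; rewrite mem_head.
by rewrite big_ord0 => /esym/eqP; rewrite oner_eq0.
Qed.

Lemma face_le c d (l : R) x :
  (forall w, w \in s -> face P c w -> dot d w <= l) ->
  face P c x -> dot d x <= l.
Proof.
move=> h fx; have [Px hx] := (fx).
apply: (@conv_face_le c d (dot c x) l) => // [w ws|w ws e].
  exact/hx/mem_conv.
by apply: h => //; exact: face_trans fx (mem_conv ws) e.
Qed.

Lemma face_gen c x : P x -> exists2 w, w \in s & face P c w.
Proof.
move=> /conv_neq0[w0 w0s]; have [w ws hw] := seq_max (dot c) w0s.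
by exists w => //; apply/faceP; split => //; apply: mem_conv.
Qed.

(** A face of a face is exposed by a small tilt of the supporting functional,
    since only finitely many generators have to be kept below it. *)
Lemma face_of_face c d x0 : P x0 -> exists c', forall x,
  face P c' x <-> face P c x /\ forall y, face P c y -> dot d y <= dot d x.
Proof.
move=> Px0.
have [w0 w0s fw0] := face_gen c Px0.
have [w1] : exists2 w1, w1 \in [seq w <- s | dot c w == dot c w0] &
    forall y, y \in [seq w <- s | dot c w == dot c w0] -> dot d y <= dot d w1.
  by apply: seq_max (w0) _; rewrite mem_filter eqxx.
rewrite mem_filter => /andP[/eqP cw1 w1s] dw1.
have fw1 : face P c w1 by apply: face_trans fw0 (mem_conv w1s) cw1.
have dface y : face P c y -> dot d y <= dot d w1.
  apply: face_le => w ws fw; apply: dw1.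
  by rewrite mem_filter ws (face_eq fw fw0) eqxx.
pose l := [seq (dot c w1 - dot c w, dot d w - dot d w1) |
            w <- s & dot c w < dot c w1].
have [|e e0 he] := @small_eps _ l.
  by move=> ab /mapP[w]; rewrite mem_filter => /andP[cw _] ->; rewrite subr_gt0.
exists (c + e *: d) => x.
have big w : w \in s -> dot (c + e *: d) w <= dot (c + e *: d) w1.
  move=> ws; rewrite !dotx; have [h1 h2] := (fw1).
  have := h2 _ (mem_conv ws); rewrite le_eqVlt => /orP[/eqP cw|cw].
    rewrite cw lerD2l ler_pM2l //; apply: dface.
    exact: face_trans fw1 (mem_conv ws) cw.
  have /= := he (dot c w1 - dot c w, dot d w - dot d w1); rewrite mulrBr.
  have -> : (dot c w1 - dot c w, dot d w - dot d w1) \in l.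
    by apply/mapP; exists w => //; rewrite mem_filter cw.
  by move=> /(_ isT); lra.
have fw1' : face P (c + e *: d) w1.
  by apply/faceP; split => //; apply: mem_conv.
split=> [fx|[fx dx]].
  have [Px _] := (fx); have ex := face_eq fx fw1'.
  have fcx : face P c x.
    apply: (face_trans fw1 Px); apply/eqP; rewrite eq_le.
    rewrite (proj2 fw1) //= -lerN2 -!dotNl.
    apply: (@conv_face_le (c + e *: d) (- c) (dot (c + e *: d) w1)) => //.
    move=> w ws ew; rewrite !dotNl lerN2 leNgt; apply/negP => cw.
    have /= := he (dot c w1 - dot c w, dot d w - dot d w1); rewrite mulrBr.
    have -> : (dot c w1 - dot c w, dot d w - dot d w1) \in l.
      by apply/mapP; exists w => //; rewrite mem_filter cw.
    by move: ew; rewrite !dotx => ew /(_ isT); lra.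
  split=> // y fy; move: ex; rewrite !dotx (face_eq fcx fw1) => /addrI.
  by move/(mulfI (lt0r_neq0 e0)) ->; apply: dface.
apply: (face_trans fw1' (proj1 fx)); rewrite !dotx (face_eq fx fw1).
by congr (_ + _ * _); apply/eqP; rewrite eq_le dface // dx.
Qed.

End Hull.

(** * Affine dimension *)

Section Dimension.
Variable R : realType.
Implicit Types (F : set 'rV[R]_3) (c d u v w x y : 'rV[R]_3).

Definition constant_on F c := forall x y, F x -> F y -> dot c x = dot c y.

Lemma constant_onP F c :
  constant_on F c <-> forall x y, F x -> F y -> (x - y <= kermx c^T)%MS.
Proof.
split=> h x y Fx Fy.
  by apply/sub_kermxP/dot_mxP; rewrite dotC dotBr (h x y) ?subrr.
by apply/eqP; rewrite -subr_eq0 -dotBr dotC; apply/eqP/dot_mxP/sub_kermxP/h.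
Qed.

Lemma has_dim_inj F (d d' : nat) : has_dim F d -> has_dim F d' -> d = d'.
Proof.
move=> [_ [U [<- hU mU]]] [_ [U' [<- hU' mU']]].
by apply/eqP; rewrite eqn_leq !mxrankS ?mU ?mU'.
Qed.

Lemma dim3_constant F c : has_dim F 3 -> constant_on F c -> c = 0.
Proof.
move=> [_ [U [rU _ mU]]] /constant_onP /mU h.
have {h} : (1%:M <= kermx c^T)%MS.
  by apply: submx_trans h; rewrite sub1mx -[row_full U]/(\rank U == 3)%N rU.
by move/sub_kermxP; rewrite mul1mx => /(congr1 trmx); rewrite trmxK trmx0.
Qed.

Lemma rV_kermx c d : c != 0 ->
  (kermx c^T <= kermx d^T)%MS <-> exists a, d = a *: c.
Proof.
move=> c0; split=> [h|[a ->]]; last first.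
  by apply/sub_kermxP; rewrite linearZ /= -scalemxAr mulmx_ker scaler0.
apply/sub_rVP; rewrite -[c]trmxK -[d]trmxK.
have r1 : \rank (kermx c^T) = 2%N by rewrite mxrank_ker mxrank_tr rank_rV c0.
have AB0 : kermx c^T *m (col_mx c d)^T = 0.
  rewrite tr_col_mx mul_mx_row mulmx_ker.
  have /sub_kermxP := h => ->; exact: row_mx0.
have := mulmx0_rank_max AB0; rewrite r1 mxrank_tr -[3%N]/(2 + 1)%N leq_add2l.
move=> rk; rewrite !trmxK.
have cS : (c <= col_mx c d)%MS by rewrite -(addsmxE c d); exact: addsmxSl.
have dS : (d <= col_mx c d)%MS by rewrite -(addsmxE c d); exact: addsmxSr.
apply: submx_trans dS _.
by rewrite -(geq_leqif (mxrank_leqif_sup cS)) (leq_trans rk) // rank_rV c0.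
Qed.

Lemma dim2_constant F c d : has_dim F 2 -> c != 0 ->
  constant_on F c -> constant_on F d -> exists a, d = a *: c.
Proof.
move=> [_ [U [rU _ mU]]] c0 /constant_onP/mU cU /constant_onP/mU dU.
apply/(rV_kermx _ c0).
suff /eqmxP <- : (U == kermx c^T)%MS by [].
rewrite -(geq_leqif (mxrank_leqif_eq cU)).
by rewrite mxrank_ker mxrank_tr rank_rV c0 rU.
Qed.

Lemma dim2I F c : F !=set0 -> c != 0 -> constant_on F c ->
  (forall d, constant_on F d -> exists a, d = a *: c) -> has_dim F 2.
Proof.
move=> F0 c0 Fc h; split=> //; exists (kermx c^T); split.
- by rewrite mxrank_ker mxrank_tr rank_rV c0.
- exact/constant_onP.
- move=> W hW; apply/row_subP => i; rewrite submxE; apply/eqP.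
  apply/matrixP => i' j; rewrite !mxE !ord1.
  have /h[a ea] : constant_on F (col j (cokermx W))^T.
    apply/constant_onP => x y Fx Fy; rewrite trmxK.
    have := hW _ _ Fx Fy; rewrite submxE => /eqP xy.
    by apply/sub_kermxP; rewrite colE mulmxA xy mul0mx.
  have e0 : row i (kermx c^T) *m (col j (cokermx W)) = 0.
    rewrite -[col j _]trmxK ea linearZ /= -scalemxAr -row_mul mulmx_ker row0.
    by rewrite scaler0.
  move/matrixP: e0 => /(_ 0 0); rewrite !mxE => e0; rewrite -[RHS]e0.
  by apply: eq_bigr => k _; rewrite !mxE.
Qed.

Lemma dim1I F v w : F v -> F w -> v != w ->
  (forall x y, F x -> F y -> exists a, x - y = a *: (w - v)) -> has_dim F 1.
Proof.
move=> Fv Fw vw h; split; first by exists v.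
exists <<w - v>>%MS; split.
- by rewrite genmxE rank_rV subr_eq0 eq_sym vw.
- by move=> x y Fx Fy; rewrite genmxE; apply/sub_rVP/h.
- by move=> W hW; rewrite genmxE hW.
Qed.

Lemma dim1_line F v w x : has_dim F 1 -> F v -> F w -> v != w -> F x ->
  exists a, x = v + a *: (w - v).
Proof.
move=> [_ [U [rU hU _]]] Fv Fw vw Fx.
have wU := hU _ _ Fw Fv; have xU := hU _ _ Fx Fv.
have /sub_rVP[a ea] : (x - v <= w - v)%MS.
  apply: submx_trans xU _; rewrite -(geq_leqif (mxrank_leqif_sup wU)).
  by rewrite rU rank_rV subr_eq0 eq_sym vw.
by exists a; rewrite -ea addrC subrK.
Qed.

Lemma dim1_two F v : has_dim F 1 -> F v -> exists2 w, F w & w != v.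
Proof.
move=> [_ [U [rU _ mU]]] Fv; apply: contrapT => h.
suff : (U <= (0 : 'M[R]_3))%MS by rewrite submx0 -mxrank_eq0 rU.
have all_v x : F x -> x = v.
  by move=> Fx; apply/eqP/negPn/negP => xv; apply: h; exists x.
by apply: mU => x y /all_v -> /all_v ->; rewrite subrr sub0mx.
Qed.

Lemma dim0_point v : has_dim [set v] 0.
Proof.
split; first by exists v.
exists 0; split=> [|x y -> ->|W _]; rewrite ?mxrank0 ?sub0mx //.
by rewrite subrr sub0mx.
Qed.

Lemma has_dim_orth F (O : 'M[R]_3) (d : nat) : O \in unitmx ->
  has_dim F d -> has_dim [set x *m O | x in F] d.
Proof.
move=> uO [[x0 Fx0] [U [rU hU mU]]]; split; first by exists (x0 *m O), x0.
exists (U *m O); split.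
- by rewrite mxrankMfree ?rU // row_free_unit.
- by move=> _ _ [x Fx <-] [y Fy <-]; rewrite -mulmxBl submxMr ?hU.
- move=> W hW; rewrite -(mulmxKV uO W) submxMr // mU // => x y Fx Fy.
  by rewrite -(mulmxK uO (x - y)) submxMr // mulmxBl hW //; [exists x|exists y].
Qed.

End Dimension.

(** * Vertices, edges and 2-faces of a polytope *)

Section Faces.
Variables (R : realType) (s : seq 'rV[R]_3).
Implicit Types (c d t u v w x y : 'rV[R]_3) (E F : set 'rV[R]_3).
Local Notation P := (conv_hull s).

Lemma vertexP (Q : set 'rV[R]_3) v :
  vertices Q v <-> exists c, [set v] = face Q c.
Proof. by split=> [[_]//|h]; split => //; apply: dim0_point. Qed.

Lemma vertex_in (Q : set 'rV[R]_3) v : vertices Q v -> Q v.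
Proof.
by move=> /vertexP[c /seteqP[/(_ v) h _]]; have [] := h (erefl : [set v] v).
Qed.

Lemma vertex_gen v : vertices P v -> v \in s.
Proof.
move=> Vv; have Pv := vertex_in Vv; move/vertexP: Vv => [c e].
by have [w ws] := face_gen c Pv; rewrite -e => <-.
Qed.

Lemma vertex_lt c v x : [set v] = face P c -> P x -> x != v ->
  dot c x < dot c v.
Proof.
move=> e Px xv; have fv : face P c v by rewrite -e.
rewrite lt_neqAle (proj2 fv) // andbT; apply: contra xv => /eqP h.
by have := face_trans fv Px h; rewrite -e => ->.
Qed.

(** A point of largest norm on a face is a vertex: it is the only point of the
    face at which the functional it defines is maximal. *)
Lemma face_has_vertex c x0 : P x0 -> exists2 v, vertices P v & face P c v.
Proof.
move=> Px0; have [w0 w0s fw0] := face_gen c Px0.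
have [v] : exists2 v, v \in [seq w <- s | `[< face P c w >]] &
    forall y, y \in [seq w <- s | `[< face P c w >]] -> dot y y <= dot v v.
  by apply: seq_max (w0) _; rewrite mem_filter w0s andbT; apply/asboolP.
rewrite mem_filter => /andP[/asboolP fv vs] hv; exists v => //.
have norm_le y w : dot y w <= (dot y y + dot w w) / 2.
  by have := dot_ge0 (y - w); rewrite !dotx (dotC w y); lra.
have v_le y : face P c y -> dot v y <= dot v v.
  apply: face_le => w ws fw; apply: le_trans (norm_le _ _) _.
  by have := hv w; rewrite mem_filter ws andbT => /(_ (asboolT fw)); lra.
have [c' c'E] := face_of_face c v Px0.
apply/vertexP; exists c'; apply/seteqP; split=> [x ->|x /c'E[fx vx]].
  by apply/c'E; split.
have xx : dot x x <= (dot x x + dot v v) / 2.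
  apply: (face_le (c := c)) fx => w ws fw; apply: le_trans (norm_le _ _) _.
  by have := hv w; rewrite mem_filter ws andbT => /(_ (asboolT fw)); lra.
apply/eqP; rewrite -subr_eq0 -dot_eq0 eq_le dot_ge0 andbT !dotx (dotC x v).
by have := vx _ fv; lra.
Qed.

Lemma face_max_vertex c d x0 : P x0 ->
  exists v, [/\ vertices P v, face P c v & forall y, face P c y -> dot d y <= dot d v].
Proof.
move=> Px0; have [c' c'E] := face_of_face c d Px0.
by have [v Vv /c'E[fv hv]] := face_has_vertex c' Px0; exists v.
Qed.

Lemma vertex_constant c d (k : R) x :
  (forall v, vertices P v -> face P c v -> dot d v = k) ->
  face P c x -> dot d x = k.
Proof.
move=> h fx; apply/eqP; rewrite eq_le.
have [v [Vv fv hv]] := face_max_vertex c d (proj1 fx).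
have [w [Vw fw hw]] := face_max_vertex c (- d) (proj1 fx).
have := hw _ fx; rewrite !dotNl lerN2 (h w Vw fw) => ->.
by rewrite -(h v Vv fv) hv.
Qed.

Lemma face0 x : face P 0 x <-> P x.
Proof. by split=> [[]//|Px]; split=> // y _; rewrite !dot0l. Qed.

Hypothesis P3 : has_dim P 3.

Lemma face2_neq0 c : has_dim (face P c) 2 -> c != 0.
Proof.
move=> h; apply/eqP => c0; move: h; rewrite c0.
have -> : face P 0 = P by apply/seteqP; split=> x /face0.
by move=> /(has_dim_inj P3).
Qed.

Lemma face_constant c : constant_on (face P c) c.
Proof. by move=> x y; apply: face_eq. Qed.

Lemma tilt_edge c d v w : has_dim (face P c) 2 ->
  ~ (exists a, d = a *: c) ->
  (forall x, face P c x -> dot d x <= dot d v) ->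
  face P c v -> face P c w -> w != v -> dot d w = dot d v ->
  exists2 E, is_face P 1 E & forall x, E x <-> face P c x /\ dot d x = dot d v.
Proof.
move=> F2 dc dv fv fw wv dw; have c0 := face2_neq0 F2.
have [c' c'E] := face_of_face c d (proj1 fv).
have EE x : face P c' x <-> face P c x /\ dot d x = dot d v.
  split=> [/c'E[fx h]|[fx e]].
    by split=> //; apply/eqP; rewrite eq_le dv // h.
  by apply/c'E; split=> // y fy; rewrite e dv.
exists (face P c') => //; split; last by exists c'.
have zE x : face P c' x -> dot c (x - v) = 0 /\ dot d (x - v) = 0.
  by move=> /EE[fx e]; rewrite !dotBr e (face_eq fx fv) !subrr.
apply: (@dim1I _ _ v w); [exact/EE|exact/EE|by rewrite eq_sym|].
move=> x y Ex Ey; have wv0 : w - v != 0 by rewrite subr_eq0.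
have [e1 e2] := zE _ Ex; have [e3 e4] := zE _ Ey.
have [|e5 e6] := zE w; first exact/EE.
have -> : x - y = (x - v) - (y - v) by rewrite opprB addrA subrK.
have [] := @annihilator_pairs _ c d (x - v - (y - v)) (w - v) c0 wv0 => //.
- by rewrite dotBr e1 e3 subrr.
- by rewrite dotBr e2 e4 subrr.
Qed.

(** Within the plane of a 2-face, tilt the functional exposing a vertex in the
    direction [t] until it meets another point of the face. *)
Lemma tilt_vertex c cv v t : has_dim (face P c) 2 ->
  face P c v -> [set v] = face P cv ->
  (forall l k, t + l *: cv <> k *: c) ->
  exists l w, [/\ face P c w, w != v,
    dot (t + l *: cv) w = dot (t + l *: cv) v &
    forall x, face P c x -> dot (t + l *: cv) x <= dot (t + l *: cv) v].
Proof.
move=> F2 fv ev tc; have c0 := face2_neq0 F2.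
pose S := [seq w <- s | `[< face P c w >] & w != v].
have memS w : (w \in S) = [&& `[< face P c w >], w != v & w \in s].
  by rewrite mem_filter andbA.
pose f w := dot t (w - v) / dot cv (v - w).
have [w0 w0S] : exists w, w \in S.
  apply: contrapT => h.
  have [a ta] : exists a, t = a *: c.
    apply: (dim2_constant F2 c0 (@face_constant c)).
    have tv (e : 'rV[R]_3) x : face P c x -> dot e x <= dot e v.
      apply: face_le => w ws fw; have [->//|wv] := eqVneq w v.
      by case: h; exists w; rewrite memS wv ws !andbT; apply/asboolP.
    have t_v x : face P c x -> dot t x = dot t v.
      move=> fx; apply/eqP; rewrite eq_le tv //=.
      by have := tv (- t) x fx; rewrite !dotNl lerN2.
    by move=> x y /t_v -> /t_v ->.
  by apply: (tc 0 a); rewrite scale0r addr0.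
have [w wS hw] := seq_max f w0S.
move: (wS); rewrite memS => /and3P[/asboolP fw wv ws].
have cv_gt0 x : x \in S -> 0 < dot cv (v - x).
  rewrite memS => /and3P[_ xv xs]; rewrite dotBr subr_gt0.
  exact: vertex_lt ev (mem_conv xs) xv.
exists (f w), w; split=> //.
  have cvN : dot cv (w - v) = - dot cv (v - w) by rewrite -dotNr opprB.
  apply/eqP; rewrite -subr_eq0 -dotBr dotDl dotZl cvN mulrN divfK ?subrr //.
  by rewrite lt0r_neq0 // cv_gt0.
move=> x; apply: face_le => y ys fy; have [->//|yv] := eqVneq y v.
have yS : y \in S by rewrite memS yv ys !andbT; apply/asboolP.
have cvN : dot cv (y - v) = - dot cv (v - y) by rewrite -dotNr opprB.
rewrite -subr_le0 -dotBr dotDl dotZl cvN mulrN.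
by rewrite subr_le0 -ler_pdivrMr ?cv_gt0 // hw.
Qed.

(** Tilting in two opposite directions stops at two different edges; a common
    edge would force the tilted functional to be constant on the face. *)
Lemma two_edges v F : vertices P v -> is_face P 2 F -> F v ->
  exists E E', [/\ is_face P 1 E, is_face P 1 E', E v /\ E' v,
    E `<=` F /\ E' `<=` F & E <> E'].
Proof.
move=> /vertexP[cv ev] [F2 [c Fc]] Fv.
have {}Fc : F = face P c by [].
rewrite {F}Fc in F2 Fv *.
have [t t0 [tcv tc]] := ex_orth2 cv c; have c0 := face2_neq0 F2.
have ind l k : t + l *: cv <> k *: c.
  move=> /(congr1 (dot t)); rewrite !dotx tcv tc !mulr0 addr0 => /eqP.
  by rewrite dot_eq0 (negPf t0).
have ind' l k : - t + l *: cv <> k *: c.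
  move=> /(congr1 (dot (- t))); rewrite !dotx tcv tc !mulr0 !oppr0 addr0 opprK.
  by rewrite mulr0 => /eqP; rewrite dot_eq0 (negPf t0).
have [l [w [fw wv ew hw]]] := tilt_vertex F2 Fv ev ind.
have [l' [w' [fw' wv' ew' hw']]] := tilt_vertex F2 Fv ev ind'.
have [E fE EE] := tilt_edge F2 (fun '(ex_intro a h) => ind _ _ h) hw Fv fw wv ew.
have [E' fE' EE'] :=
  tilt_edge F2 (fun '(ex_intro a h) => ind' _ _ h) hw' Fv fw' wv' ew'.
exists E, E'; split=> //; first by split; [apply/EE|apply/EE'].
  by split=> x; [move=> /EE[]|move=> /EE'[]].
move=> eEE; have /EE'[_] : E' w by rewrite -eEE; apply/EE.
move=> e'; move: ew; rewrite !dotx in e' * => ew.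
have cvw := vertex_lt ev (proj1 fw) wv.
have ll : (l + l') * (dot cv w - dot cv v) = 0 by lra.
move/eqP: ll; rewrite mulf_eq0 subr_eq0 (lt_eqF cvw) orbF addr_eq0 => /eqP el.
have [a ha] : exists a, t + l *: cv = a *: c.
  apply: (dim2_constant F2 c0 (@face_constant c)).
  have hv x : face P c x -> dot (t + l *: cv) x = dot (t + l *: cv) v.
    move=> fx; have := hw _ fx; have := hw' _ fx; rewrite el !dotx.
    by lra.
  by move=> x y /hv -> /hv ->.
exact: ind ha.
Qed.

(** Rotating the supporting plane of a 2-face about one of its edges brings it
    to another 2-face. *)
Lemma two_faces E F : is_face P 1 E -> is_face P 2 F -> E `<=` F ->
  exists2 F', is_face P 2 F' & E `<=` F' /\ F' <> F.
Proof.
move=> [E1 [cE Ec]] [F2 [c Fc]] EF.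
have {}Ec : E = face P cE by [].
have {}Fc : F = face P c by [].
rewrite {E}Ec {F}Fc in E1 F2 EF *; have c0 := face2_neq0 F2.
have [v Ev] := E1.1; have Fv := EF _ Ev; have Pv := proj1 Ev.
have [v' Ev' vv'] := dim1_two E1 Ev.
pose S := [seq w <- s | ~~ `[< face P c w >]].
have [w0 w0S] : exists w, w \in S.
  apply: contrapT => h; suff : c = 0 by move/eqP; rewrite (negPf c0).
  apply: (dim3_constant P3).
  have all_F w : w \in s -> face P c w.
    move=> ws; apply: contrapT => fw; apply: h; exists w.
    by rewrite mem_filter ws andbT; apply/asboolPn.
  have cc x : P x -> dot c x = dot c v.
    move=> Px; apply/eqP; rewrite eq_le (proj2 Fv) //= -lerN2 -!dotNl.
    by apply: conv_le Px => w /all_F fw; rewrite !dotNl (face_eq fw Fv).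
  by move=> x y /cc -> /cc ->.
pose f w := - (dot cE (v - w) / dot c (v - w)).
have [w wS hw] := seq_max f w0S.
have c_gt0 x : x \in S -> 0 < dot c (v - x).
  rewrite mem_filter => /andP[/asboolPn fx xs]; rewrite dotBr subr_gt0.
  rewrite lt_neqAle (proj2 Fv _ (mem_conv xs)) andbT; apply/eqP => e.
  by apply: fx; apply: face_trans Fv (mem_conv xs) e.
pose d := cE + f w *: c.
have ew : dot d w = dot d v.
  apply/eqP; rewrite eq_sym -subr_eq0 -dotBr dotDl dotZl mulNr divfK ?subrr //.
  by rewrite lt0r_neq0 // c_gt0.
have dv y : y \in s -> dot d y <= dot d v.
  move=> ys; rewrite -subr_ge0 -dotBr dotDl dotZl.
  have cEy : 0 <= dot cE (v - y) by rewrite dotBr subr_ge0; exact: (proj2 Ev _ (mem_conv ys)).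
  have [fy|nfy] := asboolP (face P c y).
    by rewrite (dotBr _ _ c) (face_eq Fv fy) subrr mulr0 addr0.
  have yS : y \in S by rewrite mem_filter ys andbT; apply/asboolPn.
  have := hw y yS; rewrite [f y]/f lerNl ler_pdivlMr ?c_gt0 // mulNr.
  by rewrite -subr_ge0 opprK.
have F'v : face P d v by by apply/faceP; split.
have EF' : face P cE `<=` face P d.
  move=> x Ex; apply: face_trans F'v (proj1 Ex) _.
  by rewrite !dotDl !dotZl (face_eq Ex Ev) (face_eq (EF _ Ex) Fv).
have F'w : face P d w.
  by apply: face_trans F'v _ ew; apply: mem_conv; move: wS; rewrite mem_filter => /andP[].
have nFw : ~ face P c w by move: wS; rewrite mem_filter => /andP[/asboolPn].
have [x Fx nEx] : exists2 x, face P c x & ~ face P cE x.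
  apply: contrapT => h; have e : face P c = face P cE.
    apply/seteqP; split=> // x fx; apply: contrapT => nx; apply: h; by exists x.
  by rewrite e in F2; have := has_dim_inj E1 F2.
have d0 : d != 0.
  apply/eqP => d0; have /eqP : dot d x = dot d v by rewrite d0 !dot0l.
  rewrite !dotDl !dotZl (face_eq Fx Fv) => /eqP /addIr e.
  by apply: nEx; apply: face_trans Ev (proj1 Fx) e.
exists (face P d); last by split=> // e; apply: nFw; rewrite -e.
split; last by exists d.
apply: (dim2I _ d0 (@face_constant d)) => [|c' hc']; first by exists v.
have z0 : v' - v != 0 by rewrite subr_eq0.
have F'v' := EF' _ Ev'.
have [] := @annihilator_pairs _ d c' (w - v) (v' - v) d0 z0 => //.
- by rewrite dotBr ew subrr.
- by rewrite dotBr (hc' _ _ F'w F'v) subrr.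
- by rewrite dotBr (face_eq F'v' F'v) subrr.
- by rewrite dotBr (hc' _ _ F'v' F'v) subrr.
move=> [a /(congr1 (dot c))]; rewrite dotZr !dotBr (face_eq (EF _ Ev') Fv) subrr.
move=> /eqP; rewrite mulr0 subr_eq0 => /eqP e.
by case: nFw; apply: face_trans Fv (proj1 F'w) e.
Qed.

End Faces.

(** * Symmetries, the centroid, and the vertices of the polar *)

Section Symmetries.
Variable R : realType.
Implicit Types (Q F : set 'rV[R]_3) (u v x y : 'rV[R]_3) (O : 'M[R]_3).

Lemma sym_mem Q O x : is_symmetry Q O -> Q x -> Q (x *m O).
Proof. by move=> [_ {2}<-] Qx; exists x. Qed.

Lemma sym_memV Q O x : is_symmetry Q O -> Q (x *m O) -> Q x.
Proof. by move=> [hO {1}<-] [y Qy] /(orth_inj hO) <-. Qed.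

Lemma orth_tr O : O *m O^T = 1%:M -> O^T *m O^T^T = 1%:M.
Proof. by move=> h; rewrite trmxK (mulmx1C h). Qed.

Lemma symI Q O : O *m O^T = 1%:M -> (forall x, Q x -> Q (x *m O)) ->
  (forall x, Q x -> Q (x *m O^T)) -> is_symmetry Q O.
Proof.
move=> hO h h'; split=> //; apply/seteqP; split=> [_ [x Qx <-]|x Qx]; first exact: h.
by exists (x *m O^T); [exact: h'|rewrite orth_mulmxVr].
Qed.

Lemma sym_tr Q O : is_symmetry Q O -> is_symmetry Q O^T.
Proof.
move=> sO; have [hO _] := sO; apply: symI; first exact: orth_tr.
  by move=> x Qx; apply: (sym_memV sO); rewrite orth_mulmxVr.
by move=> x Qx; rewrite trmxK; apply: sym_mem.
Qed.

Lemma sym_mul Q O O' : is_symmetry Q O -> is_symmetry Q O' ->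
  is_symmetry Q (O *m O').
Proof.
move=> sO sO'; have [hO _] := sO; have [hO' _] := sO'; apply: symI.
- by rewrite trmx_mul -mulmxA (mulmxA O') hO' mul1mx.
- by move=> x Qx; rewrite mulmxA; do 2!apply: sym_mem => //.
- by move=> x Qx; rewrite trmx_mul mulmxA; do 2!(apply: sym_mem; first exact: sym_tr).
Qed.

Lemma sym_face Q O d F : is_symmetry Q O -> is_face Q d F ->
  is_face Q d [set x *m O | x in F].
Proof.
move=> sO [Fd [c Fc]]; have [hO _] := sO; split.
  by apply: has_dim_orth => //; case/mulmx1_unit: hO.
exists (c *m O); apply/seteqP; split=> [_ [x + <-]|x [Qx h]].
  rewrite Fc => -[Qx h]; split; first exact: sym_mem.
  move=> y Qy; rewrite dot_orth //.
  by rewrite -(orth_mulmxVr y hO) dot_orth // h //; apply: sym_mem (sym_tr sO) _.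
exists (x *m O^T); last by rewrite orth_mulmxVr.
rewrite Fc; split=> [|y Qy]; first exact: sym_mem (sym_tr sO) _.
rewrite -(dot_orth _ y hO) -(dot_orth _ (x *m O^T) hO) orth_mulmxVr //.
by apply: h; apply: sym_mem.
Qed.

Lemma sym_vertex Q O v : is_symmetry Q O -> vertices Q v -> vertices Q (v *m O).
Proof.
by move=> sO Vv; have := sym_face sO Vv; rewrite image_set1.
Qed.

Lemma sym_polar Q O : is_symmetry Q O -> is_symmetry (polar Q) O.
Proof.
have h O' x : is_symmetry Q O' -> polar Q x -> polar Q (x *m O').
  move=> sO Qx v Qv; rewrite dot_mulmx; apply: Qx; exact: sym_mem (sym_tr sO) _.
move=> sO; have [hO _] := sO.
by apply: symI => // x; apply: h => //; apply: sym_tr.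
Qed.

End Symmetries.

Section Polar.
Variables (R : realType) (s : seq 'rV[R]_3).
Implicit Types (c d n u v w x y : 'rV[R]_3) (F : set 'rV[R]_3).
Local Notation P := (conv_hull s).
Hypothesis P3 : has_dim P 3.

Definition vertex_seq : seq 'rV[R]_3 :=
  [seq v <- undup s | `[< vertices P v >]].

Lemma vertex_seqP v : reflect (vertices P v) (v \in vertex_seq).
Proof.
apply: (iffP idP); rewrite mem_filter mem_undup; first by case/andP=> /asboolP.
by move=> Vv; rewrite vertex_gen // andbT; apply/asboolP.
Qed.

Hypothesis vertex_trans : forall v w, vertices P v -> vertices P w ->
  exists2 O, is_symmetry P O & v *m O = w.

(** The sum of the vertices is fixed by all symmetries, so that all vertices
    have the same dot product with it; as they span, it vanishes. *)
Lemma vertex_sum0 : \sum_(v <- vertex_seq) v = 0.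
Proof.
set g := \sum_(v <- _) v; have [x0 Px0] := P3.1.
have [v0 Vv0 _] := face_has_vertex 0 Px0.
have gO O : is_symmetry P O -> g *m O = g.
  move=> sO; rewrite /g mulmx_suml -(big_map (mulmx^~ O) predT id).
  apply: perm_big; apply: uniq_perm.
  - by rewrite map_inj_uniq ?filter_uniq ?undup_uniq //; apply/orth_inj/sO.1.
  - by rewrite filter_uniq ?undup_uniq.
  move=> w; apply/mapP/vertex_seqP => [[v /vertex_seqP Vv ->]|Vw].
    exact: sym_vertex.
  exists (w *m O^T); last by rewrite orth_mulmxVr // sO.1.
  by apply/vertex_seqP; apply: sym_vertex => //; apply: sym_tr.
apply: (dim3_constant P3) => x y Px Py.
have gv v : vertices P v -> face P 0 v -> dot g v = dot g v0.
  move=> Vv _; have [ O sO <-] := vertex_trans Vv0 Vv.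
  by rewrite -{1}(gO O sO) dot_orth // sO.1.
by rewrite (vertex_constant gv (x := x)) ?(vertex_constant gv (x := y)) //; apply/face0.
Qed.

Lemma origin_interior c : c != 0 -> exists2 x, P x & 0 < dot c x.
Proof.
move=> c0; apply: contrapT => h; move/eqP: c0; apply.
have c_le0 x : P x -> dot c x <= 0.
  by move=> Px; rewrite leNgt; apply/negP => cx; apply: h; exists x.
have : \sum_(v <- vertex_seq) - dot c v = 0.
  by rewrite sumrN -dot_sumr vertex_sum0 dot0r oppr0.
rewrite big_seq => /eqP; rewrite psumr_eq0 => [/allP hs|v /vertex_seqP Vv]; last first.
  by rewrite oppr_ge0 c_le0 //; apply: vertex_in.
apply: (dim3_constant P3) => x y Px Py.
have cv v : vertices P v -> face P 0 v -> dot c v = 0.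
  move=> /vertex_seqP Vv _; have := hs v Vv; rewrite Vv oppr_eq0.
  by move/eqP.
by rewrite !(vertex_constant cv) //; apply/face0.
Qed.

Definition normal_to F n :=
  (forall x, P x -> dot n x <= 1) /\ forall x, F x <-> P x /\ dot n x = 1.

Lemma ex_normal F : is_face P 2 F -> exists n, normal_to F n.
Proof.
move=> [F2 [c Fc]]; have {}Fc : F = face P c by [].
rewrite {F}Fc in F2 *; have c0 := face2_neq0 P3 F2.
have [v Fv] := F2.1; have [x Px cx] := origin_interior c0.
have cv : 0 < dot c v by apply: lt_le_trans cx _; apply: (proj2 Fv).
exists ((dot c v)^-1 *: c); split=> [y Py|y].
  by rewrite dotZl mulrC ler_pdivrMr // mul1r (proj2 Fv).
rewrite dotZl; split=> [Fy|[Py e]].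
  by rewrite (face_eq Fy Fv) mulVf ?lt0r_neq0 //; split => //; case: Fy.
apply: face_trans Fv Py _; apply: (mulfI (x := (dot c v)^-1)).
  by rewrite invr_eq0 lt0r_neq0.
by rewrite e mulVf ?lt0r_neq0.
Qed.

Lemma normal_uniq F n n' : has_dim F 2 -> normal_to F n -> normal_to F n' -> n = n'.
Proof.
move=> F2 [_ h] [_ h']; have [v Fv] := F2.1; have [_ nv] := (h v).1 Fv.
have [_ nv'] := (h' v).1 Fv.
have n0 : n != 0.
  by apply/eqP => n0; move: nv => /eqP; rewrite n0 dot0l eq_sym oner_eq0.
have [||a e] := @dim2_constant _ F n n' F2 n0.
- by move=> x y /h[_ ->] /h[_ ->].
- by move=> x y /h'[_ ->] /h'[_ ->].
by move: nv'; rewrite e dotZl nv mulr1 => ->; rewrite scale1r.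
Qed.

Lemma normal_inj F F' n : normal_to F n -> normal_to F' n -> F = F'.
Proof.
move=> [_ h] [_ h']; apply/seteqP; split=> x; first by move/h/h'.
by move/h'/h.
Qed.

Lemma normal_sym F n O : is_symmetry P O -> normal_to F n ->
  normal_to [set x *m O | x in F] (n *m O).
Proof.
move=> sO [h1 h2]; have hO := sO.1; split=> [x Px|x].
  by rewrite dot_mulmx h1 //; apply: sym_mem (sym_tr sO) _.
split=> [[y /h2[Py e] <-]|[Px]]; first by rewrite dot_orth //; split=> //; apply: sym_mem.
rewrite dot_mulmx => e; exists (x *m O^T); last by rewrite orth_mulmxVr.
by apply/h2; split=> //; apply: sym_mem (sym_tr sO) _.
Qed.

(** At the normal vector of a 2-face the sum of the generators in that face is
    maximal on the polar; conversely a vertex of the polar on which too few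
    constraints are tight could be moved both ways along a line. *)
Lemma polar_vertexP u :
  vertices (polar P) u <-> exists2 F, is_face P 2 F & normal_to F u.
Proof.
split=> [/vertexP[c ec]|[F F2 nF]].
  have pu : polar P u by apply: (vertex_in (Q := polar P)); apply/vertexP; exists c.
  have su w : w \in s -> dot u w <= 1 by move=> ws; apply: pu; apply: mem_conv.
  have tight d : (forall w, w \in s -> dot u w = 1 -> dot d w = 0) -> d = 0.
    move=> hd; pose l := [seq (1 - dot u w, `|dot d w|) | w <- s & dot u w < 1].
    have [|e e0 he] := @small_eps _ l.
      by move=> ab /mapP[w]; rewrite mem_filter => /andP[cw _] ->; rewrite subr_gt0.
    have pd (d' : 'rV[R]_3) : (forall w, `|dot d' w| = `|dot d w|) ->
        polar P (u + e *: d').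
      move=> dd' x; apply: conv_le => w ws; rewrite dotDl dotZl.
      have := su w ws; rewrite le_eqVlt => /orP[/eqP uw|uw].
        have /eqP : `|dot d' w| = 0 by rewrite dd' hd // normr0.
        by rewrite normr_eq0 uw => /eqP ->; rewrite mulr0 addr0.
      have /= := he (1 - dot u w, `|dot d w|).
      have -> : (1 - dot u w, `|dot d w|) \in l.
        by apply/mapP; exists w => //; rewrite mem_filter uw.
      move=> /(_ isT); rewrite -dd'.
      have : e * dot d' w <= e * `|dot d' w| by rewrite ler_pM2l // ler_norm.
      by lra.
    have p1 : polar P (u + e *: d) by apply: pd.
    have p2 : polar P (u + e *: - d) by apply: pd => w; rewrite dotNl normrN.
    have fu : face (polar P) c u by rewrite -ec.
    have f1 : face (polar P) c (u + e *: d).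
      apply: (face_trans fu p1).
      have := (proj2 fu) _ p1; have := (proj2 fu) _ p2; rewrite !dotx.
      by lra.
    have : [set u] (u + e *: d) by rewrite ec.
    move=> /= /eqP; rewrite addrC -subr_eq0 addrK scaler_eq0 gt_eqF //=.
    by move/eqP.
  have u0 : u != 0.
    apply/eqP => u0; have [t t0 _] := ex_orth2 (0 : 'rV[R]_3) 0.
    suff /eqP : t = 0 by rewrite (negPf t0).
    by apply: tight => w _; rewrite u0 dot0l => /eqP; rewrite eq_sym oner_eq0.
  have [w0 w0s w01] : exists2 w, w \in s & dot u w = 1.
    apply: contrapT => h; move/eqP: u0; apply; apply: tight => w ws uw.
    by case: h; exists w.
  have fw0 : face P u w0.
    by split=> [|y Py]; [exact: mem_conv|rewrite w01; apply: pu].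
  exists (face P u); last first.
    split=> [x|x]; first exact: pu.
    split=> [fx|[Px ux]]; first by rewrite (face_eq fx fw0); split => //; case: fx.
    by apply: (face_trans fw0 Px); rewrite ux.
  split; last by exists u.
  apply: (dim2I _ u0 (@face_constant _ s u)) => [|d hd]; first by exists w0.
  exists (dot d w0); apply/eqP; rewrite -subr_eq0; apply/eqP/tight => w ws uw.
  have fw : face P u w by apply: (face_trans fw0 (mem_conv ws)); rewrite uw.
  by rewrite dotBl dotZl uw mulr1 (hd _ _ fw fw0) subrr.
apply/vertexP; have [h1 h2] := nF.
pose r := [seq w <- s | `[< F w >]]; pose c := \sum_(w <- r) w.
have rF w : w \in r -> w \in s /\ F w.
  by rewrite mem_filter => /andP[/asboolP].
have [Fd [cF Fc]] := F2; have {}Fc : F = face P cF by [].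
have cE y : dot c y = \sum_(w <- r) dot y w.
  by rewrite dotC dot_sumr.
exists c; apply/seteqP; split=> [_ ->|y [Py hy]] /=.
  split=> // y Py; rewrite !cE big_seq [X in _ <= X]big_seq.
  apply: ler_sum => w /rF[ws /h2[Pw ->]]; exact: Py.
have yr w : w \in r -> dot y w = 1.
  have : \sum_(w <- r) (1 - dot y w) = 0.
    apply/eqP; rewrite eq_le; apply/andP; split; last first.
      rewrite big_seq sumr_ge0 // => z /rF[zs _]; rewrite subr_ge0.
      by apply: Py; apply: mem_conv.
    have := hy u h1; rewrite !cE -subr_le0 -sumrB; apply: le_trans.
    rewrite big_seq [X in _ <= X]big_seq; apply: ler_sum => z /rF[_ /h2[_ ->]].
    by [].
  rewrite big_seq => /eqP; rewrite psumr_eq0 => [/allP h wr|z /rF[zs _]].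
    by have := h w wr; rewrite wr subr_eq0 eq_sym => /eqP.
  by rewrite subr_ge0; apply: Py; apply: mem_conv.
have yF x : F x -> dot y x = 1.
  rewrite Fc => fx; apply/eqP; rewrite eq_le (Py _ (proj1 fx)) /=.
  rewrite -lerN2 -dotNl; apply: (face_le _ fx) => w ws fw.
  by rewrite dotNl yr // mem_filter ws andbT; apply/asboolP; rewrite Fc.
have [x Fx] := Fd.1; have u0 : u != 0.
  have [_ ux] := (h2 x).1 Fx.
  by apply/eqP => u0; move: ux => /eqP; rewrite u0 dot0l eq_sym oner_eq0.
have [||a e] := @dim2_constant _ F u y Fd u0.
- by move=> z z' /h2[_ ->] /h2[_ ->].
- by move=> z z' /yF -> /yF ->.
by have := yF x Fx; rewrite e dotZl ((h2 x).1 Fx).2 mulr1 => ->; rewrite scale1r.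
Qed.

End Polar.

(** * The frame of a flag *)

Section Reflections.
Variable R : realType.
Implicit Types (u v w x y : 'rV[R]_3) (O : 'M[R]_3).

Definition acts_as_reflection O w :=
  forall x, x *m O = x - (2 * dot x w / dot w w) *: w.

(** An orthogonal map fixing a plane pointwise preserves the normal line of
    that plane, and acts there as plus or minus the identity. *)
Lemma orth_fix2 O a b w : O *m O^T = 1%:M ->
  dot w a = 0 -> dot w b = 0 -> w != 0 ->
  (forall u, dot u a = 0 -> dot u b = 0 -> dot u w = 0 -> u = 0) ->
  a *m O = a -> b *m O = b -> (exists x, x *m O != x) ->
  acts_as_reflection O w.
Proof.
move=> hO wa wb w0 span aO bO [y yO].
have ww : dot w w != 0 by rewrite dot_eq0.
have wO : w *m O = (dot (w *m O) w / dot w w) *: w.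
  apply/eqP; rewrite -subr_eq0; apply/eqP; apply: span.
  - by rewrite dotBl dotZl wa mulr0 -{1}aO dot_orth // wa subrr.
  - by rewrite dotBl dotZl wb mulr0 -{1}bO dot_orth // wb subrr.
  - by rewrite dotBl dotZl divfK // subrr.
move: wO; set g := _ / _ => wO.
have g2 : (g - 1) * (g + 1) = 0.
  have := dot_orth w w hO; rewrite wO !dotx mulrA => e.
  apply: (mulIf ww); rewrite mul0r.
  by transitivity (g * g * dot w w - dot w w); [ring|rewrite e subrr].
have g1 : g = -1.
  move/eqP: g2; rewrite mulf_eq0 subr_eq0 addr_eq0 => /orP[/eqP g1|/eqP//].
  case/negP: yO; apply/eqP; have [al [be [ga ->]]] := span3 span y.
  by rewrite !mulmxDl -!scalemxAl aO bO wO g1 scale1r.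
move=> x; have [al [be [ga ->]]] := span3 span x.
rewrite !mulmxDl -!scalemxAl aO bO wO g1 !dotx (dotC a) (dotC b) wa wb.
rewrite !mulr0 !add0r mulrA mulfK // scaleN1r scalerN -[RHS]addrA; congr (_ + _).
by rewrite -scalerBl -scaleNr; congr (_ *: _); ring.
Qed.

Lemma reflection_fix O w x : acts_as_reflection O w -> dot x w = 0 -> x *m O = x.
Proof. by move=> h e; rewrite h e mulr0 mul0r scale0r subr0. Qed.

Lemma reflection_inv O w : w != 0 -> acts_as_reflection O w -> O *m O = 1%:M.
Proof.
move=> w0 h; have ww : dot w w != 0 by rewrite dot_eq0.
apply/row_matrixP => i; rewrite !rowE mulmxA mulmx1.
move: (delta_mx 0 i) => x; rewrite !h !dotx.
have -> : 2 * (dot x w - 2 * dot x w / dot w w * dot w w) / dot w w =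
          - (2 * dot x w / dot w w) by field.
by rewrite scaleNr opprK subrK.
Qed.

Lemma reflection_det O w : w != 0 -> acts_as_reflection O w -> \det O = -1.
Proof.
move=> w0 h; have ww : dot w w != 0 by rewrite dot_eq0.
have [t t0 [tw _]] := ex_orth2 w 0.
have [t' t'0 [t'w t't]] := ex_orth2 w t.
have tO := reflection_fix h tw; have t'O := reflection_fix h t'w.
have wO : w *m O = - w.
  by rewrite h mulfK // scaler_nat mulr2n opprD addrA subrr add0r.
pose B := col_mx t (col_mx t' w).
pose D : 'M[R]_(1 + (1 + 1)) := block_mx 1%:M 0 0 (block_mx 1%:M 0 0 (-1)%:M).
have BD : B *m O = D *m B.
  rewrite /B /D !mul_block_col !mul1mx !mul0mx !addr0 !add0r.
  by rewrite mul_scalar_mx scaleN1r !mul_col_mx tO t'O wO.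
have uB : B \in unitmx.
  rewrite -unitmx_tr -row_free_unit -kermx_eq0.
  apply/eqP/row_matrixP => i; rewrite row0.
  move: (row i _) (row_sub i (kermx B^T)) => r /sub_kermxP.
  rewrite !tr_col_mx !mul_mx_row -[in RHS]row_mx0 => /eq_row_mx[/dot_mxP h1].
  rewrite -[in RHS]row_mx0 => /eq_row_mx[/dot_mxP h2 /dot_mxP h3].
  have [||||[a e]|[a e]] := @annihilator_pairs _ t t' r w t0 w0; try by [|rewrite dotC].
    by move: t't; rewrite e dotZl => /eqP; rewrite mulf_eq0 dot_eq0 (negPf t0)
      orbF => /eqP a0; move: t'0; rewrite e a0 scale0r eqxx.
  move: h3; rewrite e dotZl => /eqP; rewrite mulf_eq0 (negPf ww) orbF.
  by move=> /eqP ->; rewrite scale0r.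
have /(congr1 (fun M => \det M)) := BD.
rewrite !det_mulmx [RHS]mulrC => /(mulfI _) ->; last by rewrite -unitfE -unitmxE.
by rewrite /D !det_ublock !det1 !mul1r det_scalar expr1.
Qed.

(** Otherwise [O] would be the reflection in the plane of [a] and [x], whose
    determinant is [- 1]; the last hypothesis says that they span a plane. *)
Lemma rotation_fix2 O a x : O *m O^T = 1%:M -> \det O = 1 ->
  a *m O = a -> x *m O = x -> (dot x a) ^+ 2 < dot x x * dot a a -> O = 1%:M.
Proof.
move=> hO dO aO xO xa.
have a0 : a != 0 by apply: contraTneq xa => ->; rewrite !dot0r expr0n mulr0 ltxx.
have [w w0 [wa wx]] := ex_orth2 a x.
apply/eqP/negPn/negP => O1; suff /(reflection_det w0) : acts_as_reflection O w.
  by rewrite dO => /eqP; rewrite -subr_eq0 opprK -mulr2n pnatr_eq0.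
apply: (@orth_fix2 O a x w) => // [u ua ux uw|].
  have [||||[b e]|[b e]] := @annihilator_pairs _ a x u w a0 w0; try by [|rewrite dotC].
    by exfalso; move: xa; rewrite e !dotx; lra.
  move: uw; rewrite e dotZl => /eqP; rewrite mulf_eq0 dot_eq0 (negPf w0) orbF.
  by move=> /eqP ->; rewrite scale0r.
apply: contrapT => h; case/negP: O1; apply/eqP/row_matrixP => i.
rewrite !rowE mulmx1; apply/eqP/negPn/negP => hi; apply: h.
by exists (delta_mx 0 i).
Qed.

End Reflections.

(** The data carried by a flag (vertex [e + k], edge with midpoint [e], 2-face
    with polar vertex [e + m]) of a canonical regular polyhedron: the midpoint,
    the half-edge and the normal displacement are orthogonal, and the three
    reflections move the vertex, the edge and the face of the flag, one each. *)
Record frame (R : realType) (p q : nat) (P : set 'rV[R]_3) (e k m : 'rV[R]_3)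
    (r1 r2 r3 : 'M[R]_3) : Prop := Frame {
  fr_ee : dot e e = 1;
  fr_ek : dot e k = 0;
  fr_em : dot e m = 0;
  fr_km : dot k m = 0;
  fr_k0 : k != 0;
  fr_m0 : m != 0;
  fr_V : vertices P (e + k);
  fr_U : vertices (polar P) (e + m);
  fr_s1 : is_symmetry P r1;
  fr_s2 : is_symmetry P r2;
  fr_s3 : is_symmetry P r3;
  fr_r1 : acts_as_reflection r1 k;
  fr_r2 : acts_as_reflection r2 (e - (dot k k)^-1 *: k - (dot m m)^-1 *: m);
  fr_r3 : acts_as_reflection r3 m;
  fr_Vtr : forall x, vertices P x ->
    exists2 O, is_symmetry P O & (e + k) *m O = x;
  fr_Utr : forall u, vertices (polar P) u ->
    exists2 O, is_symmetry P O & (e + m) *m O = u;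
  fr_Vcard : ([set x | vertices P x /\ dot x (e + m) = 1] #= `I_p)%card;
  fr_Ucard : ([set u | vertices (polar P) u /\ dot u (e + k) = 1] #= `I_q)%card;
  fr_fin : exists Vs : seq 'rV[R]_3, [/\ uniq Vs,
    forall x, x \in Vs <-> vertices P x & \sum_(x <- Vs) x = 0]
}.

Section OrthogonalFrame.
Variables (R : realType) (e k m : 'rV[R]_3).
Hypotheses (ee : dot e e = 1) (ek : dot e k = 0) (em : dot e m = 0)
  (km : dot k m = 0) (k0 : k != 0) (m0 : m != 0).
Local Notation A := (dot k k)^-1.
Local Notation B := (dot m m)^-1.
Implicit Types x : 'rV[R]_3.

Lemma frame_kill x : dot x e = 0 -> dot x k = 0 -> dot x m = 0 -> x = 0.
Proof.
have e0 : e != 0 by rewrite -dot_eq0 ee oner_eq0.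
move=> xe xk xm.
have [||||[a h]|[a h]] := @annihilator_pairs _ e k x m e0 m0;
  try by [|rewrite dotC].
  by move: k0; rewrite -dot_eq0 {2}h dotZr dotC ek mulr0 eqxx.
by apply/eqP; rewrite -dot_eq0 {2}h dotZr xm mulr0.
Qed.

Lemma frame_expand x : x = dot x e *: e + (A * dot x k) *: k + (B * dot x m) *: m.
Proof.
have kk : dot k k != 0 by rewrite dot_eq0.
have mm : dot m m != 0 by rewrite dot_eq0.
apply/eqP; rewrite -subr_eq0; apply/eqP; apply: frame_kill; rewrite !dotx;
  rewrite ?ee ?(dotC m e) ?(dotC k e) ?(dotC m k) ?ek ?em ?km.
- ring.
- by field; apply/andP.
- by field; apply/andP.
Qed.

End OrthogonalFrame.

Section RegularFrame.
Variables (R : realType) (p q : nat) (s : seq 'rV[R]_3).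
Local Notation P := (conv_hull s).
Hypotheses (hP : canonical_realisation p q P) (q0 : (0 < q)%N).
Implicit Types (E F : set 'rV[R]_3) (v x y z : 'rV[R]_3).

(** The functional exposing [v] is strictly smaller at any other point, hence
    cannot be symmetric about [v]. *)
Lemma vertex_extreme v x y : vertices P v -> P x -> P y -> v - x = y - v -> x = v.
Proof.
move=> /vertexP[c ec] Px Py e; apply/eqP/negPn/negP => xv.
have yv : y != v by rewrite -subr_eq0 -e subr_eq0 eq_sym.
have := vertex_lt ec Px xv; have := vertex_lt ec Py yv.
have /(congr1 (dot c)) := e; rewrite !dotBr; lra.
Qed.

Lemma face_sub d F x : is_face P d F -> F x -> P x.
Proof. by move=> [_ [c ->]] []. Qed.

(** The only other point of the line at that distance is on the far side of
    [x], which would then be the midpoint of a segment in the polytope. *)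
Lemma edge_end E x y z : is_face P 1 E -> vertices P x -> E x -> E y -> E z ->
  x != y -> dot (z - x) (z - x) = dot (y - x) (y - x) -> z = y.
Proof.
move=> fE Vx Ex Ey Ez xy.
have [a ez] := dim1_line fE.1 Ex Ey xy Ez.
have yx : dot (y - x) (y - x) != 0 by rewrite dot_eq0 subr_eq0 eq_sym.
have zx : z - x = a *: (y - x) by rewrite ez addrC addKr.
rewrite zx dotZl dotZr mulrA => h.
have /eqP : (a - 1) * (a + 1) = 0.
  by apply: (mulIf yx); rewrite mul0r -subr_sqr_1 mulrBl expr2 h mul1r subrr.
rewrite mulf_eq0 subr_eq0 addr_eq0 => /orP[/eqP a1|/eqP a1].
  by rewrite ez a1 scale1r addrC subrK.
case/eqP: xy; symmetry; apply: (@vertex_extreme x y z) => //.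
- exact: face_sub fE Ey.
- exact: face_sub fE Ez.
- by rewrite zx a1 scaleN1r opprB.
Qed.

Lemma vertex_face v : vertices P v -> exists2 F, is_face P 2 F & F v.
Proof.
move=> Vv; have [_ [_ /(_ v Vv) /card_set_bijP[f [_ _ surj]]] _] := hP.
by have [F [F2 Fv] _] := surj 0%N q0; exists F.
Qed.

Let P3 : has_dim P 3. Proof. by have [[[_ P3] _] _ _] := hP. Qed.

Lemma flag_at_vertex v : vertices P v -> exists E F, is_flag P v E F.
Proof.
move=> Vv; have [F F2 Fv] := vertex_face Vv.
have [E [_ [E1 _ [Ev _] [EF _] _]]] := two_edges P3 Vv F2 Fv.
by exists E, F.
Qed.

Lemma flag_at_face F : is_face P 2 F -> exists v E, is_flag P v E F.
Proof.
move=> F2; have [[[x Fx] _] [c Fc]] := F2.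
have {}Fc : F = face P c by [].
rewrite Fc in Fx; have [v Vv] := face_has_vertex c (proj1 Fx).
rewrite -Fc => Fv.
have [E [_ [E1 _ [Ev _] [EF _] _]]] := two_edges P3 Vv F2 Fv.
by exists v, E.
Qed.

Lemma vertex_trans v w : vertices P v -> vertices P w ->
  exists2 O, is_symmetry P O & v *m O = w.
Proof.
move=> /flag_at_vertex[E [F fl]] /flag_at_vertex[E' [F' fl']].
have [[_ ft] _ _] := hP.
by have [ O [sO vO _ _]] := ft _ _ _ _ _ _ fl fl'; exists O.
Qed.

Lemma polar_trans u u' : vertices (polar P) u -> vertices (polar P) u' ->
  exists2 O, is_symmetry P O & u *m O = u'.
Proof.
move=> /polar_vertexP[F F2 nF] /polar_vertexP[F' F'2 nF'].
have [v [E fl]] := flag_at_face F2; have [v' [E' fl']] := flag_at_face F'2.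
have [[_ ft] _ _] := hP.
have [ O [sO _ _ FO]] := ft _ _ _ _ _ _ fl fl'; exists O => //.
by apply: (normal_uniq F'2.1 _ nF'); rewrite -FO; apply: normal_sym.
Qed.

(** The tangency point of an edge is its midpoint, since the ends of the edge
    have equal norms. *)
Lemma tangent_midpoint E v w : is_face P 1 E -> E v -> E w -> v != w ->
  dot v v = dot w w ->
  [/\ dot (2^-1 *: (v + w)) v = 1, dot (2^-1 *: (v + w)) w = 1 &
      dot (2^-1 *: (v + w)) (2^-1 *: (v + w)) = 1].
Proof.
move=> fE Ev Ew vw vvww; have [_ _ /(_ E fE)[t [Et tt tE]]] := hP.
have [a et] := dim1_line fE.1 Ev Ew vw Et.
have D0 : dot (w - v) (w - v) != 0 by rewrite dot_eq0 subr_eq0 eq_sym.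
have tv := tE _ Ev; have tw := tE _ Ew.
have a2 : a = 2^-1.
  apply: (mulIf D0); move: tv tw; rewrite et !dotx -vvww (dotC w v).
  by lra.
have -> : 2^-1 *: (v + w) = t.
  by apply: dot_inj => z; rewrite et a2 !dotx; lra.
by [].
Qed.

Lemma regular_frame : exists e k m r1 r2 r3, frame p q P e k m r1 r2 r3.
Proof.
have [[_ ft] [hp hq] _] := hP.
have [x0 Px0] := P3.1; have [v Vv _] := face_has_vertex 0 Px0.
have [F F2 Fv] := vertex_face Vv.
have [E [E' [E1 E'1 [Ev E'v] [EF E'F] EE']]] := two_edges P3 Vv F2 Fv.
have [F' F'2 [EF' FF']] := two_faces P3 E1 F2 EF.
have [v' Vv' [Ev' vv']] : exists2 v', vertices P v' & E v' /\ v' != v.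
  have [w Ew wv] := dim1_two E1.1 Ev; have [_ [cE Ec]] := E1.
  have {}Ec : E = face P cE by []; rewrite Ec in Ew Ev *.
  have [c ec] : exists c, [set v] = face P c by apply/vertexP.
  have [v' [Vv' fv' hv']] := face_max_vertex cE (- c) (proj1 Ew).
  exists v' => //; split=> //; apply/eqP => e.
  have := hv' _ Ew; rewrite e !dotNl lerN2 => h.
  by have := lt_le_trans (vertex_lt ec (proj1 Ew) wv) h; rewrite ltxx.
have fl : is_flag P v E F by [].
have [r1 [s1 vr1 Er1 Fr1]] := ft v E F v' E F fl (And5 Vv' E1 F2 Ev' EF).
have [r2 [s2 vr2 Er2 Fr2]] := ft v E F v E' F fl (And5 Vv E'1 F2 E'v E'F).
have [r3 [s3 vr3 Er3 Fr3]] := ft v E F v E F' fl (And5 Vv E1 F'2 Ev EF').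
have o1 := s1.1; have o2 := s2.1; have o3 := s3.1.
have v'r1 : v' *m r1 = v.
  apply: (edge_end E1 Vv' Ev' Ev) => //; first by rewrite -Er1; exists v'.
  transitivity (dot ((v' - v) *m r1) ((v' - v) *m r1)); first by rewrite mulmxBl vr1.
  by rewrite dot_orth // -(opprB v) dotNl dotNr opprK.
have v'r3 : v' *m r3 = v'.
  apply: (edge_end E1 Vv Ev Ev'); first by rewrite -Er3; exists v'.
    by rewrite eq_sym.
  transitivity (dot ((v' - v) *m r3) ((v' - v) *m r3)); first by rewrite mulmxBl vr3.
  exact: dot_orth.
have vvv : dot v v = dot v' v' by rewrite -vr1 dot_orth.
have [n nF] := ex_normal P3 vertex_trans F2.
have [n' nF'] := ex_normal P3 vertex_trans F'2.
have nr1 : n *m r1 = n.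
  by apply: (normal_uniq F2.1 _ nF); rewrite -{1}Fr1; apply: normal_sym.
have nr2 : n *m r2 = n.
  by apply: (normal_uniq F2.1 _ nF); rewrite -{1}Fr2; apply: normal_sym.
have nr3 : n *m r3 = n'.
  by apply: (normal_uniq F'2.1 _ nF'); rewrite -{1}Fr3; apply: normal_sym.
have nn' : n' != n.
  by apply/eqP => e; apply: FF'; apply: (normal_inj nF'); rewrite e.
have nv := ((nF.2 v).1 (EF _ Ev)).2; have nv' := ((nF.2 v').1 (EF _ Ev')).2.
have n'v := ((nF'.2 v).1 (EF' _ Ev)).2; have n'v' := ((nF'.2 v').1 (EF' _ Ev')).2.
have v_v' : v != v' by rewrite eq_sym.
have [ev ev' ee] := tangent_midpoint E1 Ev Ev' v_v' vvv.
have [e eE] : exists e, e = 2^-1 *: (v + v') by eexists.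
rewrite -eE in ev ev' ee.
have [k kE] : exists k, k = v - e by eexists.
have [m mE] : exists m, m = n - e by eexists.
have vE : v = e + k by rewrite kE addrC subrK.
have nE : n = e + m by rewrite mE addrC subrK.
have ne : dot n e = 1 by rewrite eE !dotx nv nv'; lra.
have ek : dot e k = 0 by rewrite kE dotBr ev ee subrr.
have em : dot e m = 0 by rewrite mE dotBr dotC ne ee subrr.
have km : dot k m = 0.
  by rewrite kE mE !dotx (dotC v n) (dotC v e) (dotC e n) nv ev ne ee; lra.
have k0 : k != 0.
  apply: contra vv'; rewrite kE subr_eq0 => /eqP h; apply/eqP/dot_inj => z.
  by have := congr1 (fun x => dot x z) h; rewrite eE !dotx; lra.
have er3 : e *m r3 = e by rewrite eE -scalemxAl mulmxDl vr3 v'r3.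
have er1 : e *m r1 = e by rewrite eE -scalemxAl mulmxDl vr1 v'r1 addrC.
have kr3 : k *m r3 = k by rewrite kE mulmxBl vr3 er3.
have kr1 : k *m r1 != k.
  apply: contra vv'; rewrite kE mulmxBl vr1 er1 => /eqP h.
  by apply/eqP; apply: addIr h.
have mr1 : m *m r1 = m by rewrite mE mulmxBl nr1 er1.
have e0 : e != 0 by rewrite -dot_eq0 ee oner_eq0.
have mr3n : m *m r3 != m.
  apply: contra nn'; rewrite mE mulmxBl nr3 er3 => /eqP h.
  by apply/eqP; apply: addIr h.
have m0 : m != 0 by apply: contraNneq mr3n => ->; rewrite mul0mx.
have r3m : acts_as_reflection r3 m.
  apply: (orth_fix2 o3 _ _ m0 _ er3 kr3); try by [|rewrite dotC|exists m].
  exact: frame_kill.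
have r1k : acts_as_reflection r1 k.
  apply: (orth_fix2 o1 _ _ k0 _ er1 mr1); try by [|rewrite dotC|exists k].
  by move=> u ue um uk; apply: (@frame_kill _ e k m).
pose A := (dot k k)^-1; pose B := (dot m m)^-1.
have kk : dot k k != 0 by rewrite dot_eq0.
have mm : dot m m != 0 by rewrite dot_eq0.
have A0 : 0 < A by rewrite invr_gt0 dot_gt0.
have B0 : 0 < B by rewrite invr_gt0 dot_gt0.
have r2w : acts_as_reflection r2 (e - A *: k - B *: m).
  have we : dot e (e - A *: k - B *: m) = 1 by rewrite !dotx ee ek em; lra.
  apply: (@orth_fix2 _ _ v n) => //.
  - by rewrite vE !dotx (dotC k e) (dotC m e) (dotC m k) ee ek em km mulVf //; lra.
  - by rewrite nE !dotx (dotC m e) (dotC k e) ee em ek km mulVf //; lra.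
  - by apply: contra_eq_neq we => ->; rewrite dot0r eq_sym oner_eq0.
  - move=> u; rewrite vE nE !dotx => uv un uw.
    have uk : dot u k = - dot u e by lra.
    have um : dot u m = - dot u e by lra.
    have ue : dot u e = 0.
      have : dot u e * (1 + A + B) = 0 by move: uw; rewrite uk um; lra.
      move/eqP; rewrite mulf_eq0 => /orP[/eqP //|].
      by rewrite gt_eqF // !addr_gt0.
    by apply: (@frame_kill _ e k m); rewrite ?uk ?um ?ue ?oppr0.
  - apply: contrapT => h; apply: EE'; rewrite -Er2 -[LHS]image_id.
    apply: eq_imagel => x _; apply/eqP; rewrite eq_sym; apply/negPn/negP => hx.
    by apply: h; exists x.
exists e, k, m, r1, r2, r3; split=> //.
- by rewrite -vE.
- by rewrite -nE; apply/polar_vertexP; exists F.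
- by move=> x Vx; rewrite -vE; apply: vertex_trans.
- by move=> u Uu; rewrite -nE; apply: polar_trans => //; apply/polar_vertexP; exists F.
- rewrite -nE -(_ : vertices P `&` F = [set x | vertices P x /\ dot x n = 1]) ?hp //.
  apply/seteqP; split=> x [Vx]; first by move=> /(nF.2 x).1[_]; rewrite dotC.
  by move=> h; split=> //; apply/(nF.2 x).2; rewrite dotC; split => //; apply: vertex_in.
- rewrite -vE; pose f u : set 'rV[R]_3 := [set x | P x /\ dot u x = 1].
  have fE u G : normal_to s G u -> f u = G.
    by move=> [_ h]; apply/seteqP; split=> x; [move/(h x).2|move/(h x).1].
  have eX : f @` [set u | vertices (polar P) u /\ dot u v = 1] =
            [set F | is_face P 2 F /\ F v].
    apply/seteqP; split=> [_ [u [/polar_vertexP[G G2 nG] uv] <-]|G [G2 Gv]].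
      by rewrite (fE _ _ nG); split=> //; apply/(nG.2 v); split=> //; apply: vertex_in.
    have [u nu] := ex_normal P3 vertex_trans G2; exists u; last exact: fE.
    by split; [apply/polar_vertexP; exists G|case: ((nu.2 v).1 Gv)].
  have := hq v Vv; rewrite -eX; apply: card_eq_trans; apply: card_esym.
  apply: inj_card_eq => u u' /set_mem[/polar_vertexP[G G2 nG] _].
  move=> /set_mem[/polar_vertexP[G' G'2 nG'] _]; rewrite (fE _ _ nG) (fE _ _ nG').
  by move=> eG; apply: (normal_uniq G2.1 nG); rewrite eG.
- exists (vertex_seq s); split.
  + by rewrite filter_uniq // undup_uniq.
  + by move=> x; split=> /vertex_seqP.
  + exact: vertex_sum0 P3 vertex_trans.
Qed.

End RegularFrame.

(** * The angles of the frame *)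

Section FreePermutation.

Lemma free_perm_expn (p : nat) (s : 'S_p) :
  (forall j i i', (s ^+ j)%g i = i -> (s ^+ j)%g i' = i') -> (s ^+ p = 1)%g.
Proof.
move=> free; suff /dvdnP[d pd] : (#[s]%g %| p)%N.
  by rewrite [X in (s ^+ X)%g]pd mulnC expgM expg_order expg1n.
have act : [acts <[s]>%g, on [set: 'I_p]%SET | 'P].
  by apply/actsP => x _ i; rewrite !inE.
have := acts_sum_card_orbit act; rewrite cardsT card_ord => h.
rewrite -[X in (_ %| X)%N]h.
apply: (big_ind (fun n => (#[s]%g %| n)%N)) => [|x y|B /imsetP[i _ ->]]; [exact: dvdn0|exact: dvdn_add|].
have C1 : 'C_(<[s]>)[i | 'P]%g = 1%g; last first.
  by rewrite card_orbit C1 indexg1.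
apply/trivgP/fintype.subsetP => x /finset.setIP[/cycleP[j ->] /astab1P].
rewrite /= /aperm => e; rewrite finset.inE; by apply/eqP/perm.permP => i'; rewrite perm1; apply: free e.
Qed.

(** A bijection of a [p]-element set whose powers have no fixed point unless
    they are trivial generates a free cyclic action, of order dividing [p]. *)
Lemma free_iter (T : Type) (X : set T) (f : T -> T) (p : nat) :
  (X #= `I_p)%card -> (forall x, X x -> X (f x)) ->
  (forall x y, X x -> X y -> f x = f y -> x = y) ->
  (forall j x y, X x -> X y -> iter j f x = x -> iter j f y = y) ->
  forall x, X x -> iter p f x = x.
Proof.
move=> /card_set_bijP[g [gX ginj gsurj]] fX finj free.
have ginj' x y : X x -> X y -> g x = g y -> x = y.
  by move=> Xx Xy; apply: ginj; apply/mem_set.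
have /choice[h hP] : forall i : 'I_p, exists x, X x /\ g x = i.
  by move=> i; have [x Xx gx] := gsurj i (ltn_ord i); exists x.
have g_lt x : X x -> (g x < p)%N by move=> Xx; apply: gX.
pose t i := Ordinal (g_lt _ (fX _ (proj1 (hP i)))).
have ht i : h (t i) = f (h i).
  by apply: ginj'; [exact: (hP _).1|exact/fX/(hP _).1|rewrite (hP _).2].
have tinj : injective t.
  move=> i j e; have := congr1 h e; rewrite !ht => /finj e'; apply: val_inj.
  by rewrite /= -(hP i).2 -(hP j).2 e' //; exact: (hP _).1.
pose s := perm tinj.
have hs j i : h ((s ^+ j)%g i) = iter j f (h i).
  by elim: j => [|j IH]; rewrite ?expg0 ?perm1 // expgSr permM permE ht IH.
move=> x Xx; have hg : h (Ordinal (g_lt x Xx)) = x.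
  by apply: ginj'; rewrite ?(hP _).2 //; exact: (hP _).1.
rewrite -{1}hg -hs (_ : s ^+ p = 1)%g ?perm1 //.
apply: free_perm_expn => j i i' e.
have : iter j f (h i') = h i'.
  by apply: (free _ (h i)); [exact: (hP _).1|exact: (hP _).1|rewrite -hs e].
rewrite -hs => /(congr1 g); rewrite !(hP _).2; exact: val_inj.
Qed.

End FreePermutation.

Section Spin.
Variable R : realType.

Lemma iter_mulmx n (x : 'rV[R]_3) (O : 'M[R]_3) (j : nat) :
  n = j -> iter j (fun y => y *m O) x = x *m (O ^+ n).
Proof.
move=> ->; elim: j => [|j IH]; first by rewrite expr0 mulmx1.
by rewrite iterS IH exprSr mulmxA.
Qed.

Lemma orth_exp (O : 'M[R]_3) (j : nat) : O *m O^T = 1%:M ->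
  (O ^+ j) *m (O ^+ j)^T = 1%:M.
Proof.
move=> hO; elim: j => [|j IH]; first by rewrite expr0 trmx1 mulmx1.
by rewrite exprSr trmx_mul -mulmxA (mulmxA O) hO mul1mx.
Qed.

(** A rotation permuting a finite set of [p] points off its axis acts freely on
    them, so its [p]-th power fixes them. *)
Lemma rotation_period (X : set 'rV[R]_3) (O : 'M[R]_3) a (p : nat) :
  O *m O^T = 1%:M -> \det O = 1 -> a *m O = a -> (X #= `I_p)%card ->
  (forall x, X x -> X (x *m O)) ->
  (forall x, X x -> (dot x a) ^+ 2 < dot x x * dot a a) ->
  forall x, X x -> x *m (O ^+ p) = x.
Proof.
move=> hO dO aO cX XO off x Xx; rewrite -(iter_mulmx x O (erefl p)).
apply: (free_iter cX) => // [y z _ _|j y z Xy Xz]; first exact: orth_inj.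
rewrite !(iter_mulmx _ _ (erefl j)) => yj.
suff -> : O ^+ j = 1%:M by rewrite mulmx1.
apply: (rotation_fix2 (orth_exp j hO) _ _ yj (off _ Xy)).
  elim: j {yj} => [|j IH]; first by rewrite expr0 det1.
  by rewrite exprS det_mulmx dO IH mulr1.
elim: j {yj} => [|j IH]; first by rewrite expr0 mulmx1.
by rewrite exprS mulmxA aO.
Qed.

End Spin.

Section OmegaValues.
Variable R : realType.
Local Notation omega n := (omega R n).

Lemma cos_lt1 (x : R) : 0 < x < pi -> cos x < 1.
Proof.
move=> /sin_gt0_pi s0; rewrite lt_neqAle cos_le1 andbT; apply/eqP => c1.
have := cos2Dsin2 x; rewrite c1 expr1n => /eqP.
by rewrite addrC -subr_eq0 addrK sqrf_eq0 gt_eqF.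
Qed.

Lemma omega3 : omega 3 = 0.
Proof.
have pi0 := pi_gt0 R; set x : R := 2 * pi / 3.
have c1 : cos x < 1 by apply: cos_lt1; rewrite /x; lra.
have c2 : cos (x + x) = cos x.
  by rewrite -[RHS]cosN -[RHS]cosD2pi; congr cos; rewrite /x; field.
have := cos2Dsin2 x; move: c2; rewrite cosD => c2 c3.
have /eqP : (cos x - 1) * (2 * cos x + 1) = 0.
  by move: c2 c3; rewrite !expr2; move: (cos x) (sin x) => c s; lra.
rewrite mulf_eq0 subr_eq0 lt_eqF //= => /eqP h.
by rewrite /Defs.omega -/x; lra.
Qed.

Lemma omega4 : omega 4 = 1.
Proof.
rewrite /Defs.omega (_ : 2 * pi / 4 = pi / 2) ?cos_pihalf ?mulr0 ?addr0 //.
by field.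
Qed.

Lemma omega5 : omega 5 ^+ 2 = omega 5 + 1 /\ 1 < omega 5.
Proof.
have pi0 := pi_gt0 R; pose x : R := 2 * pi / 5.
have -> : omega 5 = 1 + 2 * cos x by [].
have c1 : cos x < 1 by apply: cos_lt1; rewrite /x; lra.
have c0 : 0 < cos x by apply: cos_gt0_pihalf; rewrite /x; lra.
have c2 : cos (x + x + x) = cos (x + x).
  by rewrite -[RHS]cosN -[RHS]cosD2pi; congr cos; rewrite /x; field.
have := cos2Dsin2 x; move: c2; rewrite !cosD !sinD => c2 c3.
have /eqP : (cos x - 1) * (4 * cos x ^+ 2 + 2 * cos x - 1) = 0.
  move: c2 c3; move: (cos x) (sin x) => c s c2 c3.
  have s2 : s ^+ 2 = 1 - c ^+ 2 by lra.
  have e1 : (c * c - s * s) * c - (s * c + c * s) * s = 4 * c ^+ 3 - 3 * c.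
    by transitivity (c ^+ 3 - 3 * c * s ^+ 2); [ring|rewrite s2; ring].
  have e2 : c * c - s * s = 2 * c ^+ 2 - 1.
    by transitivity (c ^+ 2 - s ^+ 2); [ring|rewrite s2; ring].
  have h : 4 * c ^+ 3 - 3 * c = 2 * c ^+ 2 - 1 by rewrite -e1 -e2.
  by transitivity (4 * c ^+ 3 - 3 * c - (2 * c ^+ 2 - 1)); [ring|rewrite h subrr].
rewrite mulf_eq0 subr_eq0 lt_eqF //= => /eqP h; split; last lra.
by apply/eqP; rewrite -subr_eq0; apply/eqP; rewrite -[RHS]h; ring.
Qed.

End OmegaValues.

Section Coordinates.
Variables (R : realType) (e k m : 'rV[R]_3).
Hypotheses (ee : dot e e = 1) (ek : dot e k = 0) (em : dot e m = 0)
  (km : dot k m = 0) (k0 : k != 0) (m0 : m != 0).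
Local Notation A := (dot k k)^-1.
Local Notation B := (dot m m)^-1.
Variables (r1 r2 r3 : 'M[R]_3).
Hypotheses (h1 : acts_as_reflection r1 k)
  (h2 : acts_as_reflection r2 (e - A *: k - B *: m))
  (h3 : acts_as_reflection r3 m).

Definition vec (x y z : R) : 'rV[R]_3 := x *: e + y *: k + z *: m.

(** Four times the squared cosines of the dihedral angles between the mirrors
    of [r1], [r2] and of [r2], [r3]. *)
Definition cosp : R := 4 * A / (1 + A + B).
Definition cosq : R := 4 * B / (1 + A + B).

Let kk : dot k k != 0. Proof. by rewrite dot_eq0. Qed.
Let mm : dot m m != 0. Proof. by rewrite dot_eq0. Qed.
Let A0 : 0 < A. Proof. by rewrite invr_gt0 dot_gt0. Qed.
Let B0 : 0 < B. Proof. by rewrite invr_gt0 dot_gt0. Qed.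
Let AB0 : 0 < 1 + A + B. Proof. by rewrite !addr_gt0. Qed.

Lemma cosp_gt0 : 0 < cosp. Proof. by rewrite divr_gt0 ?mulr_gt0. Qed.
Lemma cosq_gt0 : 0 < cosq. Proof. by rewrite divr_gt0 ?mulr_gt0. Qed.

Lemma dot_vec x y z x' y' z' : dot (vec x y z) (vec x' y' z') =
  x * x' + y * y' * dot k k + z * z' * dot m m.
Proof.
rewrite !dotx (dotC k e) (dotC m e) (dotC m k) ee ek em km; ring.
Qed.

Lemma vec_k : vec 0 1 0 = k.
Proof. by rewrite /vec scale1r !scale0r addr0 add0r. Qed.

Lemma vec_m : vec 0 0 1 = m.
Proof. by rewrite /vec scale1r !scale0r !add0r. Qed.

Lemma vec_w : vec 1 (- A) (- B) = e - A *: k - B *: m.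
Proof. by rewrite /vec scale1r !scaleNr. Qed.

Lemma vecD x y z x' y' z' :
  vec x y z + vec x' y' z' = vec (x + x') (y + y') (z + z').
Proof. by apply: dot_inj => u; rewrite !dotx; ring. Qed.

Lemma vecZ c x y z : c *: vec x y z = vec (c * x) (c * y) (c * z).
Proof. by apply: dot_inj => u; rewrite !dotx; ring. Qed.

Lemma vecN x y z : - vec x y z = vec (- x) (- y) (- z).
Proof. by apply: dot_inj => u; rewrite !dotx; ring. Qed.

Lemma vec_v : e + k = vec 1 1 0.
Proof. by apply: dot_inj => u; rewrite !dotx; ring. Qed.

Lemma vec_n : e + m = vec 1 0 1.
Proof. by apply: dot_inj => u; rewrite !dotx; ring. Qed.

Lemma vec_r1 x y z : vec x y z *m r1 = vec x (- y) z.
Proof.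
rewrite h1 -{2}vec_k -[in X in X *: _]vec_k !dot_vec; apply: dot_inj => u.
by rewrite !dotx; field.
Qed.

Lemma vec_r3 x y z : vec x y z *m r3 = vec x y (- z).
Proof.
rewrite h3 -[in X in X *: _]vec_m !dot_vec; apply: dot_inj => u.
by rewrite !dotx; field.
Qed.

Lemma vec_r2 x y z (h := (x - y - z) / 2) : vec x y z *m r2 =
  vec (x - (4 - cosp - cosq) * h) (y + cosp * h) (z + cosq * h).
Proof.
rewrite h2 -vec_w !dot_vec vecZ vecN vecD /h /cosp /cosq.
have nz : 1 + A + B != 0 by rewrite gt_eqF.
have -> : 1 * 1 + - A * - A * dot k k + - B * - B * dot m m = 1 + A + B.
  transitivity (1 + A * (A * dot k k) + B * (B * dot m m)); first by ring.
  by rewrite !mulVf // !mulr1.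
have -> : x * 1 + y * - A * dot k k + z * - B * dot m m = x - y - z.
  transitivity (x - y * (A * dot k k) - z * (B * dot m m)); first by ring.
  by rewrite !mulVf // !mulr1.
move: A B nz => A' B' nz.
by congr vec; field.
Qed.

Lemma vec_inj x y z x' y' z' : vec x y z = vec x' y' z' ->
  [/\ x = x', y = y' & z = z'].
Proof.
move=> h; split.
- have := congr1 (fun u => dot u (vec 1 0 0)) h; rewrite !dot_vec.
  by rewrite !mulr1 !mulr0 !mul0r !addr0.
- have := congr1 (fun u => dot u (vec 0 1 0)) h; rewrite !dot_vec.
  by rewrite !mulr1 !mulr0 !mul0r !addr0 !add0r => /(mulIf kk).
- have := congr1 (fun u => dot u (vec 0 0 1)) h; rewrite !dot_vec.
  by rewrite !mulr1 !mulr0 !mul0r !add0r => /(mulIf mm).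
Qed.

(** The rotation [r1 r2] fixes the axis [e + m]; the equations saying that its
    [p]-th power fixes [e + k] are polynomial in [cosp], and their only
    admissible common root belongs to the angle [2 pi / p], because the orbit
    stays on the inner side of the plane through the midpoint [e]. *)
Lemma cosp_value (p : nat) : p \in [:: 3; 4; 5]%N ->
  (e + k) *m ((r1 *m r2) ^+ p) = e + k ->
  dot ((e + k) *m ((r1 *m r2) ^+ 2)) (e - m) <= 1 ->
  cosp = 1 + omega R p.
Proof.
have c0 := cosp_gt0; have d0 := cosq_gt0.
have step x y z : vec x y z *m (r1 *m r2) =
    vec (x - (4 - cosp - cosq) * ((x + y - z) / 2)) (- y + cosp * ((x + y - z) / 2))
      (z + cosq * ((x + y - z) / 2)).
  by rewrite mulmxA vec_r1 vec_r2 opprK.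
have expS u j : u *m ((r1 *m r2) ^+ j.+1) = u *m (r1 *m r2) *m ((r1 *m r2) ^+ j).
  by rewrite exprS -[RHS]mulmxA.
have dm : cosq * dot m m = 4 - cosp - cosq.
  rewrite /cosp /cosq; have nz : 1 + A + B != 0 by rewrite gt_eqF.
  transitivity (4 * (B * dot m m) / (1 + A + B)); first by ring.
  by rewrite mulVf //; move: A B nz => A' B' nz; field.
have dm0 : 0 < cosq * dot m m by rewrite mulr_gt0 ?dot_gt0.
rewrite dm in dm0.
move: cosp cosq c0 d0 step dm dm0 => c d c0 d0 step dm dm0 hp.
have -> : e - m = vec 1 0 (-1).
  by apply: dot_inj => u; rewrite !dotx; ring.
rewrite vec_v; move: hp; rewrite !inE => /or3P[] /eqP ->;
  rewrite !expS expr0 !mulmx1 !step.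
- move=> /vec_inj[_ ey ez] _; rewrite omega3 addr0.
  have e1 : d * ((c - 2) * (c - 1)) = 0 by rewrite -[RHS]ez; field.
  have e2 : ((c - 2) ^+ 2 - 2) * (c - 1) = 0.
    by apply: (addIr 1); rewrite add0r -[RHS]ey; field.
  clear ey ez.
  move/eqP: e1; rewrite !mulf_eq0 (gt_eqF d0) /= !subr_eq0 => /orP[/eqP cE|/eqP //].
  by move: e2; rewrite cE; lra.
- move=> /vec_inj[_ ey ez] _; rewrite omega4.
  set t := c - 2.
  have e1 : d * ((t ^+ 2 + t - 1) * t) = 0 by rewrite -[RHS]ez /t; field.
  have e2 : t * (t ^+ 3 - 3 * t + t ^+ 2 - 2) = 0.
    by apply: (addIr 1); rewrite add0r -[RHS]ey /t; field.
  clear ey ez.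
  suff : t = 0 by rewrite /t; lra.
  move/eqP: e1; rewrite !mulf_eq0 (gt_eqF d0) /= => /orP[/eqP e1|/eqP //].
  move/eqP: e2; rewrite !mulf_eq0 => /orP[/eqP //|/eqP e2].
  have t1 : t = - 1.
    have : t * (t ^+ 2 + t - 1) = 0 by rewrite e1 mulr0.
    by move: e2; lra.
  by move: e1; rewrite t1; lra.
- move=> /vec_inj[_ ey ez] hc.
  set t := c - 2.
  have e1 : d * ((t ^+ 2 + t - 1) * (t ^+ 2 - 1)) = 0 by rewrite -[RHS]ez /t; field.
  have e2 : (t ^+ 2 + t - 1) * (t ^+ 3 - 3 * t) = 0.
    by apply: (addIr 1); rewrite add0r -[RHS]ey /t; field.
  clear ey ez.
  have t2 : t ^+ 2 + t - 1 = 0.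
    move/eqP: e1; rewrite !mulf_eq0 (gt_eqF d0) /= => /orP[/eqP //|/eqP e1].
    move/eqP: e2; rewrite !mulf_eq0 => /orP[/eqP //|/eqP e2].
    have t0 : t = 0.
      have : t * (t ^+ 2 - 1) = 0 by rewrite e1 mulr0.
      by move: e2; lra.
    by move: e1; rewrite t0; lra.
  have [w2 w1] := omega5 R.
  have c1 : 0 <= c - 1.
    rewrite -(pmulr_rge0 _ dm0); move: hc; rewrite dot_vec.
    set x2 := (X in X * 1 + _); set z2 := (X in _ + X * -1 * _).
    have -> : z2 = d * (c - 1) by rewrite /z2; field.
    have -> : x2 = 1 - (4 - c - d) * (c - 1) by rewrite /x2; field.
    have -> : d * (c - 1) * -1 * dot m m = - ((4 - c - d) * (c - 1)).
      by transitivity (- ((d * dot m m) * (c - 1))); [ring|rewrite dm].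
    rewrite !mulr0 mul0r addr0 mulr1 -subr_ge0 {z2 x2}; move: (_ * (c - 1)) => g.
    by move=> h; rewrite -(pmulr_rge0 _ (ltr0Sn R 1)); apply: le_trans h _; rewrite le_eqVlt; apply/orP; left; apply/eqP; ring.
  have /eqP : (c - 1 - omega R 5) * (c - 1 + (omega R 5 - 1)) = 0.
    by move: t2 w2; rewrite /t; lra.
  rewrite mulf_eq0 => /orP[|/eqP]; last by lra.
  by rewrite subr_eq0 => /eqP <-; ring.
Qed.

End Coordinates.

(** * The chamber of the reflection group *)

Section Chamber.
Variables (R : realType) (p q : nat) (P : set 'rV[R]_3) (e k m : 'rV[R]_3)
  (r1 r2 r3 : 'M[R]_3).
Hypothesis fr : frame p q P e k m r1 r2 r3.
Implicit Types (x y z u : 'rV[R]_3) (O g : 'M[R]_3).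
Local Notation A := (dot k k)^-1.
Local Notation B := (dot m m)^-1.
Local Notation v := (e + k).
Local Notation n := (e + m).
Local Notation w := (e - A *: k - B *: m).
Local Notation V := (vertices P).

Let ee := fr_ee fr.
Let ek := fr_ek fr.
Let em := fr_em fr.
Let km := fr_km fr.
Let k0 := fr_k0 fr.
Let m0 := fr_m0 fr.
Let kk : 0 < dot k k. Proof. by rewrite dot_gt0 k0. Qed.
Let mm : 0 < dot m m. Proof. by rewrite dot_gt0 m0. Qed.
Let A0 : 0 < A. Proof. by rewrite invr_gt0. Qed.
Let B0 : 0 < B. Proof. by rewrite invr_gt0. Qed.
Let kA : A * dot k k = 1. Proof. by rewrite mulVf // gt_eqF. Qed.
Let mB : B * dot m m = 1. Proof. by rewrite mulVf // gt_eqF. Qed.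
Let ke : dot k e = 0. Proof. by rewrite dotC. Qed.
Let me : dot m e = 0. Proof. by rewrite dotC. Qed.
Let mk : dot m k = 0. Proof. by rewrite dotC. Qed.
Let we : dot w e = 1.
Proof. by rewrite !dotx ee ke me !mulr0 !subr0. Qed.
Let wk : dot w k = - 1.
Proof. by rewrite !dotx ek mk kA mulr0 subr0 sub0r. Qed.
Let wm : dot w m = - 1.
Proof. by rewrite !dotx em km mB mulr0 subr0 sub0r. Qed.
Let w0 : w != 0.
Proof. by apply: contra_eq_neq we => ->; rewrite dot0l eq_sym oner_eq0. Qed.

Lemma frame_vr1 : v *m r1 = e - k.
Proof. by rewrite (fr_r1 fr) !dotx ek add0r mulfK ?gt_eqF // scaler_nat mulr2n
  opprD addrA addrK. Qed.

Lemma frame_nr3 : n *m r3 = e - m.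
Proof. by rewrite (fr_r3 fr) !dotx em add0r mulfK ?gt_eqF // scaler_nat mulr2n
  opprD addrA addrK. Qed.

Lemma frame_nr1 : n *m r1 = n.
Proof. by apply: (reflection_fix (fr_r1 fr)); rewrite !dotx ek mk addr0. Qed.

Lemma frame_vr3 : v *m r3 = v.
Proof. by apply: (reflection_fix (fr_r3 fr)); rewrite !dotx em km addr0. Qed.

Lemma frame_vr2 : v *m r2 = v.
Proof. by apply: (reflection_fix (fr_r2 fr)); rewrite dotC dotDr we wk subrr. Qed.

Lemma frame_nr2 : n *m r2 = n.
Proof. by apply: (reflection_fix (fr_r2 fr)); rewrite dotC dotDr we wm subrr. Qed.

Lemma sym_vertices Q O : is_symmetry Q O -> is_symmetry (vertices Q) O.
Proof.
move=> sO; apply: symI sO.1 _ _ => x; first exact: sym_vertex.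
by apply: sym_vertex; apply: sym_tr.
Qed.

Lemma vertex_polar_le x u : V x -> vertices (polar P) u -> dot u x <= 1.
Proof. by move=> Vx Uu; apply: (vertex_in Uu); apply: vertex_in. Qed.

Lemma vertex_norm x : V x -> dot x x = 1 + dot k k.
Proof.
move=> /(fr_Vtr fr)[ O [hO _] <-]; rewrite dot_orth // !dotx ee ek ke.
by rewrite addr0 add0r.
Qed.

Lemma polar_norm u : vertices (polar P) u -> dot u u = 1 + dot m m.
Proof.
move=> /(fr_Utr fr)[ O [hO _] <-]; rewrite dot_orth // !dotx ee em me.
by rewrite addr0 add0r.
Qed.

Lemma frame_v' : V (e - k).
Proof. rewrite -frame_vr1; exact: sym_vertex (fr_s1 fr) (fr_V fr). Qed.

Lemma frame_n' : vertices (polar P) (e - m).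
Proof.
rewrite -frame_nr3; exact: sym_vertex (sym_polar (fr_s3 fr)) (fr_U fr).
Qed.

Lemma frame_cosp : p \in [:: 3; 4; 5]%N -> cosp k m = 1 + omega R p.
Proof.
move=> hp; have o1 := (fr_s1 fr).1; have o2 := (fr_s2 fr).1.
have s12 := sym_mul (fr_s1 fr) (fr_s2 fr).
have n12 : n *m (r1 *m r2) = n by rewrite mulmxA frame_nr1 frame_nr2.
apply: (cosp_value ee ek em km k0 m0 (fr_r1 fr) (fr_r2 fr) hp).
  apply: (rotation_period s12.1 _ n12 (fr_Vcard fr)).
  - by rewrite det_mulmx (reflection_det k0 (fr_r1 fr))
      (reflection_det w0 (fr_r2 fr)) mulrNN mulr1.
  - move=> x [Vx xn]; split; first exact: sym_vertex.
    by rewrite -[X in dot _ X]n12 dot_orth // s12.1.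
  - move=> x [Vx ->]; rewrite (vertex_norm Vx) (polar_norm (fr_U fr)) expr1n.
    by rewrite mulrDl mul1r mulrDr mulr1 -addrA ltrDl addr_gt0 // addr_gt0 // mulr_gt0.
  - by split; [exact: fr_V fr|rewrite !dotx ee em ke km !addr0].
rewrite dotC; apply: vertex_polar_le frame_n'.
rewrite expr2 -[r1 *m r2 * _]/(r1 *m r2 *m _) mulmxA.
by do 2!(apply: sym_vertex => //); exact: fr_V fr.
Qed.

Lemma frame_cosq : q \in [:: 3; 4; 5]%N -> cosq k m = 1 + omega R q.
Proof.
move=> hq; have o3 := (fr_s3 fr).1; have o2 := (fr_s2 fr).1.
have s32 := sym_mul (fr_s3 fr) (fr_s2 fr).
have v32 : v *m (r3 *m r2) = v by rewrite mulmxA frame_vr3 frame_vr2.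
have -> : cosq k m = cosp m k by rewrite /cosq /cosp addrAC.
have h2 : acts_as_reflection r2 (e - B *: m - A *: k) by rewrite addrAC; exact: fr_r2 fr.
apply: (cosp_value ee em ek mk m0 k0 (fr_r3 fr) h2 hq).
  apply: (rotation_period s32.1 _ v32 (fr_Ucard fr)).
  - by rewrite det_mulmx (reflection_det m0 (fr_r3 fr))
      (reflection_det w0 (fr_r2 fr)) mulrNN mulr1.
  - move=> u [Uu uv]; split; first by apply: sym_vertex => //; exact: sym_polar.
    by rewrite -[X in dot _ X]v32 dot_orth // s32.1.
  - move=> u [Uu ->]; rewrite (polar_norm Uu) (vertex_norm (fr_V fr)) expr1n.
    by rewrite mulrDl mul1r mulrDr mulr1 -addrA ltrDl addr_gt0 // addr_gt0 // mulr_gt0.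
  - by split; [exact: fr_U fr|rewrite !dotx ee ek me mk !addr0].
apply: vertex_polar_le frame_v' _.
rewrite expr2 -[r3 *m r2 * _]/(r3 *m r2 *m _) mulmxA.
by do 2!(apply: sym_vertex; first exact: sym_polar); exact: fr_U fr.
Qed.

(** The symmetries of the vertex set move a point within a finite set, because
    every point is a linear combination of three vertices. *)
Lemma finite_orbit x : exists X : seq 'rV[R]_3,
  forall O, is_symmetry V O -> x *m O \in X.
Proof.
have [Vs [_ hVs _]] := fr_fin fr.
pose v'' := (e - k) *m r2.
have Vv'' : V v'' by apply: sym_vertex (fr_s2 fr) frame_v'.
have v''E : v'' = vec e k m (1 - (4 - cosp k m - cosq k m)) (cosp k m - 1) (cosq k m).
  have v'E : e - k = vec e k m 1 (-1) 0.
    by apply: dot_inj => u; rewrite !dotx; ring.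
  rewrite /v'' v'E (vec_r2 ee ek em km k0 m0 (fr_r2 fr)).
  by congr vec; field.
have span u : dot u v = 0 -> dot u (e - k) = 0 -> dot u v'' = 0 -> u = 0.
  rewrite v''E !dotx => h1 h2.
  have -> : dot u e = 0 by lra.
  have -> : dot u k = 0 by lra.
  rewrite !mulr0 !add0r => /eqP; rewrite mulf_eq0 gt_eqF ?cosq_gt0 //= => /eqP um.
  by apply: (frame_kill ee ek em km k0 m0) => //; lra.
have [a [b [c ->]]] := span3 span x.
exists [seq y + c *: z | y <- [seq a *: y + b *: z | y <- Vs, z <- Vs], z <- Vs].
move=> O sO; have VO y : V y -> y *m O \in Vs.
  by move=> Vy; apply/hVs; apply: sym_mem.
rewrite !mulmxDl -!scalemxAl.
apply/allpairsP; exists (a *: (v *m O) + b *: ((e - k) *m O), v'' *m O).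
split=> //; last exact: VO.
apply/allpairsP; exists (v *m O, (e - k) *m O).
by split=> //; apply: VO; [exact: fr_V fr|exact: frame_v'].
Qed.

(** The cone over the flag: its edges are spanned by [v], [e] and [n]. *)
Definition in_chamber x := [/\ 0 <= dot x k, 0 <= dot x w & 0 <= dot x m].

Inductive wall : 'M[R]_3 -> 'rV[R]_3 -> Prop :=
| wall1 : wall r1 k
| wall2 : wall r2 w
| wall3 : wall r3 m.

Definition chamber_point := v + e + n.
Local Notation x0 := chamber_point.

Lemma wallP x : (forall r u, wall r u -> 0 <= dot x u) -> in_chamber x.
Proof. by move=> h; split; apply: h; constructor. Qed.

Lemma wall_point r u : wall r u -> 0 < dot x0 u.
Proof.
rewrite /chamber_point; case.
- by have := kk; rewrite !dotDl ek mk; lra.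
- by rewrite dotC !(dotDr w) we wk wm; lra.
- by have := mm; rewrite !dotDl em km; lra.
Qed.

Lemma wall_reflection r u : wall r u -> acts_as_reflection r u.
Proof. by case; [exact: fr_r1 fr|exact: fr_r2 fr|exact: fr_r3 fr]. Qed.

Lemma wall_neq0 r u : wall r u -> u != 0.
Proof. by case. Qed.

Lemma wall_sym r u : wall r u -> is_symmetry P r.
Proof. by case; [exact: fr_s1 fr|exact: fr_s2 fr|exact: fr_s3 fr]. Qed.

Lemma wall_climb r u x y : wall r u -> dot x u < 0 -> 0 <= dot y u ->
  dot x y <= dot (x *m r) y.
Proof.
move=> wr xu yu; rewrite (wall_reflection wr) dotBl dotZl lerDl oppr_ge0 (dotC u).
rewrite mulr_le0_ge0 // mulr_le0_ge0 ?invr_ge0 ?dot_ge0 //.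
by rewrite mulr_ge0_le0 // ltW.
Qed.

Lemma wall_climb_lt r u x : wall r u -> dot x u < 0 ->
  dot x x0 < dot (x *m r) x0.
Proof.
move=> wr xu; rewrite (wall_reflection wr) dotBl dotZl ltrDl oppr_gt0 (dotC u).
rewrite pmulr_llt0 ?(wall_point wr) // pmulr_llt0; first by rewrite pmulr_rlt0.
by rewrite invr_gt0 dot_gt0 (wall_neq0 wr).
Qed.

Lemma count_lt (T : eqType) (a b : pred T) (s : seq T) (z : T) :
  (forall t, a t -> b t) -> z \in s -> b z -> ~~ a z -> (count a s < count b s)%N.
Proof.
move=> ab zs bz az; have -> : count b s = (count a s + count (predD b a) s)%N.
  rewrite -count_predUI [X in (_ + X)%N](eq_count (a2 := pred0)) ?count_pred0 ?addn0.
    by apply: eq_count => y /=; case ay : (a y); rewrite //= ?(ab _ ay).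
  by move=> y /=; case: (a y).
by rewrite -[X in (X < _)%N]addn0 ltn_add2l -has_count; apply/hasP; exists z => //=;
  rewrite az bz.
Qed.

(** Reflecting a point in a wall that separates it from the chamber raises its
    dot product with a point inside the chamber; on a finite orbit this climb
    ends in the chamber. *)
Lemma climb_ind x (Q : 'rV[R]_3 -> Prop) :
  (forall O, is_symmetry V O -> in_chamber (x *m O) -> Q (x *m O)) ->
  (forall O r u, is_symmetry V O -> wall r u -> dot (x *m O) u < 0 ->
    Q (x *m O *m r) -> Q (x *m O)) ->
  forall O, is_symmetry V O -> Q (x *m O).
Proof.
move=> base step O; have [X hX] := finite_orbit x.
have [N] := ubnP (count (fun y => dot (x *m O) x0 < dot y x0) X).
elim: N O => // N IH O; rewrite ltnS => le_N sO.
have [/base|] := pselect (in_chamber (x *m O)); first exact.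
move=> nD; have [r [u [wr xu]]] : exists r u, wall r u /\ dot (x *m O) u < 0.
  apply: contrapT => h; apply: nD; apply: wallP => r u wr; rewrite leNgt.
  by apply/negP => xu; apply: h; exists r, u.
apply: (step O r u sO wr xu); rewrite -mulmxA; apply: IH.
  apply: leq_trans le_N; have lt := wall_climb_lt wr xu.
  apply: (count_lt (z := x *m (O *m r))).
  - by move=> y; rewrite mulmxA; apply: lt_trans.
  - by apply: hX; apply: sym_mul => //; exact: sym_vertices (wall_sym wr).
  - by rewrite mulmxA.
  - by rewrite ltxx.
by apply: sym_mul => //; exact: sym_vertices (wall_sym wr).
Qed.

Lemma chamber_expand x : in_chamber x -> exists a b c,
  [/\ 0 <= a, 0 <= b, 0 <= c & x = a *: v + b *: e + c *: n].
Proof.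
move=> [xk xw xm]; exists (A * dot x k), (dot x w), (B * dot x m); split.
- by rewrite mulr_ge0 // ltW.
- by [].
- by rewrite mulr_ge0 // ltW.
rewrite [LHS](frame_expand ee ek em km k0 m0); apply: dot_inj => y.
rewrite !(dotx, dotBr x); ring.
Qed.

Definition mirror_group := generated mulmx 1%:M [set r1; r2; r3].

Lemma mirror_wall r u : wall r u -> mirror_group r.
Proof. by case; apply: generated_base; [left; left|left; right|right]. Qed.

Lemma mirror_sym O : mirror_group O -> is_symmetry P O.
Proof.
elim=> [|_ [[->|->]|->]|O1 O2 _ s1 _ s2|O1 O2 _ s1 e1 e2].
- by apply: symI => [|x|x]; rewrite ?trmx1 mulmx1.
- exact: fr_s1 fr.
- exact: fr_s2 fr.
- exact: fr_s3 fr.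
- exact: sym_mul.
- suff -> : O2 = O1^T by apply: sym_tr.
  by rewrite -[LHS]mul1mx -(mulmx1C s1.1) -mulmxA e1 mulmx1.
Qed.

Lemma vertex_le_self x : V x -> dot x v <= dot v v.
Proof.
move=> Vx; have := dot_ge0 (x - v); rewrite !dotBl !dotBr (vertex_norm Vx).
by rewrite (vertex_norm (fr_V fr)) (dotC v x); lra.
Qed.

Lemma vertex_le_e x : V x -> dot x e <= 1.
Proof.
move=> Vx; have := vertex_polar_le Vx frame_n'.
have := vertex_polar_le Vx (fr_U fr); rewrite !dotx !(dotC x); lra.
Qed.

Lemma orbit_le_v O : is_symmetry V O -> dot (n *m O) v <= 1.
Proof.
move=> sO; rewrite dot_mulmx; apply: vertex_polar_le (fr_U fr).
by apply: sym_mem (sym_tr sO) (fr_V fr).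
Qed.

Lemma orbit_le_e O : is_symmetry V O -> dot (n *m O) e <= 1.
Proof.
move=> sO; have := orbit_le_v sO.
have : dot (n *m O) (e - k) <= 1.
  rewrite dot_mulmx; apply: vertex_polar_le (fr_U fr).
  by apply: sym_mem (sym_tr sO) frame_v'.
rewrite !(dotDr, dotNr); lra.
Qed.

Lemma orbit_le_n O : is_symmetry V O -> dot (n *m O) n <= dot n n.
Proof.
move=> sO; have := dot_ge0 (n *m O - n); rewrite !dotBl !dotBr dot_orth ?sO.1 //.
by rewrite (dotC n); lra.
Qed.

Lemma dot_cone z (a b c : R) :
  dot z (a *: v + b *: e + c *: n) = a * dot z v + b * dot z e + c * dot z n.
Proof. by rewrite (dotDr z (_ + _) (_ *: _)) (dotDr z (_ *: _) (_ *: _)) !dotZr. Qed.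

Lemma dot_point z : dot z x0 = dot z v + dot z e + dot z n.
Proof.
by rewrite /chamber_point (dotDr z (_ + e) (e + m)) (dotDr z (e + k) e).
Qed.

(** An orthogonal map carrying the chamber point into the chamber keeps the
    maximizers [v] and [n] of the chamber functionals, and cannot be the
    reflection in the wall spanned by these. *)
Lemma chamber_trivial O : is_symmetry V O -> in_chamber (x0 *m O) -> O = 1%:M.
Proof.
move=> sO cO; have hO := sO.1; have [a [b [c [a0 b0 c0 xE]]]] := chamber_expand cO.
have sOt := sym_tr sO.
have ve : dot v e = 1 by rewrite !dotx ee ke addr0.
have ne : dot n e = 1 by rewrite !dotx ee me addr0.
have vn : dot v n = 1 by rewrite !dotx ee em ke km !addr0.
have nv : dot n v = 1 by rewrite dotC.
have back z : dot (z *m O) (x0 *m O) <= dot z (x0 *m O) ->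
    dot z x0 <= dot (z *m O^T) x0.
  by rewrite dot_orth // dot_mulmx trmxK.
have fix_of z : dot (z *m O^T) (z *m O^T) = dot z z ->
    dot z z <= dot (z *m O^T) z -> z *m O = z.
  move=> h1 h2; suff h : z *m O^T = z by rewrite -{1}h orth_mulmxVr.
  apply/eqP; rewrite -subr_eq0 -dot_eq0 eq_le dot_ge0 andbT !dotBl !dotBr h1.
  by rewrite (dotC z (z *m _)); lra.
have vO : v *m O = v.
  have Vz : V (v *m O) := sym_mem sO (fr_V fr).
  have Vz' : V (v *m O^T) := sym_mem sOt (fr_V fr).
  apply: fix_of; first by rewrite dot_orth // orth_tr.
  have : dot v x0 <= dot (v *m O^T) x0.
    apply: back; rewrite xE !dot_cone ve vn mulr1 mulr1.
    have h1 := vertex_le_self Vz; have h2 := vertex_le_e Vz.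
    have := vertex_polar_le Vz (fr_U fr); rewrite (dotC n) => h3.
    by rewrite !lerD ?ler_piMr // ler_wpM2l.
  have h2 := vertex_le_e Vz'.
  have := vertex_polar_le Vz' (fr_U fr); rewrite (dotC n) => h3.
  by rewrite !dot_point ve vn; lra.
have nO : n *m O = n.
  have h1 := orbit_le_v sO; have h2 := orbit_le_e sO; have h3 := orbit_le_n sO.
  have h4 := orbit_le_v sOt; have h5 := orbit_le_e sOt.
  apply: fix_of; first by rewrite dot_orth // orth_tr.
  have : dot n x0 <= dot (n *m O^T) x0.
    apply: back; rewrite xE !dot_cone ne nv !mulr1.
    by rewrite !lerD ?ler_piMr // ler_wpM2l.
  by rewrite !dot_point ne nv; lra.
apply/eqP/negPn/negP => O1.
have rO : acts_as_reflection O w.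
  apply: (orth_fix2 hO _ _ w0 _ vO nO).
  - by rewrite dotDr we wk subrr.
  - by rewrite dotDr we wm subrr.
  - move=> u uv un uw; have uk : dot u k = - dot u e by move: uv; rewrite dotDr; lra.
    have um : dot u m = - dot u e by move: un; rewrite dotDr; lra.
    have ue : dot u e = 0.
      have : dot u e * (1 + A + B) = 0.
        by move: uw; rewrite !dotBr !dotZr uk um; lra.
      by move/eqP; rewrite mulf_eq0 (gt_eqF (_ : 0 < 1 + A + B)) ?orbF ?addr_gt0 // => /eqP.
    by apply: (frame_kill ee ek em km k0 m0); rewrite ?uk ?um ?ue ?oppr0.
  - apply: contrapT => h; case/negP: O1; apply/eqP/row_matrixP => i.
    rewrite !rowE mulmx1; apply/eqP/negPn/negP => hi; apply: h.
    by exists (delta_mx 0 i).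
have [_ + _] := cO; rewrite leNgt => /negP; apply.
have x0w : 0 < dot x0 w by apply: wall_point wall2.
have ww : dot w w != 0 by rewrite dot_eq0.
by rewrite rO dotBl dotZl divfK // mulr_natl mulr2n opprD addrA subrr add0r oppr_lt0.
Qed.

(** Climbing from the image of the chamber point back to the chamber spells out
    a word in the three reflections that undoes the isometry. *)
Lemma mirror_group_full O : is_symmetry V O -> mirror_group O.
Proof.
move=> sO; have [g mg cg] : exists2 g, mirror_group g & in_chamber (x0 *m O *m g).
  apply: (@climb_ind x0 (fun y => exists2 g, mirror_group g & in_chamber (y *m g)))
    => // [ O' _ cO'|O' r u _ wr _ [g mg cg]].
    by exists 1%:M; [exact: generated_one|rewrite mulmx1].
  exists (r *m g); last by rewrite mulmxA.
  exact: generated_mul (mirror_wall wr) mg.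
have e1 : O *m g = 1%:M.
  apply: chamber_trivial; last by rewrite mulmxA.
  by apply: sym_mul => //; apply: sym_vertices; apply: mirror_sym.
by apply: (generated_inv mg) => //; apply: mulmx1C.
Qed.

Lemma sym_verticesP O : is_symmetry V O <-> is_symmetry P O.
Proof. by split=> [/mirror_group_full/mirror_sym|/sym_vertices]. Qed.

(** Dual circles are disjoint or tangent. A vector of the orbit of [n] other than
    [n] climbs towards [n] through the walls; the last step is across the third
    wall, the only one not containing [n], and comes from [e - m], for which
    equality holds: the two dual caps then touch at the midpoint [e]. *)
Lemma polar_dot_le u u' : vertices (polar P) u -> vertices (polar P) u' ->
  u != u' -> dot u u' <= 1 - dot m m.
Proof.
have nn O : is_symmetry V O -> n *m O != n -> dot (n *m O) n <= 1 - dot m m.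
  move: O; apply: (@climb_ind n (fun y => y != n -> dot y n <= 1 - dot m m)) => [ O sO cO|].
    case/negP; apply/eqP; have [a [b [c [a0 b0 c0 uE]]]] := chamber_expand cO.
    have nv : dot n v = 1 by rewrite !dotx ee ek me mk !addr0.
    have ne : dot n e = 1 by rewrite !dotx ee me addr0.
    have le : dot n n <= dot n (n *m O).
      rewrite -(dot_orth n n sO.1) [X in dot _ X]uE [X in _ <= dot _ X]uE !dot_cone.
      rewrite nv ne !mulr1 !lerD ?ler_piMr ?orbit_le_v ?orbit_le_e //.
      by rewrite ler_wpM2l // orbit_le_n.
    apply/eqP; rewrite -subr_eq0 -dot_eq0 eq_le dot_ge0 andbT !dotBl !dotBr.
    by rewrite dot_orth ?sO.1 // (dotC (n *m O)); lra.
  move=> O r u0 sO wr xu IH xn; have [nr|nr] := eqVneq (n *m O *m r) n.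
    have nE : n *m O = n *m r.
      by rewrite -{2}nr -mulmxA (reflection_inv (wall_neq0 wr) (wall_reflection wr)) mulmx1.
    move: xn xu nr IH; rewrite nE; case: wr; rewrite ?frame_nr1 ?frame_nr2 ?eqxx //.
    by rewrite frame_nr3 !dotx ee em me; lra.
  apply: le_trans (IH nr); apply: (wall_climb wr xu).
  case: wr; rewrite ?(dotC _ w) ?dotDr ?we ?wm ?subrr // !dotx ?ek ?mk ?em ?add0r //.
  exact: dot_ge0.
move=> /(fr_Utr fr)[ O sO <-] /(fr_Utr fr)[ O' sO' <-] ne.
have sOO : is_symmetry V (O *m O'^T).
  by apply/sym_vertices/sym_mul => //; apply: sym_tr.
rewrite -(trmxK O') -dot_mulmx -mulmxA; apply: nn => //.
apply: contra ne => /eqP h; rewrite -{2}h -!mulmxA.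
by rewrite (mulmx1C sO'.1) mulmx1.
Qed.

End Chamber.

(** * The light cone model of the extended plane *)

Section LightCone.
Variable R : realType.
Implicit Types (x y : 'rV[R]_4) (a b u : 'rV[R]_3) (s t c : R) (M N : 'M[R]_4).

Definition lor (a : 'rV[R]_3) (s : R) : 'rV[R]_4 := row_mx a (s%:M : 'rV_1).
Definition pt3 (y : 'rV[R]_2) (s : R) : 'rV[R]_3 := row_mx y (s%:M : 'rV_1).
Definition J4 : 'M[R]_4 := @block_mx R 3 1 3 1 1%:M 0 0 (-1)%:M.
Definition form x y : R := dot (x *m J4) y.

Lemma J4_tr : J4^T = J4.
Proof. by rewrite /J4 (@tr_block_mx _ 3 1 3 1) !trmx1 !trmx0 tr_scalar_mx. Qed.

Lemma J4_inv : J4 *m J4 = 1%:M.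
Proof.
rewrite /J4 (@mulmx_block _ 3 1 3 1 3 1) !mulmx0 !mul0mx !addr0 !add0r mul1mx.
by rewrite -scalar_mxM mulrNN mulr1 -(@scalar_mx_block _ 3 1).
Qed.

Lemma formC x y : form x y = form y x.
Proof. by rewrite /form dot_mulmx J4_tr dotC. Qed.

Lemma formDl x y (z : 'rV[R]_4) : form (x + y) z = form x z + form y z.
Proof. by rewrite /form mulmxDl dotDl. Qed.
Lemma formDr x y (z : 'rV[R]_4) : form z (x + y) = form z x + form z y.
Proof. by rewrite /form dotDr. Qed.
Lemma formZl c x y : form (c *: x) y = c * form x y.
Proof. by rewrite /form -scalemxAl dotZl. Qed.
Lemma formZr c x y : form x (c *: y) = c * form x y.
Proof. by rewrite /form dotZr. Qed.
Lemma formNl x y : form (- x) y = - form x y.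
Proof. by rewrite /form mulNmx dotNl. Qed.
Lemma formNr x y : form x (- y) = - form x y.
Proof. by rewrite /form dotNr. Qed.
Lemma form0l x : form 0 x = 0.
Proof. by rewrite /form mul0mx dot0l. Qed.
Lemma form0r x : form x 0 = 0.
Proof. by rewrite /form dot0r. Qed.

Definition formx := (formDl, formDr, formZl, formZr, formNl, formNr, form0l, form0r).

Lemma dot_pt3 (y z : 'rV[R]_2) s t : dot (pt3 y s) (pt3 z t) = dot y z + s * t.
Proof.
rewrite /dot /pt3 (@tr_row_mx _ _ 2 1) (@mul_row_col _ _ 2 1) mxE; congr (_ + _).
by rewrite tr_scalar_mx -scalar_mxM mxE eqxx mulr1n.
Qed.

Lemma form_lor a b s t : form (lor a s) (lor b t) = dot a b - s * t.
Proof.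
rewrite /form /lor /J4 (@mul_row_block _ _ 3 1 3 1) !mulmx0 addr0 add0r mulmx1.
rewrite /dot (@tr_row_mx _ _ 3 1) (@mul_row_col _ _ 3 1) mxE; congr (_ + _).
by rewrite -scalar_mxM tr_scalar_mx -scalar_mxM mxE eqxx mulr1n mulrN1 mulNr.
Qed.

Lemma dot_lor a b s t : dot (lor a s) (lor b t) = dot a b + s * t.
Proof.
rewrite /dot /lor (@tr_row_mx _ _ 3 1) (@mul_row_col _ _ 3 1) mxE; congr (_ + _).
by rewrite tr_scalar_mx -scalar_mxM mxE eqxx mulr1n.
Qed.

Lemma lor_surj x : exists a s, x = lor a s.
Proof.
exists (@lsubmx _ 1 3 1 x), (@rsubmx _ 1 3 1 x 0 0).
by rewrite /lor -mx11_scalar hsubmxK.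
Qed.

Lemma pt3_surj a : exists (y : 'rV[R]_2) s, a = pt3 y s.
Proof.
exists (@lsubmx _ 1 2 1 a), (@rsubmx _ 1 2 1 a 0 0).
by rewrite /pt3 -mx11_scalar hsubmxK.
Qed.

Lemma lorD a b s t : lor a s + lor b t = lor (a + b) (s + t).
Proof. by rewrite /lor (@add_row_mx _ 1 3 1) -(raddfD (@scalar_mx R 1)). Qed.

Lemma lorZ c a s : c *: lor a s = lor (c *: a) (c * s).
Proof. by rewrite /lor (@scale_row_mx _ 1 3 1) scale_scalar_mx. Qed.

Lemma lor0 : lor 0 0 = 0.
Proof. by rewrite -(scale0r (lor 0 0)) lorZ scaler0 mulr0. Qed.

Lemma lorN a s : - lor a s = lor (- a) (- s).
Proof. by rewrite -scaleN1r lorZ scaleN1r mulN1r. Qed.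

Lemma lor_inj a b s t : lor a s = lor b t -> a = b /\ s = t.
Proof.
move=> /(@eq_row_mx _ 1 3 1)[-> /(congr1 (fun M : 'M[R]_1 => M 0 0))].
by rewrite !mxE eqxx !mulr1n.
Qed.

Lemma pt3D (y z : 'rV[R]_2) s t : pt3 y s + pt3 z t = pt3 (y + z) (s + t).
Proof. by rewrite /pt3 (@add_row_mx _ 1 2 1) -(raddfD (@scalar_mx R 1)). Qed.

Lemma pt3Z c (y : 'rV[R]_2) s : c *: pt3 y s = pt3 (c *: y) (c * s).
Proof. by rewrite /pt3 (@scale_row_mx _ 1 2 1) scale_scalar_mx. Qed.

Lemma pt3N (y : 'rV[R]_2) s : - pt3 y s = pt3 (- y) (- s).
Proof. by rewrite -scaleN1r pt3Z scaleN1r mulN1r. Qed.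

Definition lorE := (lorZ, lorN, lorD, pt3Z, pt3N, pt3D).

(** A null vector on the ray of the light cone that stereographic projection
    sends to the given point. *)
Definition sig (z : extended_plane R) : 'rV[R]_4 :=
  if z is Some y then lor (pt3 (2 *: y) (dot y y - 1)) (dot y y + 1)
  else lor (pt3 0 1) 1.

Definition height x : R := - form x (lor 0 1).

Lemma height_lor a s : height (lor a s) = s.
Proof. by rewrite /height form_lor dot0r mulr1 sub0r opprK. Qed.

Lemma sig_null z : form (sig z) (sig z) = 0.
Proof.
case: z => [y|]; rewrite /sig form_lor dot_pt3 ?dot0l; last by ring.
by rewrite !dotx; ring.
Qed.

Lemma sig_height z : 0 < height (sig z).
Proof.
case: z => [y|]; rewrite /sig height_lor //.
by rewrite ltr_wpDl ?dot_ge0.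
Qed.

Lemma sig_form_lt0 z z' : z != z' -> form (sig z) (sig z') < 0.
Proof.
have NS (y : 'rV[R]_2) : form (sig None) (sig (Some y)) < 0.
  by rewrite /sig form_lor dot_pt3 dot0l; lra.
case: z z' => [y|] [y'|] // h; last by rewrite formC.
have : 0 < dot (y - y') (y - y').
  by rewrite dot_gt0 subr_eq0; apply: contra h => /eqP ->.
rewrite /sig form_lor dot_pt3 !dotx (dotC y' y).
by move: (dot y y) (dot y y') (dot y' y') => X Y Z; lra.
Qed.

Lemma sig_inj c z z' : sig z = c *: sig z' -> z = z'.
Proof.
move=> h; apply/eqP/negPn/negP => /sig_form_lt0.
by rewrite h formZl sig_null mulr0 ltxx.
Qed.

Lemma null_sig x : form x x = 0 -> 0 < height x ->
  exists z, exists2 c, 0 < c & x = c *: sig z.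
Proof.
have [a [s ->]] := lor_surj x; have [y [t ->]] := pt3_surj a.
rewrite form_lor dot_pt3 height_lor => h s0.
have [ts|ts] := eqVneq t s.
  have y0 : y = 0 by apply/eqP; rewrite -dot_eq0; move: h; rewrite ts; lra.
  exists None, s => //; rewrite /sig lorZ pt3Z y0 ts scaler0 mulr1.
  by [].
have st : 0 < s - t.
  rewrite subr_gt0 lt_neqAle ts /= leNgt; apply/negP => lt_st.
  have := dot_ge0 y; have : 0 < (t - s) * (t + s).
    by rewrite mulr_gt0 ?subr_gt0 // addr_gt0 // (lt_trans s0).
  by move: h; lra.
exists (Some ((s - t)^-1 *: y)), ((s - t) / 2); first by rewrite divr_gt0.
have yy : dot y y = (s - t) * (s + t) by move: h; lra.
have st0 : s - t != 0 by rewrite gt_eqF.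
rewrite /sig lorZ pt3Z !dotx yy !scalerA; congr (lor (pt3 _ _) _).
- by rewrite -[LHS]scale1r; congr (_ *: _); field.
- by field.
- by field.
Qed.

End LightCone.

(** * Lorentz transformations *)

Section Lorentz.
Variable R : realType.
Implicit Types (x y : 'rV[R]_4) (a b u : 'rV[R]_3) (s t c : R) (M N : 'M[R]_4).

Definition lorentz M := M *m J4 R *m M^T = J4 R.
(** Locked, lest rewriting by associativity see the product. *)
Definition linv M := locked (J4 R *m M^T *m J4 R).

Lemma lorentz_form M x y : lorentz M -> form (x *m M) (y *m M) = form x y.
Proof. by move=> h; rewrite /form dotC dot_mulmx -!mulmxA (mulmxA M) h dotC. Qed.

Lemma mx_act_inj n M (N : 'M[R]_n) (L : 'M[R]_n) :
  (forall x : 'rV_n, x *m N = x *m L) -> N = L.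
Proof. by move=> h; apply/row_matrixP => i; rewrite !rowE h. Qed.

Lemma lorentzP M : (forall x y, form (x *m M) (y *m M) = form x y) -> lorentz M.
Proof.
move=> h; apply: (mx_act_inj M) => x; apply: dot_inj => y.
by rewrite -[RHS]/(form x y) -(h x y) /form [RHS]dotC [RHS]dot_mulmx [RHS]dotC !mulmxA.
Qed.

Lemma lorentz1 : lorentz 1%:M.
Proof. by rewrite /lorentz mul1mx trmx1 mulmx1. Qed.

Lemma lorentz_mul M N : lorentz M -> lorentz N -> lorentz (M *m N).
Proof.
by move=> hM hN; apply: lorentzP => x y; rewrite !mulmxA !lorentz_form.
Qed.

Lemma mulmx_linv M : lorentz M -> M *m linv M = 1%:M.
Proof. by move=> h; rewrite /linv -lock !mulmxA h J4_inv. Qed.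

Lemma linv_mulmx M : lorentz M -> linv M *m M = 1%:M.
Proof. by move=> h; apply: mulmx1C; apply: mulmx_linv. Qed.

Lemma lorentz_linv M : lorentz M -> lorentz (linv M).
Proof.
move=> h; apply: lorentzP => x y; rewrite -(lorentz_form (x *m _) (y *m _) h).
by rewrite -(mulmxA x) -(mulmxA y) linv_mulmx // !mulmx1.
Qed.

Lemma form_linv M x y : lorentz M -> form (x *m linv M) y = form x (y *m M).
Proof.
move=> h; rewrite -(lorentz_form (x *m linv M) y h).
by rewrite -(mulmxA x) linv_mulmx // mulmx1.
Qed.

Definition lrefl x : 'M[R]_4 := 1%:M - (2 / form x x) *: (J4 R *m x^T *m x).

Lemma lrefl_act x y : y *m lrefl x = y - (2 * form y x / form x x) *: x.
Proof.
rewrite /lrefl mulmxBr mulmx1 -scalemxAr !mulmxA [y *m J4 R *m x^T]mx11_scalar.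
by rewrite mul_scalar_mx scalerA -/(form y x) mulrAC.
Qed.

Lemma lrefl_inv x : form x x != 0 -> lrefl x *m lrefl x = 1%:M.
Proof.
move=> x0; apply: (mx_act_inj 1%:M) => y; rewrite mulmxA !lrefl_act !formx mulmx1.
have -> : 2 * (form y x - 2 * form y x / form x x * form x x) / form x x =
          - (2 * form y x / form x x) by field.
by rewrite scaleNr opprK subrK.
Qed.

Lemma lorentz_lrefl x : form x x != 0 -> lorentz (lrefl x).
Proof.
move=> x0; apply: lorentzP => y z; rewrite !lrefl_act !formx (formC x z).
by field.
Qed.

Lemma lreflZ c x : c != 0 -> lrefl (c *: x) = lrefl x.
Proof.
move=> c0; apply: (mx_act_inj 1%:M) => y; rewrite !lrefl_act !formx scalerA.
congr (_ - _ *: _); have [->|x0] := eqVneq (form x x) 0.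
  by rewrite !mulr0 !invr0 !mulr0 mul0r.
by field; rewrite x0.
Qed.

Lemma lrefl_conj M x : lorentz M -> linv M *m lrefl x *m M = lrefl (x *m M).
Proof.
move=> h; apply: (mx_act_inj 1%:M) => y; rewrite (mulmxA y) (mulmxA y) !lrefl_act mulmxBl.
by rewrite -(mulmxA y) linv_mulmx // mulmx1 -scalemxAl form_linv // lorentz_form.
Qed.

Lemma cauchy_schwarz n (a b : 'rV[R]_n) : dot a b ^+ 2 <= dot a a * dot b b.
Proof.
have [->|b0] := eqVneq b 0; first by rewrite !dot0r expr0n mulr0.
have bb : 0 < dot b b by rewrite dot_gt0.
have := dot_ge0 (dot b b *: a - dot a b *: b).
have -> : dot (dot b b *: a - dot a b *: b) (dot b b *: a - dot a b *: b) =
    dot b b * (dot a a * dot b b - dot a b ^+ 2).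
  by rewrite !dotx (dotC b a); ring.
by rewrite pmulr_rge0 // subr_ge0.
Qed.

(** Signature (3,1): by Cauchy-Schwarz in the spatial part, two orthogonal
    vectors cannot both lie in the closed light cone unless they are
    proportional and null. *)
Lemma timelike_orth x y : form x x < 0 -> form x y = 0 -> y != 0 -> 0 < form y y.
Proof.
have [a [s ->]] := lor_surj x; have [b [t ->]] := lor_surj y.
rewrite !form_lor => xx /eqP; rewrite subr_eq0 => /eqP xy y0.
have := cauchy_schwarz a b; rewrite xy => cs.
have [t0|t0] := eqVneq t 0.
  rewrite t0 mulr0 subr0 dot_gt0; apply: contra y0 => /eqP ->; rewrite t0.
  by rewrite lor0.
rewrite subr_gt0 ltNge; apply/negP => le_b.
have t2 : 0 < t ^+ 2 by rewrite exprn_even_gt0.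
have : dot a a * dot b b <= dot a a * t ^+ 2 by rewrite ler_wpM2l ?dot_ge0 // expr2.
have : dot a a * t ^+ 2 < s * s * t ^+ 2 by rewrite ltr_pM2r // -subr_lt0.
by move: cs; rewrite exprMn !expr2; lra.
Qed.

(** * Oriented circles as spacelike vectors *)

Definition cap x : set (extended_plane R) := [set z | 0 <= form (sig z) x].

Lemma cap_sides x : 0 < form x x ->
  (exists z, form (sig z) x < 0) /\ (exists z, 0 < form (sig z) x).
Proof.
have [a [s ->]] := lor_surj x; rewrite form_lor => xx.
pose r := Num.sqrt (dot a a).
have rr : r ^+ 2 = dot a a by rewrite sqr_sqrtr ?dot_ge0.
have aa : 0 < dot a a by move: xx; have := sqr_ge0 s; rewrite expr2; lra.
have r0 : 0 < r by rewrite sqrtr_gt0.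
have rs : s < r /\ - s < r.
  have : `|s| < r.
    by rewrite -(ltr_pXn2r (n := 2)) ?nnegrE ?(ltW r0) // rr real_normK ?num_real //
      expr2 -subr_gt0.
  by rewrite ltr_norml => /andP[]; lra.
have side (d : 'rV[R]_3) : dot d d = dot a a -> exists z, exists2 c, 0 < c &
    lor d r = c *: sig z.
  move=> dd; apply: null_sig; last by rewrite height_lor.
  by rewrite form_lor dd -rr expr2 subrr.
split.
- have [|z [c c0 e]] := side (- a); first by rewrite dotNl dotNr opprK.
  exists z; rewrite -(pmulr_rlt0 _ c0) -formZl -e form_lor dotNl -rr expr2.
  by rewrite -opprD -mulrDr oppr_lt0 pmulr_rgt0 //; move: rs => [] _; lra.
- have [|z [c c0 e]] := side a; first by [].
  exists z; rewrite -(pmulr_rgt0 _ c0) -formZl -e form_lor -rr expr2 -mulrBr.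
  by rewrite pmulr_rgt0 // subr_gt0; case: rs.
Qed.

(** A null vector orthogonal to [x] can be pushed, staying on the light cone,
    to the negative side of [x], along the parabola spanned by a spacelike and
    a null direction. *)
Lemma cap_boundary x y z : 0 < form x x -> cap x = cap y ->
  form (sig z) x = 0 -> form (sig z) y <= 0.
Proof.
move=> xx /seteqP[cxy cyx] zx; rewrite leNgt; apply/negP => zy.
have [[z' z'x] _] := cap_sides xx.
have neg_y c v : 0 < c -> form v v = 0 -> 0 < height v -> form v x < 0 -> form v y < 0.
  move=> _ vv v0 vx; have [t [d d0 e]] := null_sig vv v0.
  move: vx; rewrite e !formZl !pmulr_rlt0 // ltNge => tx.
  by rewrite ltNge; apply: contra tx => ty; apply: (cyx t).
have zz' : form (sig z) (sig z') < 0.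
  by apply: sig_form_lt0; apply/eqP => e; move: z'x; rewrite -e zx ltxx.
set K := form (sig z) (sig z') in zz'.
have [w w0 [wz wz']] := @ex_orth2 R 1 (sig z *m J4 R) (sig z' *m J4 R).
have {}wz : form (sig z) w = 0 by rewrite /form dotC.
have {}wz' : form (sig z') w = 0 by rewrite /form dotC.
have ww : 0 < form w w.
  apply: (@timelike_orth (sig z + sig z')) => //; last by rewrite formDl wz wz' addr0.
  rewrite !formx !sig_null (formC (sig z')) -/K; lra.
wlog wx : w w0 wz wz' ww / form w x <= 0.
  move=> th; have [|lt_wx] := leP (form w x) 0; first exact: (th w).
  apply: (th (- w)); rewrite ?oppr_eq0 ?formNr ?formNl ?wz ?wz' ?oppr0 ?opprK //.
  by rewrite oppr_le0 ltW.
pose c := form w w / (- 2 * K).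
have c0 : 0 < c by rewrite divr_gt0 // mulNr oppr_gt0 pmulr_rlt0.
pose l := [:: (form (sig z) y, `|form w y| + c * `|form (sig z') y|);
              (height (sig z), `|height w|); (1, 1)].
have [|e e0 he] := @small_eps R l.
  move=> ab; rewrite !inE => /or3P[] /eqP -> //=; exact: sig_height.
have := he _ (mem_head _ _); have := he (height (sig z), `|height w|).
have := he (1, 1); rewrite !inE !eqxx !orbT => /(_ isT)/= e1 /(_ isT)/= eh ey.
pose v := sig z + e *: w + (c * e ^+ 2) *: sig z'.
have e2 : 0 < e ^+ 2 by rewrite exprn_gt0.
have ee : e ^+ 2 <= e by rewrite expr2 ler_piMl ?(ltW e0) //; move: e1; lra.
have vv : form v v = 0.
  rewrite /v !formx !sig_null (formC (sig z')) -/K (formC w (sig z)) (formC w (sig z')).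
  rewrite wz wz' /c; have K0 : K != 0 by rewrite lt_eqF.
  by field.
have vh : 0 < height v.
  rewrite /height /v !formDl !formZl !opprD -![- (_ * _)]mulrN -!/(height _).
  have hz' : 0 < height (sig z') by exact: sig_height.
  have : 0 <= c * e ^+ 2 * height (sig z') by rewrite ltW // mulr_gt0 // mulr_gt0.
  have : - (e * height w) <= e * `|height w|.
    by rewrite -mulrN ler_pM2l // -normrN ler_norm.
  by move: eh; lra.
have vx : form v x < 0.
  rewrite /v !formDl !formZl zx add0r.
  have : e * form w x <= 0 by rewrite pmulr_rle0.
  have : c * e ^+ 2 * form (sig z') x < 0 by rewrite pmulr_rlt0 // mulr_gt0.
  lra.
have := neg_y e v e0 vv vh vx; rewrite /v !formDl !formZl.
have : - (e * form w y) <= e * `|form w y|.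
  by rewrite -mulrN ler_pM2l // -normrN ler_norm.
have : - (c * e ^+ 2 * form (sig z') y) <= c * e * `|form (sig z') y|.
  have ce : 0 < c * e ^+ 2 by rewrite mulr_gt0.
  rewrite -mulrN; apply: (@le_trans _ _ (c * e ^+ 2 * `|form (sig z') y|)).
    by rewrite (ler_pM2l ce) -normrN ler_norm.
  by rewrite ler_wpM2r // (ler_pM2l c0).
move: ey; rewrite mulrDr; lra.
Qed.

Lemma cap_boundary0 x y z : 0 < form x x -> cap x = cap y ->
  form z z = 0 -> form z x = 0 -> form z y = 0.
Proof.
move=> xx cxy; have pos v : form v v = 0 -> 0 < height v -> form v x = 0 -> form v y = 0.
  move=> vv vh vx; have [t [c c0 e]] := null_sig vv vh; rewrite e formZl.
  have tx : form (sig t) x = 0.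
    by move/eqP: vx; rewrite e formZl mulf_eq0 gt_eqF //= => /eqP.
  apply/eqP; rewrite mulf_eq0 gt_eqF //= eq_le (cap_boundary xx cxy tx) /=.
  have xt : cap x t by rewrite /cap /= tx.
  by rewrite cxy in xt.
move=> zz zx; have [hz|hz|hz] := ltrgtP (height z) 0.
- apply/eqP; rewrite -oppr_eq0 -formNl; apply/eqP; apply: pos.
  + by rewrite formNl formNr opprK.
  + by rewrite /height formNl opprK; move: hz; rewrite /height; lra.
  + by rewrite formNl zx oppr0.
- exact: pos.
- have [a [s ze]] := lor_surj z; move: hz zz; rewrite ze height_lor form_lor => ->.
  rewrite mulr0 subr0 => /eqP; rewrite dot_eq0 => /eqP ->.
  by rewrite lor0 form0l.
Qed.

(** The component of [y] orthogonal to [x] vanishes, because it is orthogonal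
    to every null vector of the complement of [x], and these span it. *)
Lemma cap_inj x y : 0 < form x x -> 0 < form y y -> cap x = cap y ->
  exists2 c, 0 < c & y = c *: x.
Proof.
move=> xx yy cxy; pose k := form y x / form x x.
have x0 : form x x != 0 by rewrite gt_eqF.
have [y2 y2E] : exists y2, y2 = y - k *: x by eexists.
have y2x : form y2 x = 0 by rewrite y2E !formx /k divfK // subrr.
have null v : form v v = 0 -> form v x = 0 -> form v y = 0.
  exact: cap_boundary0.
have yE : y = k *: x + y2 by rewrite y2E addrC subrK.
have [a [s xE]] := lor_surj x.
have [t tE] : exists t : 'rV[R]_4, t = lor 0 1 - (form (lor 0 1) x / form x x) *: x by eexists.
have tx : form t x = 0 by rewrite tE !formx divfK // subrr.
have tt : form t t < 0.
  rewrite {1}tE formDl formNl formZl (formC x t) tx mulr0 subr0 (formC _ t).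
  rewrite tE !formx (formC x (lor 0 1)) form_lor dot0l.
  rewrite -mulrA (mulrC _^-1) mulrA -expr2.
  have : 0 <= form (lor 0 1) x ^+ 2 / form x x by rewrite divr_ge0 ?sqr_ge0 ?ltW.
  by lra.
(* on the plane of [t] and a spacelike [w] the two null directions span *)
have plane w : form w x = 0 -> form t w = 0 -> 0 < form w w ->
    form t y = 0 /\ form w y = 0.
  move=> wx tw ww; have [r r0 rr] : exists2 r, 0 < r & r ^+ 2 * form w w = - form t t.
    exists (Num.sqrt (- form t t / form w w)).
      by rewrite sqrtr_gt0 divr_gt0 // oppr_gt0.
    by rewrite sqr_sqrtr ?divfK ?gt_eqF // divr_ge0 ?ltW // oppr_gt0.
  have nul (q : R) : q ^+ 2 = r ^+ 2 -> form (t + q *: w) y = 0.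
    move=> qr; apply: null; rewrite !formx ?(formC w t) ?tw ?tx ?wx.
      by move: rr; rewrite -qr; lra.
    by rewrite mulr0 addr0.
  have := nul r erefl; have := nul (- r) (sqrrN r); rewrite !formx => h1 h2.
  have ty : form t y = 0 by lra.
  split=> //; apply/eqP; move: h2; rewrite ty add0r => /eqP.
  by rewrite mulf_eq0 gt_eqF.
have ty : form t y = 0.
  have [d d0 [da _]] := @ex_orth2 R 0 a 0.
  apply: (proj1 (plane (lor d 0) _ _ _)).
  - by rewrite xE form_lor da mul0r subr0.
  - by rewrite tE xE !formx !form_lor dot0l (dotC a) da !mulr0 !subr0 !mulr0 subr0.
  - by rewrite form_lor mulr0 subr0 dot_gt0.
have y20 : y2 = 0.
  apply/eqP/negPn/negP => y20.
  have ty2 : form t y2 = 0 by rewrite y2E !formx ty tx mulr0 subr0.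
  have y2y2 := timelike_orth tt ty2 y20.
  have [_] := plane y2 y2x ty2 y2y2.
  by rewrite yE formDr formZr y2x mulr0 add0r => h; move: y2y2; rewrite h ltxx.
exists k; last by rewrite yE y20 addr0.
have [_ [z zx]] := cap_sides xx.
have zx' : cap x z by rewrite /cap /= ltW.
have k0 : k != 0 by apply: contraTneq yy => k0; rewrite yE y20 k0 scale0r addr0 form0l ltxx.
rewrite lt_neqAle eq_sym k0 /= -(pmulr_rge0 _ zx) mulrC -formZr.
by move: zx'; rewrite cxy yE y20 addr0.
Qed.

End Lorentz.

(** * Moebius transformations as Lorentz matrices *)

Section Represents.
Variable R : realType.
Local Notation ext := (extended_plane R).
Implicit Types (f g : ext -> ext) (M N : 'M[R]_4) (x : 'rV[R]_4) (z : ext).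

Definition represents f M := lorentz M /\
  forall z, exists2 c, 0 < c & sig z *m M = c *: sig (f z).

Lemma rep_id : represents id 1%:M.
Proof.
split; first exact: lorentz1.
by move=> z; exists 1; rewrite ?mulmx1 ?scale1r.
Qed.

(** Matrices act on rows from the right, which reverses composition. *)
Lemma rep_comp f g M N : represents f M -> represents g N ->
  represents (f \o g) (N *m M).
Proof.
move=> [hM fM] [hN gN]; split; first exact: lorentz_mul.
move=> z; have [c c0 e] := gN z; have [d d0 e'] := fM (g z).
exists (c * d); first exact: mulr_gt0.
by rewrite mulmxA e -scalemxAl e' scalerA.
Qed.

Lemma rep_fun f g M : represents f M -> represents g M -> f = g.
Proof.
move=> [_ fM] [_ gM]; apply/funext => z.
have [c c0 e] := fM z; have [d d0 e'] := gM z.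
apply: (@sig_inj R (c^-1 * d)).
by rewrite -scalerA -e' e scalerA mulVf ?scale1r // gt_eqF.
Qed.

Lemma rep_inverse f g M : represents f M -> f \o g = id ->
  represents g (linv M).
Proof.
move=> [hM fM] fg; split; first exact: lorentz_linv.
move=> z; have [c c0 e] := fM (g z).
have fgz : f (g z) = z by rewrite -[RHS]/(id z) -fg.
exists c^-1; first by rewrite invr_gt0.
rewrite -{1}fgz -[sig (f _)]scale1r -(mulVf (lt0r_neq0 c0)) -scalerA -e.
by rewrite -scalemxAl -mulmxA mulmx_linv // mulmx1.
Qed.

(** Two antipodal points of the sphere add up to a vector on the time axis, and
    subtracting the latter leaves all the spatial directions. *)
Lemma null_span (D : 'M[R]_4) : (forall z, sig z *m D = 0) -> D = 0.
Proof.
move=> h; have unit_null (u : 'rV[R]_3) : dot u u = 1 -> lor u 1 *m D = 0.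
  move=> uu; have [||z [c c0 ->]] := @null_sig R (lor u 1).
  - by rewrite form_lor uu mulr1 subrr.
  - by rewrite height_lor.
  - by rewrite -scalemxAl h scaler0.
have uu (i : 'I_3) : dot (delta_mx 0 i : 'rV[R]_3) (delta_mx 0 i) = 1.
  by rewrite /dot -rowE !mxE !eqxx.
have time : lor 0 1 *m D = 0.
  have -> : lor 0 1 = 2^-1 *: (lor (delta_mx 0 0) 1 + lor (- delta_mx 0 0) 1) :> 'rV[R]_4.
    by rewrite lorD lorZ subrr scaler0; congr lor; field.
  rewrite -scalemxAl mulmxDl !unit_null ?addr0 ?scaler0 // dotNl dotNr opprK.
  by [].
have space (i : 'I_3) : lor (delta_mx 0 i) 0 *m D = 0.
  have -> : lor (delta_mx 0 i) 0 = lor (delta_mx 0 i) 1 - lor 0 1 :> 'rV[R]_4.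
    by rewrite lorN lorD oppr0 addr0 subrr.
  by rewrite mulmxBl unit_null // time subr0.
apply: (mx_act_inj 0 (L := 0)) => x; rewrite mulmx0.
have [a [s ->]] := lor_surj x.
have -> : lor a s = lor a 0 + s *: lor 0 1 by rewrite lorZ lorD scaler0 addr0 mulr1 add0r.
rewrite mulmxDl -scalemxAl time scaler0 addr0 (row_sum_delta a).
have lor_space (b b' : 'rV[R]_3) : lor (b + b') 0 = lor b 0 + lor b' 0.
  by rewrite lorD addr0.
have lor_spaceZ t (b : 'rV[R]_3) : lor (t *: b) 0 = t *: lor b 0.
  by rewrite lorZ mulr0.
have lin (r : seq 'I_3) : lor (\sum_(j <- r) a 0 j *: delta_mx 0 j) 0 *m D = 0.
  elim: r => [|j r IH]; first by rewrite big_nil lor0 mul0mx.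
  by rewrite big_cons lor_space mulmxDl IH addr0 lor_spaceZ -scalemxAl space scaler0.
exact: lin.
Qed.

Lemma rep_mx f M N : represents f M -> represents f N -> M = N.
Proof.
move=> [hM fM] [hN fN].
have nu z : exists2 c, 0 < c & sig z *m M = c *: (sig z *m N).
  have [c c0 e] := fM z; have [d d0 e'] := fN z.
  exists (c / d); first by rewrite divr_gt0.
  by rewrite e e' scalerA divfK // gt_eqF.
have nu1 z z' c d : z != z' -> sig z *m M = c *: (sig z *m N) ->
    sig z' *m M = d *: (sig z' *m N) -> c * d = 1.
  move=> zz' e e'; have := lorentz_form (sig z) (sig z') hM.
  rewrite e e' !formx lorentz_form // mulrA => h.
  apply: (mulIf (ltr0_neq0 (sig_form_lt0 zz'))).
  by rewrite mul1r.
apply/eqP; rewrite -subr_eq0; apply/eqP/null_span => z; rewrite mulmxBr.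
have [z' [z'' [zz' zz'' z'z'']]] : exists z' z'', [/\ z != z', z != z'' & z' != z''].
  have d0 (y : 'rV[R]_2) : y != y + const_mx 1.
    rewrite -subr_eq0 opprD addrA subrr add0r oppr_eq0.
    by apply/eqP => /matrixP/(_ 0 0); rewrite !mxE => /eqP; rewrite oner_eq0.
  case: z => [y|].
    by exists None, (Some (y + const_mx 1)); split=> //; apply: contra (d0 y) => /eqP[<-].
  by exists (Some 0), (Some (0 + const_mx 1)); split=> //; apply: contra (d0 0) => /eqP[<-].
have [a a0 ea] := nu z; have [b b0 eb] := nu z'; have [c c0 ec] := nu z''.
have ab := nu1 _ _ _ _ zz' ea eb; have ac := nu1 _ _ _ _ zz'' ea ec.
have bc := nu1 _ _ _ _ z'z'' eb ec.
have cb : c = b by apply: (mulfI (lt0r_neq0 a0)); rewrite ac ab.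
have b1 : b = 1.
  have /eqP : (b - 1) * (b + 1) = 0 by move: bc; rewrite cb; lra.
  by rewrite mulf_eq0 subr_eq0 addr_eq0 => /orP[/eqP //|/eqP b_1]; move: b0; rewrite b_1; lra.
by rewrite ea; move: ab; rewrite b1 mulr1 => ->; rewrite scale1r subrr.
Qed.

Lemma cap_image f g M x : represents f M -> f \o g = id -> g \o f = id ->
  f @` cap x = cap (x *m M).
Proof.
move=> rf fg gf; have [hM _] := rf; have [_ gM] := rep_inverse rf fg.
apply/seteqP; split=> [_ [z zx <-]|z]; rewrite /cap /=.
  have [c c0 e] := rf.2 z; move: zx; rewrite /cap /= -(lorentz_form _ _ hM) e formZl.
  by rewrite pmulr_rge0.
rewrite -form_linv //; have [c c0 ->] := gM z; rewrite formZl pmulr_rge0 // => zx.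
by exists (g z) => //; rewrite -[LHS]/((f \o g) z) fg.
Qed.

Lemma capZ c x : 0 < c -> cap (c *: x) = cap x.
Proof.
by move=> c0; apply/seteqP; split=> z; rewrite /cap /= formZr pmulr_rge0.
Qed.

(** * Inversions are Lorentz reflections *)

Definition circ_vec (c : 'rV[R]_2) (r : R) : 'rV[R]_4 :=
  lor (pt3 c ((dot c c - r ^+ 2 - 1) / 2)) ((dot c c - r ^+ 2 + 1) / 2).

Definition line_vec (n : 'rV[R]_2) (k : R) : 'rV[R]_4 := lor (pt3 n k) k.

Lemma form_circ_vec c r : form (circ_vec c r) (circ_vec c r) = r ^+ 2.
Proof. by rewrite /circ_vec form_lor dot_pt3; field. Qed.

Lemma form_line_vec n k : form (line_vec n k) (line_vec n k) = dot n n.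
Proof. by rewrite /line_vec form_lor dot_pt3 addrK. Qed.

Lemma sig_circ_vec y c r :
  form (sig (Some y)) (circ_vec c r) = r ^+ 2 - dot (y - c) (y - c).
Proof.
by rewrite /sig /circ_vec form_lor dot_pt3 !dotx (dotC c y); field.
Qed.

Lemma sig_None_circ_vec c r : form (sig None) (circ_vec c r) = - 1.
Proof. by rewrite /sig /circ_vec form_lor dot_pt3 dot0l; field. Qed.

Lemma sig_line_vec y n k : form (sig (Some y)) (line_vec n k) = 2 * (dot n y - k).
Proof. by rewrite /sig /line_vec form_lor dot_pt3 !dotx (dotC y n); ring. Qed.

Lemma sig_None_line_vec n k : form (sig None) (line_vec n k) = 0.
Proof. by rewrite /sig /line_vec form_lor dot_pt3 dot0l; ring. Qed.

Lemma rep_circle c r : 0 < r ->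
  represents (circle_inversion c r) (lrefl (circ_vec c r)).
Proof.
move=> r0; have r2 : 0 < r ^+ 2 by rewrite exprn_gt0.
have r2n : r ^+ 2 != 0 by rewrite gt_eqF.
have rn : r != 0 by rewrite gt_eqF.
split; first by apply: lorentz_lrefl; rewrite form_circ_vec.
move=> [y|]; rewrite lrefl_act form_circ_vec; last first.
  exists (r ^+ 2)^-1; first by rewrite invr_gt0.
  rewrite sig_None_circ_vec /sig /circ_vec !lorE.
  congr (lor (pt3 _ _) _).
  - by apply: dot_inj => u; rewrite !dotx; field.
  - by field.
  - by field.
rewrite sig_circ_vec /circle_inversion; have [->|yc] := eqVneq y c.
  exists (r ^+ 2) => //.
  rewrite subrr dot0l subr0 mulfK // /sig /circ_vec !lorE.
  congr (lor (pt3 _ _) _).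
  - by rewrite subrr scaler0.
  - by field.
  - by field.
have D0 : 0 < dot (y - c) (y - c) by rewrite dot_gt0 subr_eq0.
exists (dot (y - c) (y - c) / r ^+ 2); first by rewrite divr_gt0.
have yy : dot y y = dot (y - c) (y - c) + 2 * dot y c - dot c c.
  by rewrite !dotx (dotC c y); ring.
have y'y' t : dot (c + t *: (y - c)) (c + t *: (y - c)) =
    dot c c + 2 * t * (dot y c - dot c c) + t ^+ 2 * dot (y - c) (y - c).
  by rewrite !dotx (dotC c y); ring.
rewrite /sig y'y' yy /circ_vec !lorE.
move: (dot (y - c) (y - c)) (gt_eqF D0) => D /negbT Dn.
congr (lor (pt3 _ _) _).
- by apply: dot_inj => u; rewrite !dotx; field; rewrite ?rn ?Dn.
- by field; rewrite ?rn ?Dn.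
- by field; rewrite ?rn ?Dn.
Qed.

Lemma rep_line n k : n != 0 -> represents (line_reflection n k) (lrefl (line_vec n k)).
Proof.
move=> n0; have nn : dot n n != 0 by rewrite dot_eq0.
split; first by apply: lorentz_lrefl; rewrite form_line_vec.
move=> [y|]; exists 1 => //; rewrite lrefl_act form_line_vec scale1r; last first.
  by rewrite sig_None_line_vec mulr0 mul0r scale0r subr0.
rewrite sig_line_vec /line_reflection /sig /line_vec.
have y'y' t : dot (y - t *: n) (y - t *: n) = dot y y - 2 * t * dot n y + t ^+ 2 * dot n n.
  by rewrite !dotx (dotC y n); ring.
rewrite y'y' !lorE.
congr (lor (pt3 _ _) _).
- by apply: dot_inj => u; rewrite !dotx; field.
- by field.
- by field.
Qed.

Lemma disk_cap c r : disk c r = cap (circ_vec c r).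
Proof.
apply/seteqP; split=> -[y|]; rewrite /disk /cap /=.
- by rewrite -/(sig (Some y)) sig_circ_vec subr_ge0.
- by [].
- by rewrite -/(sig (Some y)) sig_circ_vec subr_ge0.
- by rewrite -/(sig None) sig_None_circ_vec; lra.
Qed.

Lemma disk_exterior_cap c r : disk_exterior c r = cap (- circ_vec c r).
Proof.
apply/seteqP; split=> -[y|]; rewrite /disk_exterior /cap /= formNr oppr_ge0.
- by rewrite -/(sig (Some y)) sig_circ_vec subr_le0.
- by rewrite -/(sig None) sig_None_circ_vec; lra.
- by rewrite -/(sig (Some y)) sig_circ_vec subr_le0.
- by [].
Qed.

Lemma half_plane_cap n k : half_plane n k = cap (line_vec n k).
Proof.
apply/seteqP; split=> -[y|]; rewrite /half_plane /cap /=.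
- by rewrite -/(sig (Some y)) sig_line_vec pmulr_rge0 // subr_ge0.
- by rewrite -/(sig None) sig_None_line_vec.
- by rewrite -/(sig (Some y)) sig_line_vec pmulr_rge0 // subr_ge0.
- by [].
Qed.

(** A spacelike vector is, up to a positive factor, that of a disk, of the
    exterior of a disk or of a half-plane, according to the sign of its product
    with the null vector of the point at infinity. *)
Lemma spacelike_circle x : 0 < form x x -> exists2 t, 0 < t &
  [\/ exists c r, 0 < r /\ x = t *: circ_vec c r,
      exists c r, 0 < r /\ x = t *: - circ_vec c r |
      exists n k, n != 0 /\ x = t *: line_vec n k].
Proof.
have [a [s ->]] := lor_surj x; have [b [u ->]] := pt3_surj a.
rewrite form_lor dot_pt3 => xx.
have circle (h : R) : h = s - u -> h != 0 ->
    exists c r, 0 < r /\ lor (pt3 b u) s = h *: circ_vec c r.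
  move=> hE h0; have h2 : 0 < h ^+ 2 by rewrite exprn_even_gt0.
  exists (h^-1 *: b), (Num.sqrt ((dot b b + u * u - s * s) / h ^+ 2)).
  split; first by rewrite sqrtr_gt0 divr_gt0.
  rewrite /circ_vec sqr_sqrtr ?divr_ge0 ?ltW // lorZ pt3Z !dotx.
  congr (lor (pt3 _ _) _).
  - by rewrite scalerA mulfV ?scale1r.
  - by have -> : s = h + u by [rewrite hE subrK]; field.
  - by have -> : u = s - h by [rewrite hE subKr]; field.
have [su|su|su] := ltrgtP s u.
- exists (u - s); first by rewrite subr_gt0.
  have [|c [r [r0 e]]] := circle (s - u) erefl; first by rewrite subr_eq0 lt_eqF.
  by apply: Or32; exists c, r; split=> //; rewrite e scalerN -scaleNr opprB.
- exists (s - u); first by rewrite subr_gt0.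
  by apply: Or31; apply: circle; rewrite // subr_eq0 gt_eqF.
- exists 1 => //; apply: Or33; exists b, s; split; last by rewrite scale1r /line_vec su.
  by rewrite -dot_gt0; move: xx; rewrite su addrK.
Qed.

Lemma inversion_throughP D f : is_inversion_through D f <->
  exists x, [/\ 0 < form x x, D = cap x & represents f (lrefl x)].
Proof.
split=> [[[c [r [r0 hD ->]]]|[n [k [n0 -> ->]]]]|[x [xx -> rf]]].
- have r2 : 0 < r ^+ 2 by rewrite exprn_gt0.
  have rc := rep_circle c r0.
  case: hD => ->; [exists (circ_vec c r)|exists (- circ_vec c r)]; split.
  + by rewrite form_circ_vec.
  + exact: disk_cap.
  + exact: rc.
  + by rewrite formNl formNr opprK form_circ_vec.
  + exact: disk_exterior_cap.
  + by rewrite -scaleN1r lreflZ // oppr_eq0 oner_eq0.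
- exists (line_vec n k); split; [by rewrite form_line_vec dot_gt0|exact: half_plane_cap|].
  exact: rep_line.
have [t t0 []] := spacelike_circle xx; move=> [c [r [r0 xE]]]; move: rf; rewrite xE.
- rewrite lreflZ ?gt_eqF // capZ // => rf; left; exists c, r; split=> //.
    by left; rewrite disk_cap.
  exact: rep_fun rf (rep_circle c r0).
- rewrite lreflZ ?gt_eqF // capZ // -scaleN1r lreflZ ?oppr_eq0 ?oner_eq0 // scaleN1r.
  move=> rf; left; exists c, r; split=> //; first by right; rewrite disk_exterior_cap.
  exact: rep_fun rf (rep_circle c r0).
- rewrite lreflZ ?gt_eqF // capZ // => rf; right; exists c, r; split=> //.
    by rewrite half_plane_cap.
  exact: rep_fun rf (rep_line r r0).
Qed.

Lemma ex_inversion x : 0 < form x x ->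
  exists2 f, moebius f & is_inversion_through (cap x) f /\ represents f (lrefl x).
Proof.
move=> xx; have [f [rf mf]] : exists f, represents f (lrefl x) /\ moebius f.
  have [t t0 []] := spacelike_circle xx; move=> [c [r [r0 ->]]].
  - exists (circle_inversion c r); rewrite lreflZ ?gt_eqF //.
    split; first exact: rep_circle.
    by apply: generated_base; left; exists c, r.
  - exists (circle_inversion c r); rewrite lreflZ ?gt_eqF // -scaleN1r lreflZ ?oppr_eq0 ?oner_eq0 //.
    split; first exact: rep_circle.
    by apply: generated_base; left; exists c, r.
  - exists (line_reflection c r); rewrite lreflZ ?gt_eqF //.
    split; first exact: rep_line.
    by apply: generated_base; right; exists c, r.
by exists f => //; split=> //; apply/inversion_throughP; exists x.
Qed.

Lemma rep_lrefl_invol f x : 0 < form x x -> represents f (lrefl x) -> f \o f = id.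
Proof.
move=> xx rf; apply: (rep_fun (M := 1%:M)); last exact: rep_id.
by rewrite -(lrefl_inv (lt0r_neq0 xx)); apply: rep_comp.
Qed.

Lemma moebius_rep f : moebius f -> exists g M,
  [/\ represents f M, f \o g = id, g \o f = id & moebius g].
Proof.
have base h y : 0 < form y y -> represents h (lrefl y) -> moebius h -> exists g M,
    [/\ represents h M, h \o g = id, g \o h = id & moebius g].
  by move=> yy rh mh; exists h, (lrefl y); split=> //; apply: rep_lrefl_invol yy rh.
elim=> [|h []|h h' _ [g [M [rM hg gh mg]]] _ [g' [M' [rM' hg' gh' mg']]]
    |h h' mh [g [M [rM hg gh mg]]] hh' h'h].
- by exists id, 1%:M; split=> //; [exact: rep_id|exact: generated_one].
- move=> [c [r [r0 ->]]]; apply: (base _ (circ_vec c r)).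
  + by rewrite form_circ_vec exprn_gt0.
  + exact: rep_circle.
  + by apply: generated_base; left; exists c, r.
- move=> [n [k [n0 ->]]]; apply: (base _ (line_vec n k)).
  + by rewrite form_line_vec dot_gt0.
  + exact: rep_line.
  + by apply: generated_base; right; exists n, k.
- exists (g' \o g), (M' *m M); split; [exact: rep_comp| | |exact: generated_mul].
  + by apply/funext => z /=; have /(congr1 (@^~ (g z))) /= -> := hg';
      have /(congr1 (@^~ z)) /= -> := hg.
  + by apply/funext => z /=; have /(congr1 (@^~ (h' z))) /= -> := gh;
      have /(congr1 (@^~ z)) /= -> := gh'.
- exists h, (linv M); split=> //; exact: rep_inverse rM hh'.
Qed.

End Represents.

(** * The group generated by the mirrors and the dual inversions *)

Section LorentzGroup.
Variables (R : realType) (p q : nat) (P : set 'rV[R]_3) (e k m : 'rV[R]_3)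
  (r1 r2 r3 : 'M[R]_3).
Hypothesis fr : frame p q P e k m r1 r2 r3.
Implicit Types (x y : 'rV[R]_4) (a u : 'rV[R]_3) (O : 'M[R]_3) (K M : 'M[R]_4).
Local Notation U := (vertices (polar P)).
Local Notation o := (lor 0 1 : 'rV[R]_4).
Local Notation n := (e + m).
Local Notation w := (e - (dot k k)^-1 *: k - (dot m m)^-1 *: m).

Definition isom4 O : 'M[R]_4 := @block_mx R 3 1 3 1 O 0 0 1%:M.

Lemma isom4_act a s O : lor a s *m isom4 O = lor (a *m O) s.
Proof.
rewrite /lor /isom4 (@mul_row_block _ _ 3 1 3 1) !mulmx0 addr0 add0r.
by rewrite mulmx1.
Qed.

Lemma isom4_mul O O' : isom4 (O *m O') = isom4 O *m isom4 O'.
Proof.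
apply: (mx_act_inj 1%:M) => x; have [a [s ->]] := lor_surj x.
by rewrite mulmxA !isom4_act mulmxA.
Qed.

Lemma isom4_1 : isom4 1%:M = 1%:M.
Proof.
apply: (mx_act_inj 1%:M) => x; have [a [s ->]] := lor_surj x.
by rewrite isom4_act !mulmx1.
Qed.

Lemma isom4_lorentz O : O *m O^T = 1%:M -> lorentz (isom4 O).
Proof.
move=> hO; apply: lorentzP => x y.
have [a [s ->]] := lor_surj x; have [b [t ->]] := lor_surj y.
by rewrite !isom4_act !form_lor dot_orth.
Qed.

Lemma isom4_trK O : O *m O^T = 1%:M -> isom4 O *m isom4 O^T = 1%:M.
Proof. by move=> hO; rewrite -isom4_mul hO isom4_1. Qed.

Lemma isom4_trKr O : O *m O^T = 1%:M -> isom4 O^T *m isom4 O = 1%:M.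
Proof. by move=> hO; apply: mulmx1C; apply: isom4_trK. Qed.

Lemma isom4_linv O : O *m O^T = 1%:M -> linv (isom4 O) = isom4 O^T.
Proof.
move=> hO; rewrite -[LHS]mulmx1 -(isom4_trK hO) mulmxA.
by rewrite linv_mulmx ?mul1mx //; apply: isom4_lorentz.
Qed.

Lemma isom4_reflection O u : acts_as_reflection O u -> isom4 O = lrefl (lor u 0).
Proof.
move=> h; apply: (mx_act_inj 1%:M) => x; have [a [s ->]] := lor_surj x.
rewrite isom4_act h lrefl_act !form_lor !mulr0 !subr0 lorZ lorN lorD.
by rewrite mulr0 oppr0 addr0.
Qed.

Lemma form_dual u : U u -> form (lor u 1) (lor u 1) = dot m m.
Proof. by move=> Uu; rewrite form_lor (polar_norm fr Uu); ring. Qed.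

Let mm : 0 < dot m m. Proof. by rewrite dot_gt0 (fr_m0 fr). Qed.

Lemma form_dual_gt0 u : U u -> 0 < form (lor u 1) (lor u 1).
Proof. by move=> Uu; rewrite form_dual. Qed.

Lemma form_dual_neq0 u : U u -> form (lor u 1) (lor u 1) != 0.
Proof. by move=> Uu; rewrite gt_eqF // form_dual_gt0. Qed.

Definition dual_group := generated mulmx 1%:M [set lrefl (lor u 1) | u in U].

Lemma dual_group_conj O K : is_symmetry P O -> dual_group K ->
  dual_group (isom4 O^T *m K *m isom4 O).
Proof.
move=> sO; have hO := sO.1; elim=> [|_ [u Uu <-]|K1 K2 _ h1 _ h2|K1 K2 _ h1 e1 e2].
- by rewrite mulmx1 isom4_trKr //; exact: generated_one.
- rewrite -isom4_linv // lrefl_conj; last exact: isom4_lorentz.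
  rewrite isom4_act; apply: generated_base; exists (u *m O) => //.
  by apply: sym_vertex => //; apply: sym_polar.
- have -> : isom4 O^T *m (K1 *m K2) *m isom4 O =
      (isom4 O^T *m K1 *m isom4 O) *m (isom4 O^T *m K2 *m isom4 O).
    by rewrite -!mulmxA (mulmxA (isom4 O) (isom4 O^T)) isom4_trK // mul1mx.
  exact: generated_mul.
- have cancel (A B : 'M[R]_4) : A *m B = 1%:M ->
      (isom4 O^T *m A *m isom4 O) *m (isom4 O^T *m B *m isom4 O) = 1%:M.
    move=> AB; rewrite -!mulmxA (mulmxA (isom4 O) (isom4 O^T)) isom4_trK // mul1mx.
    by rewrite (mulmxA A) AB mul1mx isom4_trKr.
  by apply: (generated_inv h1); apply: cancel.
Qed.

(** * Reduced words *)

Definition wprod (us : seq 'rV[R]_3) : 'M[R]_4 :=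
  foldr (fun u K => lrefl (lor u 1) *m K) 1%:M us.

Definition distinct_rel (u u' : 'rV[R]_3) := u != u'.

Definition reduced (us : seq 'rV[R]_3) :=
  (forall u, u \in us -> U u) /\ sorted distinct_rel us.

Lemma reduced_cons u us : U u -> reduced us ->
  exists2 vs, reduced vs & lrefl (lor u 1) *m wprod us = wprod vs.
Proof.
move=> Uu; case: us => [|u' us] [hU hs].
  by exists [:: u] => //; split=> // x; rewrite inE => /eqP ->.
have [uu'|uu'] := eqVneq u u'.
  exists us; last by rewrite /= uu' mulmxA -uu' lrefl_inv ?mul1mx // form_dual_neq0.
  by split; [move=> x xu; apply: hU; rewrite inE xu orbT|exact: path_sorted hs].
exists [:: u, u' & us] => //; split; last by rewrite /= [distinct_rel _ _]uu'.
by move=> x; rewrite inE => /orP[/eqP ->|/hU].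
Qed.

Lemma reduced_cat us vs : (forall u, u \in us -> U u) -> reduced vs ->
  exists2 ws, reduced ws & wprod us *m wprod vs = wprod ws.
Proof.
elim: us => [|u us IH] hU hv; first by exists vs; rewrite //= mul1mx.
have [|ws hws e1] := IH _ hv; first by move=> x xu; apply: hU; rewrite inE xu orbT.
have [ws' hws' e2] := reduced_cons (hU u (mem_head _ _)) hws.
by exists ws' => //; rewrite /= -mulmxA e1.
Qed.

Lemma reduced_inv us : (forall u, u \in us -> U u) ->
  exists2 ws, reduced ws & wprod us *m wprod ws = 1%:M.
Proof.
elim: us => [|u us IH] hU; first by exists [::]; rewrite //= mulmx1.
have [|ws hws e1] := IH; first by move=> x xu; apply: hU; rewrite inE xu orbT.
have Uu := hU u (mem_head _ _).
have [ws' hws' e2] : exists2 ws', reduced ws' & wprod ws *m wprod [:: u] = wprod ws'.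
  by apply: reduced_cat; [exact: hws.1|split=> // x; rewrite inE => /eqP ->].
exists ws' => //; rewrite -e2 /= mulmx1 -mulmxA (mulmxA (wprod us)) e1 mul1mx.
by rewrite lrefl_inv // form_dual_neq0.
Qed.

Lemma dual_group_word K : dual_group K -> exists2 us, reduced us & K = wprod us.
Proof.
elim=> [|_ [u Uu <-]|K1 K2 _ [us hus ->] _ [vs hvs ->]|K1 K2 _ [us hus ->] e1 e2].
- by exists [::].
- by exists [:: u]; rewrite /= ?mulmx1 //; split=> // x; rewrite inE => /eqP ->.
- by have [ws hws e1] := reduced_cat hus.1 hvs; exists ws.
- have [ws hws e3] := reduced_inv hus.1; exists ws => //.
  by rewrite -[LHS]mulmx1 -e3 mulmxA e2 mul1mx.
Qed.

(** * Ping-pong *)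

(** Where a point is after the last reflection, in [lor u 1]: beyond the mirror
    of [u], and at least as far on the near side of every other mirror. This is
    preserved by the next reflection because distinct dual circles are disjoint
    or tangent. *)
Definition beyond x u := 1 <= form x (lor u 1) /\
  forall u', U u' -> u != u' -> form x (lor u 1) + form x (lor u' 1) <= 0.

Lemma dual_disjoint u u' : U u -> U u' -> u != u' ->
  form (lor u 1) (lor u' 1) <= - dot m m.
Proof. by move=> Uu Uu' /(polar_dot_le fr Uu Uu'); rewrite form_lor; lra. Qed.

Lemma reflect_others x u u' : U u -> U u' -> u != u' -> form x (lor u 1) <= -1 ->
  form (x *m lrefl (lor u 1)) (lor u 1) = - form x (lor u 1) /\
  form (x *m lrefl (lor u 1)) (lor u' 1) <= form x (lor u' 1) + 2 * form x (lor u 1).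
Proof.
move=> Uu Uu' uu' xu; rewrite lrefl_act !formx form_dual //.
have mm0 : dot m m != 0 by rewrite gt_eqF.
split; first by field.
have := dual_disjoint Uu Uu' uu'; set f := form (lor u 1) _ => hf.
rewrite lerD2l.
have c0 : 0 <= - (2 * form x (lor u 1) / dot m m).
  by rewrite -mulNr divr_ge0 ?ltW //; lra.
have := ler_wpM2l c0 hf.
have -> : - (2 * form x (lor u 1) / dot m m) * - dot m m = 2 * form x (lor u 1).
  by field.
by rewrite mulNr.
Qed.

Lemma beyond_step x u u' : U u -> U u' -> u != u' -> beyond x u ->
  beyond (x *m lrefl (lor u' 1)) u'.
Proof.
move=> Uu Uu' uu' [xu hx].
have xu' : form x (lor u' 1) <= -1 by have := hx _ Uu' uu'; lra.
split=> [|u'' Uu'' u'u''].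
  by have [|-> _] := reflect_others Uu' Uu _ xu'; [rewrite eq_sym|lra].
have [-> h] := reflect_others Uu' Uu'' u'u'' xu'.
have [u_u''|uu''] := eqVneq u u''.
  by have := hx _ Uu' uu'; move: h; rewrite -u_u''; lra.
by have := hx _ Uu'' uu''; move: h; lra.
Qed.

Lemma pingpong us x u : U u -> (forall u', u' \in us -> U u') ->
  path distinct_rel u us -> beyond x u -> beyond (x *m wprod us) (last u us).
Proof.
elim: us x u => [|u' us IH] x u Uu hU /=; first by rewrite mulmx1.
move=> /andP[uu' pu'] bx; rewrite mulmxA.
have Uu' : U u' by apply: hU; rewrite mem_head.
apply: IH => //; last exact: beyond_step bx.
by move=> y yus; apply: hU; rewrite inE yus orbT.
Qed.

(** The centre of the ball is on the near side of all the mirrors, so ping-pong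
    can start with the first letter of a nonempty reduced word. *)
Lemma dual_group_moves K : dual_group K ->
  K = 1%:M \/ exists2 u, U u & 1 <= form (o *m K) (lor u 1).
Proof.
move=> /dual_group_word[[|u us] [hU hs] ->]; first by left.
right; have Uu := hU u (mem_head _ _).
have ou u' : form o (lor u' 1) = - 1 by rewrite form_lor dot0l; ring.
have b1 : beyond (o *m lrefl (lor u 1)) u.
  split=> [|u' Uu' uu'].
    have [u'' Uu'' uu''] : exists2 u'', U u'' & u != u''.
      have [uE|une] := eqVneq u n; last by exists n => //; exact: fr_U fr.
      exists (e - m); first exact: frame_n' fr.
      rewrite uE; apply/eqP => /addrI /eqP; rewrite -subr_eq0 opprK -mulr2n.
      by rewrite -scaler_nat scaler_eq0 pnatr_eq0 (negPf (fr_m0 fr)).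
    by have [|-> _] := @reflect_others o u u'' Uu Uu'' uu''; rewrite ou //; lra.
  have [|-> h] := @reflect_others o u u' Uu Uu' uu'; rewrite ?ou //.
  by move: h; rewrite !ou; lra.
exists (last u us); first by apply: hU; exact: mem_last.
have hU' u' : u' \in us -> U u' by move=> hu'; apply: hU; rewrite inE hu' orbT.
by have [] := pingpong Uu hU' hs b1; rewrite -mulmxA.
Qed.

(** * The full group in Lorentz coordinates *)

Definition gens4 : set 'M[R]_4 :=
  [set lrefl (lor k 0); lrefl (lor w 0); lrefl (lor m 0); lrefl (lor n 1)].

Definition full_group := generated mulmx 1%:M gens4.

Lemma isom4_full O : is_symmetry P O -> full_group (isom4 O).
Proof.
move=> /sym_vertices /(mirror_group_full fr).
elim=> [|_ [[->|->]|->]|O1 O2 _ h1 _ h2|O1 O2 _ h1 e1 e2].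
- by rewrite isom4_1; exact: generated_one.
- by rewrite (isom4_reflection (fr_r1 fr)); apply: generated_base; do 3!left.
- by rewrite (isom4_reflection (fr_r2 fr)); apply: generated_base; do 2!left; right.
- by rewrite (isom4_reflection (fr_r3 fr)); apply: generated_base; left; right.
- by rewrite isom4_mul; exact: generated_mul.
- by apply: (generated_inv h1); rewrite -isom4_mul ?e1 ?e2 isom4_1.
Qed.

Lemma dual_full K : dual_group K -> full_group K.
Proof.
elim=> [|_ [u Uu <-]|K1 K2 _ h1 _ h2|K1 K2 _ h1 e1 e2].
- exact: generated_one.
- have [ O sO <-] := fr_Utr fr Uu; have hO := sO.1.
  rewrite -isom4_act -lrefl_conj ?isom4_linv //; last exact: isom4_lorentz.
  apply: generated_mul; last exact: isom4_full.
  apply: generated_mul; first by apply: isom4_full; apply: sym_tr.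
  by apply: generated_base; right.
- exact: generated_mul.
- exact: generated_inv h1 e1 e2.
Qed.

(** The mirror group normalises the dual group, so that the full group is the
    product of the two. *)
Lemma full_groupP M : full_group M <->
  exists O K, [/\ is_symmetry P O, dual_group K & M = isom4 O *m K].
Proof.
split=> [|[ O [K [sO dK ->]]]]; last first.
  by apply: generated_mul; [exact: isom4_full|exact: dual_full].
have s1 : is_symmetry P 1%:M by apply: symI => [|x|x]; rewrite ?trmx1 mulmx1.
elim=> [|_ [[[->|->]|->]|->]|M1 M2 _ [ O1 [K1 [sO1 dK1 ->]]] _ [ O2 [K2 [sO2 dK2 ->]]]
    |M1 M2 _ [ O [K [sO dK ->]]] e1 e2].
- by exists 1%:M, 1%:M; split=> //; [exact: generated_one|rewrite isom4_1 mulmx1].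
- exists r1, 1%:M; split; [exact: fr_s1 fr|exact: generated_one|].
  by rewrite mulmx1 (isom4_reflection (fr_r1 fr)).
- exists r2, 1%:M; split; [exact: fr_s2 fr|exact: generated_one|].
  by rewrite mulmx1 (isom4_reflection (fr_r2 fr)).
- exists r3, 1%:M; split; [exact: fr_s3 fr|exact: generated_one|].
  by rewrite mulmx1 (isom4_reflection (fr_r3 fr)).
- exists 1%:M, (lrefl (lor n 1)); split=> //; last by rewrite isom4_1 mul1mx.
  by apply: generated_base; exists n => //; exact: fr_U fr.
- exists (O1 *m O2), (isom4 O2^T *m K1 *m isom4 O2 *m K2); split.
  + exact: sym_mul.
  + by apply: generated_mul => //; apply: dual_group_conj.
  + rewrite isom4_mul -!mulmxA (mulmxA (isom4 O2) (isom4 O2^T)).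
    by rewrite isom4_trK ?sO2.1 // mul1mx.
have hO := sO.1; have [K' dK' KK'] : exists2 K', dual_group K' & K *m K' = 1%:M.
  have [us hus KE] := dual_group_word dK; have [ws hws e3] := reduced_inv hus.1.
  exists (wprod ws); last by rewrite KE.
  by apply: (generated_inv dK); rewrite KE // mulmx1C.
exists O^T, (isom4 O *m K' *m isom4 O^T); split.
- exact: sym_tr.
- by have := dual_group_conj (sym_tr sO) dK'; rewrite trmxK.
- rewrite -[LHS]mulmx1 -[X in _ *m X](isom4_trK hO) -[X in M2 *m (X *m _)]mulmx1.
  rewrite -[X in M2 *m (_ *m X *m _)]KK' !mulmxA -(mulmxA M2) e2 mul1mx.
  by rewrite isom4_trKr // mul1mx.
Qed.

Lemma full_group_lorentz M : full_group M -> lorentz M.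
Proof.
elim=> [|_ [[[->|->]|->]|->]|M1 M2 _ h1 _ h2|M1 M2 _ h1 e1 e2].
- exact: lorentz1.
- by apply: lorentz_lrefl; rewrite form_lor mulr0 subr0 dot_eq0 (fr_k0 fr).
- apply: lorentz_lrefl; rewrite form_lor mulr0 subr0 dot_eq0.
  exact: wall_neq0 fr _ _ (wall2 _ _ _ _ _ _).
- by apply: lorentz_lrefl; rewrite form_lor mulr0 subr0 dot_eq0 (fr_m0 fr).
- by apply: lorentz_lrefl; apply: form_dual_neq0; exact: fr_U fr.
- exact: lorentz_mul.
- by rewrite -[M2]mul1mx -(linv_mulmx h1) -mulmxA e1 mulmx1; apply: lorentz_linv.
Qed.

(** Discreteness at the identity. Unless the factor in the dual group is
    trivial, ping-pong moves the centre of the ball by a definite amount; and the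
    other factor moves the chamber point within a finite set. *)
Lemma full_group_discrete : exists d : R, 0 < d /\ forall M, full_group M ->
  dot (o *m M - o) (o *m M - o) < d ->
  dot (lor (chamber_point e k m) 0 *m M - lor (chamber_point e k m) 0)
      (lor (chamber_point e k m) 0 *m M - lor (chamber_point e k m) 0) < d ->
  M = 1%:M.
Proof.
set x0 := chamber_point e k m.
have [X hX] := finite_orbit fr x0.
have [d0 d00 hd0] : exists2 d, 0 < d & forall a, a \in X -> a != x0 ->
    d < dot (a - x0) (a - x0).
  have [|d d0 hd] := @small_eps R [seq (dot (a - x0) (a - x0), 1) | a <- X & a != x0].
    by move=> ab /mapP[a]; rewrite mem_filter => /andP[ax _] ->; rewrite dot_gt0 subr_eq0.
  exists d => // a aX ax0; have /= := hd (dot (a - x0) (a - x0), 1).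
  rewrite mulr1; apply; apply/mapP; exists a => //.
  by rewrite mem_filter ax0.
have m2 : 0 < 2 + dot m m by rewrite addr_gt0.
exists (Num.min d0 (4 / (2 + dot m m))); split.
  by rewrite lt_min d00 divr_gt0.
move=> M /full_groupP[ O [K [sO dK ->]]]; rewrite !lt_min => /andP[_ ho] /andP[hx _].
rewrite mulmxA isom4_act mul0mx in ho.
have K1 : K = 1%:M.
  have [//|[u Uu ou]] := dual_group_moves dK; exfalso.
  have f0 : form o (lor u 1) = - 1 by rewrite form_lor dot0l; ring.
  have := cauchy_schwarz ((o *m K - o) *m J4 R) (lor u 1).
  rewrite -/(form (o *m K - o) (lor u 1)) dot_orth ?J4_tr ?J4_inv //.
  have -> : dot (lor u 1) (lor u 1) = 2 + dot m m.
    by rewrite dot_lor (polar_norm fr Uu); ring.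
  rewrite formDl formNl f0 => cs.
  have h2 : 2 <= form (o *m K) (lor u 1) - -1 by lra.
  have h4 : 4 <= (form (o *m K) (lor u 1) - -1) ^+ 2.
    by rewrite (_ : 4 = 2 ^+ 2) ?ler_pXn2r ?nnegrE //; lra.
  by move: ho; rewrite ltr_pdivlMr // ltNge (le_trans h4 cs).
rewrite K1 mulmx1 isom4_act lorN lorD dot_lor oppr0 addr0 mulr0 addr0 in hx *.
suff -> : O = 1%:M by rewrite isom4_1.
apply: (chamber_trivial fr); first exact: sym_vertices.
have -> : x0 *m O = x0.
  apply/eqP/negPn/negP => ne; have := hd0 _ (hX _ (sym_vertices sO)) ne.
  by rewrite ltNge ltW.
by apply: (@wallP R e k m r1 r2 r3) => r u wr; rewrite ltW // (wall_point fr wr).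
Qed.

End LorentzGroup.

(** * Stereographic circles as caps *)

Section Stereo.
Variable R : realType.

Lemma pt3_last (y : 'rV[R]_2) t : pt3 y t 0 ord_max = t.
Proof.
have -> : ord_max = rshift 2 (0 : 'I_1) :> 'I_(2 + 1) by apply: val_inj.
by rewrite /pt3 (@row_mxEr _ 1 2 1) mxE eqxx mulr1n.
Qed.

Lemma pt3_init (y : 'rV[R]_2) t j : pt3 y t 0 (widen_ord (leqnSn 2) j) = y 0 j.
Proof.
have -> : widen_ord (leqnSn 2) j = lshift 1 j :> 'I_(2 + 1) by apply: val_inj.
by rewrite /pt3 (@row_mxEl _ 1 2 1).
Qed.

Lemma stereo_sig (u : 'rV[R]_3) : dot u u = 1 ->
  exists2 c, 0 < c & lor u 1 = c *: sig (stereo u).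
Proof.
move=> uu; have [||z [c c0 e]] := @null_sig R (lor u 1).
- by rewrite form_lor uu mulr1 subrr.
- by rewrite height_lor.
suff -> : stereo u = z by exists c.
move: e; case: z => [y|]; rewrite /sig lorZ pt3Z => /lor_inj[uE c1]; rewrite /stereo uE pt3_last.
  have -> : c * (dot y y - 1) = 1 - 2 * c.
    by transitivity (c * (dot y y + 1) - 2 * c); [ring|rewrite -c1].
  rewrite ifF; last by apply/eqP => h; move: c0; lra.
  congr Some; apply/rowP => j; rewrite mxE pt3_init !mxE opprB addrC subrK.
  by move: (y 0 j) => t; field; rewrite gt_eqF.
by rewrite -c1 eqxx.
Qed.

Lemma stereo_circle_cap (v : 'rV[R]_3) : stereo_circle v = cap (lor v 1).
Proof.
apply/seteqP; split=> [_ [u [uu uv] <-]|z].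
  have [c c0 e] := stereo_sig uu.
  by rewrite /cap /= -(pmulr_rge0 _ c0) -formZl -e form_lor mulr1 subr_ge0.
rewrite /cap /=; have := sig_height z; have := sig_null z; have [a [t e]] := lor_surj (sig z).
rewrite e height_lor !form_lor mulr1 => aa t0 av.
have t0' : t != 0 by rewrite gt_eqF.
have aa' : dot a a = t * t by move/eqP: aa; rewrite subr_eq0 => /eqP.
have uu : dot (t^-1 *: a) (t^-1 *: a) = 1 by rewrite !dotx aa'; field.
exists (t^-1 *: a).
  by split=> //; rewrite dotZl mulrC ler_pdivlMr // mul1r -subr_ge0.
have [c c0 e'] := stereo_sig uu; apply: (@sig_inj R (c^-1 * t^-1)).
by rewrite e -scalerA lorZ mulVf // e' scalerA mulVf ?scale1r // gt_eqF.
Qed.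

End Stereo.

(** * The groups of an arrangement in Lorentz coordinates *)

Section FunctionGroups.
Variables (R : realType) (p q : nat) (P : set 'rV[R]_3) (e k m : 'rV[R]_3)
  (r1 r2 r3 : 'M[R]_3).
Hypothesis fr : frame p q P e k m r1 r2 r3.
Local Notation ext := (extended_plane R).
Local Notation U := (vertices (polar P)).
Local Notation V := (vertices P).
Local Notation o := (lor 0 1 : 'rV[R]_4).
Variables (mu nu : ext -> ext) (T : 'M[R]_4).
Hypotheses (rT : represents mu T) (mn : mu \o nu = id) (nm : nu \o mu = id).
Implicit Types (f g h : ext -> ext) (K M : 'M[R]_4) (O : 'M[R]_3).
Local Notation inv_gr := (inversion_group (arrangement mu (polar P))).
Local Notation sym_gr := (symmetry_group (arrangement mu P)).

Let hT : lorentz T. Proof. by case: rT. Qed.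

(** Coordinates are taken before applying [mu]. *)
Definition conjT K := linv T *m K *m T.

Lemma conjT1 : conjT 1%:M = 1%:M.
Proof. by rewrite /conjT mulmx1 linv_mulmx. Qed.

Lemma conjT_mul K M : conjT (K *m M) = conjT K *m conjT M.
Proof.
by rewrite /conjT -!mulmxA (mulmxA T (linv T)) mulmx_linv // mul1mx.
Qed.

Lemma conjT_inj K M : conjT K = conjT M -> K = M.
Proof.
move=> /(congr1 (fun X => T *m X *m linv T)); rewrite /conjT.
have h X : T *m (linv T *m X *m T) *m linv T = X.
  by rewrite !mulmxA mulmx_linv // mul1mx -mulmxA mulmx_linv // mulmx1.
by rewrite !h.
Qed.

Lemma conjT_lrefl x : conjT (lrefl x) = lrefl (x *m T).
Proof. exact: lrefl_conj. Qed.

Lemma act_conjT (x : 'rV[R]_4) K : x *m T *m conjT K = x *m K *m T.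
Proof. by rewrite /conjT !mulmxA -(mulmxA x) mulmx_linv // mulmx1. Qed.

Lemma mu_circle v : mu @` stereo_circle v = cap (lor v 1 *m T).
Proof. by rewrite stereo_circle_cap; exact: cap_image rT mn nm. Qed.

Lemma arrangementP Q D : arrangement mu Q D <->
  exists2 v, vertices Q v & D = cap (lor v 1 *m T).
Proof.
by split=> [[v Qv <-]|[v Qv ->]]; exists v => //; rewrite mu_circle.
Qed.

(** By [cap_inj] a dual circle leaves no choice for the inversion through it. *)
Lemma dual_inversionP f :
  (exists2 D, arrangement mu (polar P) D & is_inversion_through D f) <->
  exists2 u, U u & represents f (conjT (lrefl (lor u 1))).
Proof.
split=> [[D /arrangementP[u Uu ->] /inversion_throughP[x [xx cx rf]]]|[u Uu rf]].
  exists u => //; have uu := form_dual_gt0 fr Uu.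
  have [|c c0 xE] := cap_inj _ xx cx; first by rewrite lorentz_form.
  by rewrite conjT_lrefl -(lreflZ _ (lt0r_neq0 c0)) -xE.
exists (cap (lor u 1 *m T)); first by apply/arrangementP; exists u.
apply/inversion_throughP; exists (lor u 1 *m T); split=> //.
  by rewrite lorentz_form // (form_dual_gt0 fr).
by rewrite -conjT_lrefl.
Qed.

Lemma rep_lrefl_moebius x f : 0 < form x x -> represents f (lrefl x) -> moebius f.
Proof.
by move=> xx rf; have [g mg [_ rg]] := ex_inversion xx; rewrite (rep_fun rf rg).
Qed.

Lemma inv_gr_rep f : inv_gr f ->
  moebius f /\ exists2 K, dual_group P K & represents f (conjT K).
Proof.
elim=> [|g /dual_inversionP[u Uu rg]|g h _ [mg [K dK rg]] _ [mh [K' dK' rh]]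
    |g h _ [mg [K dK rg]] gh hg].
- split; first exact: generated_one.
  by exists 1%:M; [exact: generated_one|rewrite conjT1; exact: rep_id].
- split; last by exists (lrefl (lor u 1)) => //; apply: generated_base; exists u.
  move: rg; rewrite conjT_lrefl; apply: rep_lrefl_moebius.
  by rewrite lorentz_form // (form_dual_gt0 fr).
- split; first exact: generated_mul.
  exists (K' *m K); first exact: generated_mul.
  by rewrite conjT_mul; apply: rep_comp.
- split; first exact: generated_inv mg gh hg.
  have [us hus KE] := dual_group_word fr dK; have [ws hws e3] := reduced_inv fr hus.1.
  exists (wprod ws).
    by apply: (generated_inv dK); rewrite KE // mulmx1C.
  have -> : conjT (wprod ws) = linv (conjT K).
    have hK : lorentz (conjT K) by case: rg.
    rewrite -[LHS]mul1mx -(linv_mulmx hK) -mulmxA -conjT_mul KE e3 conjT1 mulmx1.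
    by [].
  exact: rep_inverse rg gh.
Qed.

Lemma dual_group_inv_gr K : dual_group P K ->
  exists2 f, inv_gr f & represents f (conjT K).
Proof.
elim=> [|_ [u Uu <-]|K1 K2 _ [f1 h1 rf1] _ [f2 h2 rf2]|K1 K2 _ [f hf rf] e1 e2].
- by exists id; [exact: generated_one|rewrite conjT1; exact: rep_id].
- have [|f mf [_ rf]] := @ex_inversion R (lor u 1 *m T).
    by rewrite lorentz_form // (form_dual_gt0 fr).
  exists f; last by rewrite conjT_lrefl.
  apply: generated_base; apply/dual_inversionP; exists u => //.
  by rewrite conjT_lrefl.
- exists (f2 \o f1); first exact: generated_mul.
  by rewrite conjT_mul; apply: rep_comp.
- have [mf _] := inv_gr_rep hf.
  have [g [M [rM fg gf _]]] := moebius_rep mf.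
  exists g; first exact: generated_inv hf fg gf.
  have -> : conjT K2 = linv (conjT K1).
    have hK : lorentz (conjT K1) by case: rf.
    by rewrite -[LHS]mul1mx -(linv_mulmx hK) -mulmxA -conjT_mul e1 conjT1 mulmx1.
  exact: rep_inverse rf fg.
Qed.

Let kk : 0 < dot k k. Proof. by rewrite dot_gt0 (fr_k0 fr). Qed.

Lemma form_vertex v : V v -> form (lor v 1) (lor v 1) = dot k k.
Proof. by move=> Vv; rewrite form_lor (vertex_norm fr Vv); ring. Qed.

(** A Lorentz matrix permuting the vectors of the vertex circles fixes their
    sum, which is a multiple of the centre of the ball; so it is an isometry. *)
Lemma permute_isom4 K : lorentz K ->
  (forall v, V v -> exists2 w, V w & lor v 1 *m K = lor w 1) ->
  (forall w, V w -> exists2 v, V v & lor v 1 *m K = lor w 1) ->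
  exists2 O, is_symmetry P O & K = isom4 O.
Proof.
move=> hK to from; have [Vs [uVs hVs sum0]] := fr_fin fr.
have KK (a b : 'rV[R]_4) : a *m K = b *m K -> a = b.
  by move=> /(congr1 (mulmx^~ (linv K))); rewrite -!mulmxA mulmx_linv // !mulmx1.
have sumE (l : seq 'rV[R]_3) : \sum_(v <- l) lor v 1 = lor (\sum_(v <- l) v) (size l)%:R.
  elim: l => [|v l IH]; first by rewrite !big_nil lor0.
  by rewrite !big_cons IH lorD /= -natr1 addrC [X in lor _ X]addrC.
have oK : o *m K = o.
  have sz : (size Vs)%:R != 0 :> R.
    have := (hVs _).2 (fr_V fr); case: (Vs) => // v l _.
    by rewrite pnatr_eq0.
  have sE : \sum_(v <- Vs) lor v 1 = (size Vs)%:R *: o.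
    by rewrite sumE sum0 lorZ scaler0 mulr1.
  have : (\sum_(v <- Vs) lor v 1) *m K = \sum_(v <- Vs) lor v 1.
    rewrite mulmx_suml -(big_map (fun v => lor v 1 *m K) predT id).
    rewrite -[RHS](big_map (fun v => lor v 1) predT id).
    apply: perm_big; apply: uniq_perm.
    - by rewrite map_inj_uniq // => v w /KK/lor_inj[].
    - by rewrite map_inj_uniq // => v w /lor_inj[].
    move=> x; apply/mapP/mapP => [[v vs ->]|[w ws ->]].
      by have [w Vw e1] := to v ((hVs v).1 vs); exists w => //; exact/hVs.
    by have [v Vv e1] := from w ((hVs w).1 ws); exists v => //; exact/hVs.
  by rewrite sE -scalemxAl => /(scalerI sz).
pose O := @ulsubmx R 3 1 3 1 K.
have aK (a : 'rV[R]_3) t : lor a t *m K = lor (a *m O) t.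
  have a0 : exists b, lor a 0 *m K = lor b 0.
    have [b [t' bE]] := lor_surj (lor a 0 *m K); exists b; rewrite bE; congr lor.
    have := lorentz_form (lor a 0) o hK; rewrite oK bE !form_lor !dot0r; lra.
  have [b bE] := a0.
  have bO : b = a *m O.
    move: bE; rewrite -[K](@submxK _ 3 1 3 1) /lor (@mul_row_block _ _ 3 1 3 1).
    by rewrite raddf0 !mul0mx !addr0 => /(@eq_row_mx _ 1 3 1)[<-].
  have -> : lor a t = lor a 0 + t *: o by rewrite lorZ lorD scaler0 addr0 mulr1 add0r.
  by rewrite mulmxDl -scalemxAl oK bE bO lorZ lorD scaler0 addr0 mulr1 add0r.
have KE : K = isom4 O.
  apply: (mx_act_inj 1%:M) => x; have [a [t ->]] := lor_surj x.
  by rewrite aK isom4_act.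
have hO : O *m O^T = 1%:M.
  apply: (mx_act_inj (1%:M : 'M[R]_4)) => a; apply: dot_inj => b.
  have := lorentz_form (lor a 0) (lor b 0) hK; rewrite !aK !form_lor !mulr0 !subr0.
  by rewrite mulmx1 mulmxA => <-; rewrite dot_mulmx trmxK.
exists O => //; apply/(sym_verticesP fr).
have VO x : V x -> V (x *m O).
  by move=> /to[y Vy]; rewrite aK => /lor_inj[->].
apply: symI => // y /from[x Vx]; rewrite aK => /lor_inj[<- _].
by rewrite orth_mulmxV.
Qed.

(** It suffices to realise the three reflections generating the isometries. *)
Lemma ex_isom4_moebius O : is_symmetry P O ->
  exists2 g, moebius g & represents g (conjT (isom4 O)).
Proof.
move=> /sym_vertices /(mirror_group_full fr) mO.
elim: mO => [|_ [[->|->]|->]|O1 O2 _ [g1 m1 h1] _ [g2 m2 h2]|O1 O2 _ [g mg rg] e1 e2].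
- by exists id; [exact: generated_one|rewrite isom4_1 conjT1; exact: rep_id].
- rewrite (isom4_reflection (fr_r1 fr)) conjT_lrefl.
  have [|g mg [_ rg]] := @ex_inversion R (lor k 0 *m T); last by exists g.
  by rewrite lorentz_form // form_lor mulr0 subr0.
- rewrite (isom4_reflection (fr_r2 fr)) conjT_lrefl; set w := e - _ - _.
  have [|g mg [_ rg]] := @ex_inversion R (lor w 0 *m T); last by exists g.
  rewrite lorentz_form // form_lor mulr0 subr0 dot_gt0.
  exact: wall_neq0 fr _ _ (wall2 _ _ _ _ _ _).
- rewrite (isom4_reflection (fr_r3 fr)) conjT_lrefl.
  have [|g mg [_ rg]] := @ex_inversion R (lor m 0 *m T); last by exists g.
  by rewrite lorentz_form // form_lor mulr0 subr0 dot_gt0 (fr_m0 fr).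
- exists (g2 \o g1); first exact: generated_mul.
  by rewrite isom4_mul conjT_mul; apply: rep_comp.
- have [h [M [rM gh hg mh]]] := moebius_rep mg; exists h => //.
  have -> : conjT (isom4 O2) = linv (conjT (isom4 O1)).
    have hK : lorentz (conjT (isom4 O1)) by case: rg.
    rewrite -[LHS]mul1mx -(linv_mulmx hK) -mulmxA -conjT_mul -isom4_mul e1.
    by rewrite isom4_1 conjT1 mulmx1.
  exact: rep_inverse rg gh.
Qed.

Lemma isom4_moebius f O : is_symmetry P O -> represents f (conjT (isom4 O)) ->
  moebius f.
Proof.
by move=> /ex_isom4_moebius[g mg rg] rf; rewrite (rep_fun rf rg).
Qed.

Lemma sym_gr_isom4 f O : is_symmetry P O -> represents f (conjT (isom4 O)) ->
  sym_gr f.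
Proof.
move=> sO rf; have mf := isom4_moebius sO rf; split=> //.
have [g [M [rM fg gf _]]] := moebius_rep mf.
have fcap v : f @` cap (lor v 1 *m T) = cap (lor (v *m O) 1 *m T).
  by rewrite (cap_image _ rf fg gf) act_conjT isom4_act.
apply/seteqP; split=> [_ [_ /arrangementP[v Vv ->] <-]|D /arrangementP[v Vv ->]].
  by rewrite fcap; apply/arrangementP; exists (v *m O) => //; apply: sym_vertex.
exists (cap (lor (v *m O^T) 1 *m T)).
  by apply/arrangementP; exists (v *m O^T) => //; apply: sym_vertex => //; apply: sym_tr.
by rewrite fcap orth_mulmxVr // sO.1.
Qed.

Lemma sym_grP f : sym_gr f <->
  exists2 O, is_symmetry P O & represents f (conjT (isom4 O)).
Proof.
split=> [[mf arr]|[ O sO rf]]; last exact: sym_gr_isom4 rf.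
have [g [M [rM fg gf _]]] := moebius_rep mf; have [hM _] := rM.
have [K KE] : exists K, K = T *m M *m linv T by eexists.
have hK : lorentz K by rewrite KE; do 2?apply: lorentz_mul => //; apply: lorentz_linv.
have MK : M = conjT K.
  rewrite /conjT KE !mulmxA linv_mulmx // mul1mx -mulmxA linv_mulmx // mulmx1.
  by [].
have fcap v : f @` cap (lor v 1 *m T) = cap (lor v 1 *m K *m T).
  by rewrite (cap_image _ rM fg gf) MK act_conjT.
have same v w : V v -> V w -> cap (lor v 1 *m K *m T) = cap (lor w 1 *m T) ->
    lor v 1 *m K = lor w 1.
  move=> Vv Vw cvw.
  have [||c c0 wE] := cap_inj _ _ cvw; rewrite ?lorentz_form ?form_vertex //.
  have {}wE : lor w 1 = c *: (lor v 1 *m K).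
    rewrite -[LHS]mulmx1 -[X in c *: X]mulmx1 -(mulmx_linv hT) !mulmxA wE.
    by rewrite -scalemxAl.
  have := form_vertex Vw; rewrite wE !formx lorentz_form // form_vertex // mulrA => h.
  have /eqP : (c - 1) * (c + 1) = 0.
    by apply: (mulIf (lt0r_neq0 kk)); rewrite mul0r -subr_sqr_1 mulrBl expr2 h mul1r subrr.
  rewrite mulf_eq0 subr_eq0 addr_eq0 => /orP[/eqP ->|/eqP c1]; first by rewrite scale1r.
  by exfalso; move: c0; rewrite c1; lra.
have [||O sO KO] := permute_isom4 hK.
- move=> v Vv; have : arrangement mu P (f @` cap (lor v 1 *m T)).
    by rewrite -arr; exists (cap (lor v 1 *m T)) => //; apply/arrangementP; exists v.
  by move=> /arrangementP[w Vw]; rewrite fcap => /same h; exists w => //; apply: h.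
- move=> w Vw; have : arrangement mu P (cap (lor w 1 *m T)) by apply/arrangementP; exists w.
  rewrite -arr => -[_ /arrangementP[v Vv ->]]; rewrite fcap => /same h.
  by exists v => //; apply: h.
by exists O => //; rewrite -KO -MK.
Qed.

End FunctionGroups.

(** * The integral matrices *)

Section Matrices.
Variables (R : realType) (p q : nat).
Local Notation wp := (omega R p).
Local Notation wq := (omega R q).
Local Notation Z := (Zadjoin wp wq).

Lemma Zadj1 : Z 1. Proof. by move=> A []. Qed.
Lemma Zadj_p : Z wp. Proof. by []. Qed.
Lemma Zadj_q : Z wq. Proof. by []. Qed.

Lemma ZadjB x y : Z x -> Z y -> Z (x - y).
Proof. by move=> hx hy A cA pA qA; have [_ h _] := cA; apply: h; [exact: hx|exact: hy]. Qed.

Lemma ZadjM x y : Z x -> Z y -> Z (x * y).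
Proof. by move=> hx hy A cA pA qA; have [_ _ h] := cA; apply: h; [exact: hx|exact: hy]. Qed.

Lemma Zadj0 : Z 0. Proof. by rewrite -(subrr 1); apply: ZadjB; exact: Zadj1. Qed.
Lemma ZadjN x : Z x -> Z (- x).
Proof. by move=> hx; rewrite -sub0r; apply: ZadjB => //; exact: Zadj0. Qed.
Lemma ZadjD x y : Z x -> Z y -> Z (x + y).
Proof. by move=> hx hy; rewrite -[y]opprK; apply: ZadjB => //; exact: ZadjN. Qed.
Lemma ZadjX x j : Z x -> Z (x ^+ j).
Proof.
by move=> hx; elim: j => [|j IH]; rewrite ?expr0 ?exprS; [exact: Zadj1|exact: ZadjM].
Qed.
Lemma Zadj2 : Z 2. Proof. by rewrite mulr2n; apply: ZadjD; exact: Zadj1. Qed.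

Ltac zadj := repeat first [exact: Zadj0|exact: Zadj1|exact: Zadj2|exact: Zadj_p
  |exact: Zadj_q|apply: ZadjD|apply: ZadjM|apply: ZadjN|apply: ZadjX].

Ltac entries i j := case: i => [[|[|[|[|//]]]] ?]; case: j => [[|[|[|[|//]]]] ?].

Definition gens_mx : set 'M[R]_4 := [set R1mx R p q; R2mx R p q; R3mx R p q; Sfmx R p q].

Lemma gens_entries X : gens_mx X -> forall i j, Z (X i j).
Proof.
by move=> [[[->|->]|->]|->] i j; entries i j; rewrite !mxE /=; zadj.
Qed.

(** Self-adjointness, which for an involution is invariance of the form. *)
Lemma gens_adjoint X : gens_mx X -> X^T *m Qmx R p q = Qmx R p q *m X.
Proof.
rewrite /gens_mx /Qmx /R1mx /R2mx /R3mx /Sfmx; move: wp wq => x y.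
by move=> [[[->|->]|->]|->]; apply/matrixP => i j;
  rewrite !(mxE, big_ord_recl, big_ord0); entries i j; rewrite /=; ring.
Qed.

(** The generators being involutions, the induction can carry along an inverse
    with the same properties; no division occurs. *)
Lemma matrix_group_props :
  (forall X, gens_mx X -> X *m X = 1%:M) ->
  forall X, matrix_group R p q X ->
    [/\ X^T *m Qmx R p q *m X = Qmx R p q, \det X = 1 \/ \det X = - 1 &
        forall i j, Z (X i j)].
Proof.
move=> invol X gX; pose good (X : 'M[R]_4) :=
  [/\ X^T *m Qmx R p q *m X = Qmx R p q, \det X = 1 \/ \det X = - 1 &
        forall i j, Z (X i j)].
suff [Y [_ _ //]] : exists Y, [/\ X *m Y = 1%:M, Y *m X = 1%:M, good X & good Y].
have mulZ (A B : 'M[R]_4) : (forall i j, Z (A i j)) -> (forall i j, Z (B i j)) ->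
    forall i j, Z ((A *m B) i j).
  by move=> hA hB i j; rewrite mxE !big_ord_recl big_ord0; zadj; rewrite ?hA ?hB.
have good_mul A B : good A -> good B -> good (A *m B).
  move=> [fA dA zA] [fB dB zB]; split; [| |exact: mulZ].
    by rewrite trmx_mul !mulmxA -(mulmxA _ A^T) -(mulmxA _ _ A) fA.
  rewrite det_mulmx; case: dA dB => -> [|] ->; rewrite ?mulr1 ?mul1r ?mulrNN ?mulr1; tauto.
elim: gX => [|Y gY|A B _ [A' [a1 a2 gA gA']] _ [B' [b1 b2 gB gB']]
    |A B _ [A' [a1 a2 gA gA']] e1 e2].
- have g1 : good 1%:M.
    split; [by rewrite trmx1 mul1mx mulmx1|by left; exact: det1|].
    by move=> i j; rewrite mxE; case: eqP => _; [exact: Zadj1|exact: Zadj0].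
  by exists 1%:M; rewrite mulmx1.
- have gg : good Y.
    split; [by rewrite (gens_adjoint gY) -mulmxA invol // mulmx1| |exact: gens_entries].
    have := congr1 (fun M => \det M) (invol Y gY); rewrite det_mulmx det1 => h.
    have /eqP : (\det Y - 1) * (\det Y + 1) = 0 by move: h; lra.
    by rewrite mulf_eq0 subr_eq0 addr_eq0 => /orP[/eqP|/eqP]; [left|right].
  by exists Y; rewrite invol.
- exists (B' *m A'); split; [| |exact: good_mul|exact: good_mul].
    by rewrite mulmxA -(mulmxA A) b1 mulmx1.
  by rewrite mulmxA -(mulmxA B') a2 mulmx1.
- have -> : B = A' by rewrite -[LHS]mul1mx -a2 -mulmxA e1 mulmx1.
  by exists A; split.
Qed.

End Matrices.

(** * The basis of the matrix representation *)

Section Basis.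
Variables (R : realType) (p q : nat) (P : set 'rV[R]_3) (e k m : 'rV[R]_3)
  (r1 r2 r3 : 'M[R]_3).
Hypothesis fr : frame p q P e k m r1 r2 r3.
Hypotheses (hp : p \in [:: 3; 4; 5]%N) (hq : q \in [:: 3; 4; 5]%N).
Local Notation wp := (omega R p).
Local Notation wq := (omega R q).
Local Notation S := (wp + wq).
Local Notation n := (e + m).
Local Notation w := (e - (dot k k)^-1 *: k - (dot m m)^-1 *: m).

Let ee := fr_ee fr.
Let ek := fr_ek fr.
Let em := fr_em fr.
Let km := fr_km fr.
Let k0 := fr_k0 fr.
Let m0 := fr_m0 fr.

Let cp : cosp k m = 1 + wp := frame_cosp fr hp.
Let cq : cosq k m = 1 + wq := frame_cosq fr hq.
Let cp0 : 0 < 1 + wp. Proof. by rewrite -cp cosp_gt0. Qed.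
Let cq0 : 0 < 1 + wq. Proof. by rewrite -cq cosq_gt0. Qed.

Let mmE : (1 + wq) * dot m m = 2 - S.
Proof.
have mm : dot m m != 0 by rewrite dot_eq0.
have -> : 2 - S = 4 - cosp k m - cosq k m by rewrite cp cq; ring.
have AB : 0 < 1 + (dot k k)^-1 + (dot m m)^-1.
  by rewrite !addr_gt0 ?invr_gt0 ?dot_gt0 ?k0 ?m0.
rewrite -cq /cosp /cosq.
transitivity (4 * ((dot m m)^-1 * dot m m) / (1 + (dot k k)^-1 + (dot m m)^-1)).
  by ring.
rewrite mulVf //; move: AB; move: (dot k k)^-1 (dot m m)^-1 => A B AB.
by field; rewrite gt_eqF.
Qed.

Let S2 : 0 < 2 - S.
Proof. by rewrite -mmE mulr_gt0 // dot_gt0. Qed.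

Definition lvec (x y z s : R) : 'rV[R]_4 := lor (vec e k m x y z) s.

Lemma lvecD x y z s x' y' z' s' :
  lvec x y z s + lvec x' y' z' s' = lvec (x + x') (y + y') (z + z') (s + s').
Proof. by rewrite /lvec lorD vecD. Qed.

Lemma lvecZ c x y z s : c *: lvec x y z s = lvec (c * x) (c * y) (c * z) (c * s).
Proof. by rewrite /lvec lorZ vecZ. Qed.

Lemma lvecN x y z s : - lvec x y z s = lvec (- x) (- y) (- z) (- s).
Proof. by rewrite /lvec lorN vecN. Qed.

Lemma lvec_surj (a : 'rV[R]_4) : exists x y z s, a = lvec x y z s.
Proof.
have [b [s ->]] := lor_surj a.
rewrite {1}(frame_expand ee ek em km k0 m0 b).
by exists (dot b e), ((dot k k)^-1 * dot b k), ((dot m m)^-1 * dot b m), s.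
Qed.

Lemma form_lvec x y z s x' y' z' s' : form (lvec x y z s) (lvec x' y' z' s') =
  x * x' + y * y' * dot k k + z * z' * dot m m - s * s'.
Proof. by rewrite /lvec form_lor dot_vec. Qed.

Lemma lvec_refl1 x y z s : lvec x y z s *m lrefl (lor k 0) = lvec x (- y) z s.
Proof.
by rewrite -(isom4_reflection (fr_r1 fr)) isom4_act (vec_r1 ee ek em km k0 (fr_r1 fr)).
Qed.

Lemma lvec_refl2 x y z s : lvec x y z s *m lrefl (lor w 0) =
  lvec (x - (2 - S) * ((x - y - z) / 2)) (y + (1 + wp) * ((x - y - z) / 2))
    (z + (1 + wq) * ((x - y - z) / 2)) s.
Proof.
rewrite -(isom4_reflection (fr_r2 fr)) isom4_act.
rewrite (vec_r2 ee ek em km k0 m0 (fr_r2 fr)) cp cq.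
by have -> : 4 - (1 + wp) - (1 + wq) = 2 - S by ring.
Qed.

Lemma lvec_refl3 x y z s : lvec x y z s *m lrefl (lor m 0) = lvec x y (- z) s.
Proof.
by rewrite -(isom4_reflection (fr_r3 fr)) isom4_act (vec_r3 ee ek em km m0 (fr_r3 fr)).
Qed.

Lemma lvec_refl4 x y z s : lvec x y z s *m lrefl (lor n 1) =
  lvec x y z s - lvec (2 * ((x - s) * ((1 + wq) / (2 - S)) + z)) 0
    (2 * ((x - s) * ((1 + wq) / (2 - S)) + z))
    (2 * ((x - s) * ((1 + wq) / (2 - S)) + z)).
Proof.
set h := 2 * _.
have nE : lor n 1 = lvec 1 0 1 1 by rewrite /lvec (vec_n e k m).
rewrite lrefl_act nE !form_lvec lvecZ.
have mm : dot m m = (2 - S) / (1 + wq).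
  by rewrite -mmE mulrAC mulfV ?mul1r // gt_eqF.
have hE : 2 * (x * 1 + y * 0 * dot k k + z * 1 * dot m m - s * 1) /
    (1 * 1 + 0 * 0 * dot k k + 1 * 1 * dot m m - 1 * 1) = h.
  rewrite mm /h; move: (2 - S) (1 + wq) (gt_eqF S2) (gt_eqF cq0) => d c /negbT d0 /negbT c0.
  by field; rewrite d0 c0.
by rewrite hE !mulr1 mulr0.
Qed.

(** Each integral matrix minus the identity has rank one, and the four columns
    spanning these images form a triangular matrix. The rows below solve the
    triangular system that takes them, by the transpose of that matrix, to
    suitable multiples of the mirror vectors. *)
Definition basis_rows : seq 'rV[R]_4 :=
  [:: lvec (S - 1) (- (1 + wp)) wq 1; lvec (- 1) (1 + wp) wp (1 - S);
      lvec (1 - S) 0 (- 1 - S) (1 - S); lvec 1 0 1 1].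

Definition basis_mx : 'M[R]_4 := \matrix_(i < 4) basis_rows`_i.

Lemma basis_unit : basis_mx \in unitmx.
Proof.
rewrite -unitmx_tr -row_free_unit -kermx_eq0; apply/eqP/row_matrixP => i.
rewrite row0; move: (row i _) (row_sub i (kermx basis_mx^T)) => r /sub_kermxP rB.
have rb (j : 'I_4) : form (r *m J4 R) basis_rows`_j = 0.
  move/matrixP: rB => /(_ 0 j); rewrite mxE [RHS]mxE => <-.
  rewrite /form -mulmxA J4_inv mulmx1 dotE; apply: eq_bigr => l _.
  by rewrite !mxE.
suff r'0 : r *m J4 R = 0 by rewrite -[r]mulmx1 -J4_inv mulmxA r'0 mul0mx.
have [x [y [z [s rE]]]] := lvec_surj (r *m J4 R); rewrite rE in rb *.
have := rb (Ordinal (isT : 0 < 4)%N); have := rb (Ordinal (isT : 1 < 4)%N).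
have := rb (Ordinal (isT : 2 < 4)%N); have := rb (Ordinal (isT : 3 < 4)%N).
rewrite /= !form_lvec => b4 b3 b2 b1.
have mm : 0 < dot m m by rewrite dot_gt0.
have kk : 0 < dot k k by rewrite dot_gt0.
have z0 : z = 0.
  apply: (mulIf (lt0r_neq0 mm)); rewrite mul0r.
  have : (1 - S) * (x + z * dot m m - s) = 0.
    by transitivity ((1 - S) * (x * 1 + y * 0 * dot k k + z * 1 * dot m m - s * 1));
      [ring|rewrite b4 mulr0].
  by move: b3; lra.
have xs : x = s by move: b4; rewrite z0; lra.
have x0 : x = 0.
  have /eqP : (2 - S) * x = 0.
    by move: b1 b2; rewrite z0 -xs; lra.
  by rewrite mulf_eq0 gt_eqF //= => /eqP.
have y0 : y = 0.
  have /eqP : y * ((1 + wp) * dot k k) = 0.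
    by move: b2; rewrite z0 -xs x0; lra.
  by rewrite mulf_eq0 orbC gt_eqF ?mulr_gt0 //= => /eqP.
by rewrite -xs x0 y0 z0 /lvec /vec !scale0r !addr0 lor0.
Qed.

(** In frame coordinates the reflections involve only [cosp] and [cosq], that
    is, [wp] and [wq], so that each row gives polynomial identities. *)
Lemma basis_gens :
  [/\ (R1mx R p q)^T *m basis_mx = basis_mx *m lrefl (lor k 0),
      (R2mx R p q)^T *m basis_mx = basis_mx *m lrefl (lor w 0),
      (R3mx R p q)^T *m basis_mx = basis_mx *m lrefl (lor m 0) &
      (Sfmx R p q)^T *m basis_mx = basis_mx *m lrefl (lor n 1)].
Proof.
have S0 : 2 - S != 0 by rewrite gt_eqF.
have rowE (X : 'M[R]_4) (i : 'I_4) : row i (X^T *m basis_mx) =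
    \sum_l X l i *: basis_rows`_l.
  rewrite row_mul mulmx_sum_row; apply: eq_bigr => l _.
  by rewrite rowK !mxE.
split; apply/row_matrixP => i; rewrite rowE row_mul rowK !big_ord_recl big_ord0 addr0 !mxE;
  case: i => [[|[|[|[|//]]]] ?]; rewrite /= ?(lvec_refl1, lvec_refl2, lvec_refl3, lvec_refl4)
  !(lvecZ, lvecN, lvecD); congr lvec; by field.
Qed.

(** The transposition makes up for the row action, which reverses composition. *)
Definition represent (M : 'M[R]_4) : 'M[R]_4 :=
  (basis_mx *m M *m invmx basis_mx)^T.

Lemma represent1 : represent 1%:M = 1%:M.
Proof. by rewrite /represent mulmx1 mulmxV ?basis_unit // trmx1. Qed.

Lemma represent_mul M N : represent (M *m N) = represent N *m represent M.
Proof.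
rewrite /represent -trmx_mul !mulmxA; congr (_^T).
by rewrite -(mulmxA _ (invmx _)) mulVmx ?basis_unit // mulmx1.
Qed.

Lemma represent_inj : injective represent.
Proof.
move=> M N /trmx_inj h; have uB := basis_unit.
have := congr1 (fun X => invmx basis_mx *m (X *m basis_mx)) h.
by rewrite -!mulmxA mulVmx // !mulmx1 !mulmxA mulVmx // !mul1mx.
Qed.

Lemma represent_of X M : X^T *m basis_mx = basis_mx *m M -> represent M = X.
Proof.
by move=> h; rewrite /represent -h -mulmxA mulmxV ?basis_unit // mulmx1 trmxK.
Qed.

Lemma gens_represent X : @gens_mx R p q X <-> exists2 M, gens4 e k m M & X = represent M.
Proof.
have [/represent_of e1 /represent_of e2 /represent_of e3 /represent_of e4] := basis_gens.
split=> [[[[->|->]|->]|->]|[M [[[->|->]|->]|->] ->]].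
- by exists (lrefl (lor k 0)); first by do 3!left.
- by exists (lrefl (lor w 0)); first by do 2!left; right.
- by exists (lrefl (lor m 0)); first by left; right.
- by exists (lrefl (lor n 1)); first by right.
- by rewrite e1; do 3!left.
- by rewrite e2; do 2!left; right.
- by rewrite e3; left; right.
- by rewrite e4; right.
Qed.

Lemma matrix_groupP X : matrix_group R p q X <->
  exists2 M, full_group e k m M & X = represent M.
Proof.
split.
- elim=> [|Y /gens_represent[M gM ->]|_ _ _ [M1 h1 ->] _ [M2 h2 ->]|A B _ [M hM ->] e1 e2].
  + by exists 1%:M; [exact: generated_one|rewrite represent1].
  + by exists M => //; apply: generated_base.
  + by exists (M2 *m M1); [exact: generated_mul|rewrite represent_mul].
  + have hL := full_group_lorentz fr hM; exists (linv M).
      by apply: (generated_inv hM); [exact: mulmx_linv|exact: linv_mulmx].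
    by rewrite -[LHS]mul1mx -represent1 -(mulmx_linv hL) represent_mul -mulmxA e1 mulmx1.
- move=> [M hM ->]; elim: hM => [|N gN|M1 M2 _ h1 _ h2|M1 M2 _ h1 e1 e2].
  + by rewrite represent1; exact: generated_one.
  + by apply: generated_base; apply/gens_represent; exists N.
  + by rewrite represent_mul; exact: generated_mul.
  + by apply: (generated_inv h1); rewrite -represent_mul ?e1 ?e2 represent1.
Qed.

Lemma gens_invol X : @gens_mx R p q X -> X *m X = 1%:M.
Proof.
move=> /gens_represent[M gM ->]; rewrite -represent_mul -represent1; congr represent.
case: gM => [[[->|->]|->]|->]; apply: lrefl_inv.
- by rewrite form_lor mulr0 subr0 dot_eq0.
- rewrite form_lor mulr0 subr0 dot_eq0; exact: wall_neq0 fr _ _ (wall2 _ _ _ _ _ _).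
- by rewrite form_lor mulr0 subr0 dot_eq0.
- by apply: (form_dual_neq0 fr); exact: fr_U fr.
Qed.

End Basis.

(** * The full symmetry group *)

Section FullSymmetryGroup.
Variables (R : realType) (p q : nat) (P : set 'rV[R]_3) (e k m : 'rV[R]_3)
  (r1 r2 r3 : 'M[R]_3).
Hypothesis fr : frame p q P e k m r1 r2 r3.
Hypotheses (hp : p \in [:: 3; 4; 5]%N) (hq : q \in [:: 3; 4; 5]%N).
Local Notation ext := (extended_plane R).
Local Notation o := (lor 0 1 : 'rV[R]_4).
Variables (mu nu : ext -> ext) (T : 'M[R]_4).
Hypotheses (rT : represents mu T) (mn : mu \o nu = id) (nm : nu \o mu = id).
Local Notation inv_gr := (inversion_group (arrangement mu (polar P))).
Local Notation sym_gr := (symmetry_group (arrangement mu P)).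
Local Notation conj := (conjT T).

(** Elements of the symmetry group fix the centre of the ball, while nontrivial
    elements of the inversion group move it. *)
Lemma semidirect_groups : semidirect inv_gr sym_gr.
Proof.
split=> [g h Ng Hh|].
  have [_ [K dK rg]] := inv_gr_rep fr rT mn nm Ng.
  have [ O sO rh] := (sym_grP fr rT mn nm h).1 Hh.
  have [g' Ng' rg'] := dual_group_inv_gr fr rT mn nm (dual_group_conj sO dK).
  exists g' => //; apply: rep_fun (rep_comp rh rg) _.
  have := rep_comp rg' rh; rewrite -!(conjT_mul rT) !mulmxA isom4_trK ?sO.1 // mul1mx.
  by [].
apply/seteqP; split=> [f [Nf Hf]|_ ->]; last first.
  split; first exact: generated_one.
  split; first exact: generated_one.
  by rewrite -[RHS]image_id; apply: eq_imagel => D _; exact: image_id.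
have [_ [K dK rf]] := inv_gr_rep fr rT mn nm Nf.
have [ O sO rf'] := (sym_grP fr rT mn nm f).1 Hf.
have KO := conjT_inj rT (rep_mx rf rf').
have [K1|[u Uu]] := dual_group_moves fr dK.
  by apply: (rep_fun rf); rewrite K1 (conjT1 rT); exact: rep_id.
by rewrite KO isom4_act mul0mx form_lor dot0l; lra.
Qed.

Lemma full_symmetry_groupP f : full_symmetry_group mu P f <->
  exists2 M, full_group e k m M & represents f (conj M).
Proof.
split=> [[g Ng [h Hh <-]]|[M /(full_groupP fr)[ O [K [sO dK ->]]] rf]].
  have [_ [K dK rg]] := inv_gr_rep fr rT mn nm Ng.
  have [ O sO rh] := (sym_grP fr rT mn nm h).1 Hh.
  exists (isom4 O *m K); first by apply/(full_groupP fr); exists O, K.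
  by rewrite (conjT_mul rT); apply: rep_comp.
have [g Ng rg] := dual_group_inv_gr fr rT mn nm dK.
have [h mh rh] := ex_isom4_moebius fr rT sO.
exists g => //; exists h; first by apply/(sym_grP fr rT mn nm); exists O.
by apply: rep_fun rf; rewrite (conjT_mul rT); apply: rep_comp.
Qed.

(** By [rep_mx] there is no choice of the matrix for a Moebius transformation. *)
Definition rho f := represent p q e k m (T *m xget 1%:M [set M | represents f M] *m linv T).

Lemma rhoE f M : represents f (conj M) -> rho f = represent p q e k m M.
Proof.
move=> rf; rewrite /rho; congr represent.
have hT := rT.1; have rX : represents f (xget 1%:M [set M | represents f M]).
  by apply: (@xgetPex _ 1%:M [set M | represents f M]); exists (conj M).
rewrite (rep_mx rX rf) /conjT !mulmxA mulmx_linv // mul1mx -mulmxA mulmx_linv //.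
by rewrite mulmx1.
Qed.

Lemma rho_comp f g : full_symmetry_group mu P f -> full_symmetry_group mu P g ->
  rho (f \o g) = rho f *m rho g.
Proof.
move=> /full_symmetry_groupP[M hM rf] /full_symmetry_groupP[N hN rg].
have := rep_comp rf rg; rewrite -(conjT_mul rT) => /rhoE ->.
by rewrite (rhoE rf) (rhoE rg) (represent_mul fr hp hq).
Qed.

Lemma rho_inj : set_inj (full_symmetry_group mu P) rho.
Proof.
move=> f g /set_mem /full_symmetry_groupP[M hM rf] /set_mem /full_symmetry_groupP[N hN rg].
rewrite (rhoE rf) (rhoE rg) => /(represent_inj fr hp hq) MN.
by apply: rep_fun rf _; rewrite MN.
Qed.

Lemma rho_image : rho @` full_symmetry_group mu P = matrix_group R p q.
Proof.
apply/seteqP; split=> [_ [f /full_symmetry_groupP[M hM rf] <-]|X].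
  by apply/(matrix_groupP fr hp hq); exists M => //; exact: rhoE.
move=> /(matrix_groupP fr hp hq)[M hM ->].
have [ O [K [sO dK MK]]] := (full_groupP fr M).1 hM.
have [g Ng rg] := dual_group_inv_gr fr rT mn nm dK.
have [h mh rh] := ex_isom4_moebius fr rT sO.
have rgh : represents (g \o h) (conj M).
  by rewrite MK (conjT_mul rT); apply: rep_comp.
exists (g \o h); last exact: rhoE.
by apply/full_symmetry_groupP; exists M.
Qed.

End FullSymmetryGroup.

Section Discreteness.
Variable R : realType.

Lemma continuous_sum (T : topologicalType) (I : Type) (r : seq I) (F : I -> T -> R) :
  (forall i, continuous (F i)) -> continuous (fun X => \sum_(i <- r) F i X).
Proof.
move=> h; apply: continuous_big => [|i _]; last exact: h.
exact: add_continuous.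
Qed.

Lemma continuous_mul (T : topologicalType) (f g : T -> R) :
  continuous f -> continuous g -> continuous (fun X => f X * g X).
Proof. by move=> hf hg X; apply: continuousM; [exact: hf|exact: hg]. Qed.

Lemma continuous_entry (A B : 'M[R]_4) (i j : 'I_4) :
  continuous (fun X : 'M[R]_4 => (A *m X *m B) i j).
Proof.
have -> : (fun X : 'M[R]_4 => (A *m X *m B) i j) =
    (fun X => \sum_l (\sum_l' A i l' * X l' l) * B l j).
  by apply/funext => Y; rewrite mxE; apply: eq_bigr => l _; rewrite mxE.
apply: continuous_sum => l; apply: continuous_mul; last exact: cst_continuous.
apply: continuous_sum => l'; apply: continuous_mul; first exact: cst_continuous.
exact: coord_continuous.
Qed.

Lemma continuous_displacement (A B : 'M[R]_4) (x : 'rV[R]_4) :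
  continuous (fun X : 'M[R]_4 => dot (x *m (A *m X *m B)^T - x) (x *m (A *m X *m B)^T - x)).
Proof.
have -> : (fun X : 'M[R]_4 =>
    dot (x *m (A *m X *m B)^T - x) (x *m (A *m X *m B)^T - x)) =
    (fun X => \sum_i ((\sum_j x 0 j * (A *m X *m B) i j) - x 0 i) ^+ 2).
  apply/funext => Y; rewrite dotE; apply: eq_bigr => i _; rewrite -expr2; congr (_ ^+ 2).
  by rewrite !mxE; congr (_ - _); apply: eq_bigr => j _; rewrite [_^T _ _]mxE.
have lin i : continuous (fun X : 'M[R]_4 => (\sum_j x 0 j * (A *m X *m B) i j) - x 0 i).
  move=> X; apply: continuousB; last exact: cst_continuous.
  apply: continuous_sum => j; apply: continuous_mul; first exact: cst_continuous.
  exact: continuous_entry.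
by apply: continuous_sum => i; apply: continuous_mul; exact: lin.
Qed.

End Discreteness.

Theorem proposition2 (R : realType) (p q : nat)
    (hpq : (p, q) \in [:: (3, 3); (3, 4); (4, 3); (3, 5); (5, 3)]%N)
    (P : set 'rV[R]_3) (hP : canonical_realisation p q P)
    (mu : extended_plane R -> extended_plane R) (hmu : moebius mu) :
  [/\ semidirect (inversion_group (arrangement mu (polar P)))
                 (symmetry_group (arrangement mu P)),
      exists rho : (extended_plane R -> extended_plane R) -> 'M[R]_4,
        [/\ forall g h, full_symmetry_group mu P g ->
              full_symmetry_group mu P h -> rho (g \o h) = rho g *m rho h,
            set_inj (full_symmetry_group mu P) rho &
            rho @` full_symmetry_group mu P = matrix_group R p q],
      forall M, matrix_group R p q M ->
        [/\ M^T *m Qmx R p q *m M = Qmx R p q,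
            \det M = 1 \/ \det M = - 1 &
            forall i j, Zadjoin (omega R p) (omega R q) (M i j)] &
      matrix_group R p q `<=` isolated (matrix_group R p q)].
Proof.
have [hp hq] : p \in [:: 3; 4; 5]%N /\ q \in [:: 3; 4; 5]%N.
  by move: hpq; rewrite !inE => /or4P[|||/orP[]] /eqP[-> ->].
have q0 : (0 < q)%N by move: hq; rewrite !inE => /or3P[] /eqP ->.
have [[[[s Ps] _] _] _ _] := hP.
have [e [k [m [r1 [r2 [r3 fr]]]]]] : exists e k m r1 r2 r3, frame p q P e k m r1 r2 r3.
  by rewrite Ps in hP *; exact: regular_frame hP q0.
have [nu [T [rT mn nm _]]] := moebius_rep hmu.
split.
- exact: semidirect_groups fr _ _ _ rT mn nm.
- exists (rho p q e k m T); split.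
  + by move=> g h; apply: (rho_comp fr hp hq rT mn nm).
  + exact: rho_inj fr hp hq _ _ _ rT mn nm.
  + exact: rho_image fr hp hq _ _ _ rT mn nm.
- by apply: matrix_group_props; exact: gens_invol fr hp hq.
move=> X gX; split; first exact/mem_set.
have [M hM XE] := (matrix_groupP fr hp hq X).1 gX.
have [d [d0 hd]] := full_group_discrete fr.
have uB := basis_unit fr hp hq; set B := basis_mx p q e k m in uB.
have hL := full_group_lorentz fr hM.
(* the quotient of a nearby group element by [X], in Lorentz coordinates, is
   linear in that element *)
pose quot (Y : 'M[R]_4) := ((B *m linv M)^T *m Y *m (invmx B)^T)^T.
have quotE N : quot (represent p q e k m N) = N *m linv M.
  rewrite /quot /represent -/B !trmx_mul !trmxK !mulmxA mulVmx // mul1mx.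
  by rewrite -(mulmxA N) mulVmx // mulmx1.
have q1 : quot X = 1%:M by rewrite XE quotE mulmx_linv.
have near_X (x : 'rV[R]_4) :
    nbhs X [set Y | dot (x *m quot Y - x) (x *m quot Y - x) < d].
  have := @continuous_displacement R (B *m linv M)^T (invmx B)^T x X.
  rewrite /continuous_at -/(quot X) q1 mulmx1 subrr dot0l.
  by move=> /cvgr_lt; apply.
exists ([set Y | dot (lor 0 1 *m quot Y - lor 0 1) (lor 0 1 *m quot Y - lor 0 1) < d] `&`
    [set Y | dot (lor (chamber_point e k m) 0 *m quot Y - lor (chamber_point e k m) 0)
      (lor (chamber_point e k m) 0 *m quot Y - lor (chamber_point e k m) 0) < d]).
  by apply: filterI; exact: near_X.
apply/seteqP; split=> [Y [[Y1 Y2] /(matrix_groupP fr hp hq)[N hN YE]]|_ ->].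
  rewrite /= YE quotE in Y1 Y2.
  have N1 : N *m linv M = 1%:M.
    apply: hd Y1 Y2; apply: generated_mul => //.
    by apply: (generated_inv hM); [exact: mulmx_linv|exact: linv_mulmx].
  rewrite YE XE; congr represent; rewrite -[LHS]mulmx1 -(linv_mulmx hL) mulmxA N1.
  by rewrite mul1mx.
by split=> //; split; exact: nbhs_singleton (near_X _).
Qed.
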